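(* Let $n\ge1$. There exists a sequence of functions $\{u_m\}\subset\mathcal D_L$ with $d_0(u_m,M)>0$ such that $$\frac{LS(u_m)}{d_0^2(u_m,M)}\to0\quad\text{as }m\to\infty.$$
   Context: $\mathbb S^n\subset\mathbb R^{n+1}$ is the unit sphere, $d\omega$ is its (unnormalized) surface measure, $|\mathbb S^n|$ its total measure, $\|\cdot\|_2$ is the norm of $L^2(\mathbb S^n,d\omega)$, and $|\omega-\eta|$ is Euclidean distance in $\mathbb R^{n+1}$. $B^{n+1}=\{\xi\in\mathbb R^{n+1}:|\xi|<1\}$. Functions are real-valued. $$\mathcal D_L=\Big\{v\in L^2(\mathbb S^n):\iint_{\mathbb S^n\times\mathbb S^n}\frac{|v(\omega)-v(\eta)|^2}{|\omega-\eta|^n}\,d\omega\,d\eta<\infty\Big\}.$$ $$LS(u)=\iint_{\mathbb S^n\times\mathbb S^n}\frac{|u(\omega)-u(\eta)|^2}{|\omega-\eta|^n}\,d\omega\,d\eta-C_n\int_{\mathbb S^n}|u(\omega)|^2\ln\frac{|u(\omega)|^2|\mathbb S^n|}{\|u\|_2^2}\,d\omega,\qquad C_n=\frac4n\,\frac{\pi^{n/2}}{\Gamma(n/2)},$$ with the convention $0\ln0=0$. $$M=\{v_{c,\xi}(\omega)=c(1-\xi\cdot\omega)^{-n/2}:\ \xi\in B^{n+1},\ c\in\mathbb R\}.$$ $$d_0^2(u,v)=\iint_{\mathbb S^n\times\mathbb S^n}\frac{|u(\omega)-v(\omega)-u(\eta)+v(\eta)|^2}{|\omega-\eta|^n}\,d\omega\,d\eta,\qquad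 d_0(u,M)=\inf_{v\in M}d_0(u,v).$$ *)

(* Defs.v *)
From HB Require Import structures.
From mathcomp Require Import all_boot all_order all_algebra.
From mathcomp Require Import all_classical all_reals all_analysis.
From mathcomp Require Import measurable_realfun.

Set Implicit Arguments.
Unset Strict Implicit.
Unset Printing Implicit Defensive.

Import Order.TTheory GRing.Theory Num.Theory.
Import numFieldNormedType.Exports.

Local Open Scope classical_set_scope.
Local Open Scope ring_scope.

(* Points of R^k are k-tuples of reals, with the product sigma-algebra. *)
Notation euclid R k := (k.-tuple (measurableTypeR R)).

Section lebesgue_measure_tuple.
Context {R : realType}.
Local Open Scope ereal_scope.

Definition tcons k (p : measurableTypeR R * euclid R k) : euclid R k.+1 :=
  [tuple of p.1 :: p.2].

Definition tuncons k (x : euclid R k.+1) : measurableTypeR R * euclid R k :=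
  (tnth x ord0, [tuple of behead x]).

Lemma tconsK k : cancel (@tcons k) (@tuncons k).
Proof. by case=> a t; congr pair; apply/val_inj. Qed.

Lemma tunconsK k : cancel (@tuncons k) (@tcons k).
Proof. by move=> x; rewrite /tcons/= -tuple_eta. Qed.

Lemma measurable_tcons k : measurable_fun setT (@tcons k).
Proof. exact: measurable_cons. Qed.

Lemma measurable_tuncons k : measurable_fun setT (@tuncons k).
Proof.
apply/measurable_fun_pair; first exact: measurable_tnth.
exact: measurable_behead.
Qed.

Section cons_measure.
Variables (k : nat) (m : {sigma_finite_measure set (euclid R k) -> \bar R}).

Definition cons_measure (A : set (euclid R k.+1)) : \bar R :=
  (lebesgue_measure \x m) (@tcons k @^-1` A).

Let cons_measure0 : cons_measure set0 = 0.
Proof. by rewrite /cons_measure preimage_set0 measure0. Qed.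

Let cons_measure_ge0 A : 0 <= cons_measure A.
Proof. exact: measure_ge0. Qed.

Let cons_measure_sigma_additive : semi_sigma_additive cons_measure.
Proof.
have mpre (B : set (euclid R k.+1)) :
    measurable B -> measurable (@tcons k @^-1` B).
  by move=> mB; rewrite -[X in measurable X]setTI; exact: measurable_tcons.
move=> F mF tF mUF; rewrite /cons_measure preimage_bigcup.
apply: measure_semi_sigma_additive.
- by move=> i; exact: mpre.
- apply/trivIsetP => i j _ _ ij; rewrite -preimage_setI.
  by move/trivIsetP : tF => /(_ _ _ _ _ ij) ->//; rewrite preimage_set0.
- by rewrite -preimage_bigcup; exact: mpre.
Qed.

HB.instance Definition _ := isMeasure.Build _ _ _ cons_measure
  cons_measure0 cons_measure_ge0 cons_measure_sigma_additive.

Let cons_measure_sigma_finite : sigma_finite setT cons_measure.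
Proof.
have /sigma_finiteP[F [TF ndF Foo]] := sigma_finiteT (@lebesgue_measure R).
have /sigma_finiteP[G [TG ndG Goo]] := sigma_finiteT m.
exists (fun i => @tuncons k @^-1` (F i `*` G i)).
  rewrite -preimage_bigcup; apply/esym; rewrite -subTset => x _ /=.
  have [i _ Fi] : (\bigcup_i F i) (tuncons x).1 by rewrite -TF.
  have [j _ Gj] : (\bigcup_i G i) (tuncons x).2 by rewrite -TG.
  exists (maxn i j) => //; split.
    by move: (tuncons x).1 Fi; exact/subsetPset/ndF/leq_maxl.
  by move: (tuncons x).2 Gj; exact/subsetPset/ndG/leq_maxr.
move=> i; have [mF Fi] := Foo i; have [mG Gi] := Goo i; split.
  rewrite -[X in measurable X]setTI; apply: measurable_tuncons => //.
  exact: measurableX.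
rewrite /cons_measure (_ : _ @^-1` _ = F i `*` G i); last first.
  rewrite -comp_preimage (_ : _ \o _ = id) ?preimage_id//.
  by apply/funext => p; exact: tconsK.
by rewrite product_measure1E// lte_mul_pinfty// ge0_fin_numE.
Qed.

HB.instance Definition _ := Measure_isSigmaFinite.Build _ _ _ cons_measure
  cons_measure_sigma_finite.

End cons_measure.

(* k-dimensional Lebesgue measure, as an iterated product measure. *)
Fixpoint lebesgue_measuren (k : nat) :
    {sigma_finite_measure set (euclid R k) -> \bar R} :=
  match k with
  | 0 => \d_([tuple] : euclid R 0)
  | k'.+1 => cons_measure (lebesgue_measuren k')
  end.

End lebesgue_measure_tuple.

Section euclidean_geometry.
Context {R : realType} {k : nat}.
Implicit Types x y : euclid R k.

Definition dot x y : R := \sum_(i < k) tnth x i * tnth y i.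
Definition enorm x : R := Num.sqrt (dot x x).
Definition edist x y : R :=
  Num.sqrt (\sum_(i < k) (tnth x i - tnth y i) ^+ 2).

Definition unit_sphere : set (euclid R k) := [set x | enorm x = 1].
Definition unit_ball : set (euclid R k) := [set x | enorm x < 1].

(* The origin is sent to itself. *)
Definition normalize x : euclid R k := [tuple tnth x i / enorm x | i < k].

Let mcoord (i : 'I_k) : measurable_fun [set: euclid R k]
  (fun x => tnth x i : R).
Proof. exact: measurable_tnth. Qed.

Lemma measurable_enorm : measurable_fun setT (enorm : euclid R k -> R).
Proof.
have -> : enorm = (@powR R ^~ 2^-1) \o (fun x => dot x x).
  apply/funext => x /=; rewrite powR12_sqrt//.
  by apply: sumr_ge0 => i _; rewrite -expr2 sqr_ge0.
apply: measurableT_comp; first exact: measurable_powR.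
by apply: measurable_sum => i; apply: measurable_funM; exact: mcoord.
Qed.

Lemma measurable_normalize : measurable_fun setT normalize.
Proof.
apply/measurable_fun_tnthP => i.
rewrite (_ : _ \o _ =
    (fun x => tnth x i : R) \* ((@powR R ^~ (-1)) \o enorm)); last first.
  by apply/funext => x /=; rewrite tnth_mktuple powR_inv1// sqrtr_ge0.
apply: measurable_funM; first exact: mcoord.
apply: measurableT_comp; last exact: measurable_enorm.
exact: measurable_powR.
Qed.

Lemma measurable_unit_ball : measurable unit_ball.
Proof.
have -> : unit_ball = setT `&` enorm @^-1` `]-oo, 1[%classic.
  by apply/seteqP; split => x /=; rewrite in_itv/=; [split | case].
by apply: measurable_enorm => //; exact: measurable_itv.
Qed.

End euclidean_geometry.
Arguments unit_sphere R k : clear implicits.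
Arguments unit_ball R k : clear implicits.

Section surface_measure.
Context {R : realType} (n : nat).
Local Open Scope ereal_scope.

(* Surface measure of the unit sphere S^n of R^(n+1), by polar coordinates:
   the measure of A is n+1 times the volume of the cone
   {r w : 0 < r < 1, w in A}.  It is carried by S^n (up to the origin, which
   is negligible) and is seen as a measure on R^(n+1). *)
Definition surface_measure (A : set (euclid R n.+1)) : \bar R :=
  (n.+1%:R)%:E *
  lebesgue_measuren n.+1 (unit_ball R n.+1 `&` normalize @^-1` A).

Let mpre (A : set (euclid R n.+1)) : measurable A ->
  measurable (unit_ball R n.+1 `&` normalize @^-1` A).
Proof.
move=> mA; apply: measurableI; first exact: measurable_unit_ball.
by rewrite -[X in measurable X]setTI; exact: measurable_normalize.
Qed.

Let surface_measure0 : surface_measure set0 = 0.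
Proof. by rewrite /surface_measure preimage_set0 setI0 measure0 mule0. Qed.

Let surface_measure_ge0 A : 0 <= surface_measure A.
Proof. by rewrite mule_ge0// ?lee_fin// measure_ge0. Qed.

Let surface_measure_sigma_additive : semi_sigma_additive surface_measure.
Proof.
move=> F mF tF mUF; rewrite [X in X @ \oo --> _](_ : _ = (fun N =>
    (n.+1%:R)%:E * \sum_(0 <= i < N)
      lebesgue_measuren n.+1 (unit_ball R n.+1 `&` normalize @^-1` F i)));
  last by apply/funext => N; rewrite ge0_sume_distrr.
apply: cvgeZl => //.
rewrite preimage_bigcup setI_bigcupr.
apply: measure_semi_sigma_additive.
- by move=> i; exact: mpre.
- apply/trivIsetP => i j _ _ ij; rewrite setIACA -[X in _ `&` X]preimage_setI.
  by move/trivIsetP : tF => /(_ _ _ _ _ ij) ->//; rewrite preimage_set0 setI0.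
- by rewrite -setI_bigcupr -preimage_bigcup; exact: mpre.
Qed.

HB.instance Definition _ := isMeasure.Build _ _ _ surface_measure
  surface_measure0 surface_measure_ge0 surface_measure_sigma_additive.

End surface_measure.
Arguments surface_measure R n : clear implicits.

Definition Gamma {R : realType} (s : R) : R :=
  (\int[lebesgue_measure]_(t in `]0%R, +oo[) (t `^ (s - 1) * expR (- t)))%R.

(* Functions on S^n are represented by functions on R^(n+1), of which only the
   values on the sphere matter in what follows. *)
Section log_sobolev.
Context {R : realType} (n : nat).
Local Notation sphere := (unit_sphere R n.+1).
Local Notation sigma := (surface_measure R n).
Implicit Types u v : euclid R n.+1 -> R.

(* The diagonal is negligible for n >= 1; there the integrand is _ / 0 = 0. *)
Definition double_int (F : euclid R n.+1 -> euclid R n.+1 -> R) : \bar R :=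
  (\int[sigma]_(eta in sphere) \int[sigma]_(omega in sphere)
     (`|F omega eta| ^+ 2 / edist omega eta ^+ n)%:E)%E.

Definition energy u : \bar R :=
  double_int (fun omega eta => u omega - u eta).

Definition norm2_sq u : \bar R :=
  (\int[sigma]_(omega in sphere) (`|u omega| ^+ 2)%:E)%E.

Definition sphere_area : R := fine (sigma sphere).

Definition D_L : set (euclid R n.+1 -> R) :=
  [set v | [/\ measurable_fun sphere v,
    (norm2_sq v < +oo)%E & (energy v < +oo)%E]].

Definition C_n : R := 4 / n%:R * (pi `^ (n%:R / 2) / Gamma (n%:R / 2)).

(* [ln 0 = 0] in the library, so 0 ln 0 = 0; [norm2_sq u] is finite on D_L. *)
Definition entropy u : \bar R :=
  (\int[sigma]_(omega in sphere)
     (`|u omega| ^+ 2 *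
        ln (`|u omega| ^+ 2 * sphere_area / fine (norm2_sq u)))%:E)%E.

(* Kept extended-real: finiteness of [entropy] on D_L is itself a theorem (the
   logarithmic Sobolev inequality). *)
Definition LS u : \bar R := (energy u - C_n%:E * entropy u)%E.

Definition optimizer (c : R) (xi : euclid R n.+1) : euclid R n.+1 -> R :=
  fun omega => c * (1 - dot xi omega) `^ (- (n%:R / 2)).

Definition M : set (euclid R n.+1 -> R) :=
  [set v | exists c xi, unit_ball R n.+1 xi /\ v = optimizer c xi].

Definition d0 u v : \bar R :=
  sqrte (double_int (fun omega eta => u omega - v omega - u eta + v eta)).

Definition d0_M u : \bar R := ereal_inf [set d0 u v | v in M].

End log_sobolev.
Arguments D_L R n : clear implicits.

(* Main.v *)
Require Import Defs.
From HB Require Import structures.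
From mathcomp Require Import all_boot all_order all_algebra.
From mathcomp Require Import all_classical all_reals all_analysis.
From mathcomp Require Import measurable_realfun.
From mathcomp Require Import ring lra.
(* Takes back [edist], which MathComp-Analysis shadows. *)
Import Defs.
Set Implicit Arguments.
Unset Strict Implicit.
Unset Printing Implicit Defensive.
Import Order.TTheory GRing.Theory Num.Theory.
Import numFieldNormedType.Exports.
Local Open Scope classical_set_scope.
Local Open Scope ring_scope.

(* The test functions are even bumps: u_r is a tent of radius r in the gnomonic
   charts around the two poles +-e_0, and r -> 0.  Put N = ||u_r||_2^2 and
   L = ln (1/r), and let kappa be half of |S^(n-1)|, so that n C_n = 4 kappa.  The
   energy is N (4 kappa L + o(L)), its main part coming from the pairs of points at
   distance between r and o(1), one of them in the support.  The entropy is
   N ln (|S^n| / N) + O(N) = N (n L + O(1)), since N is comparable to r^n.  Hence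
   LS(u_r) = o(N L).

   On the other hand d_0^2(u_r, M) >= c N L.  Let v be an optimizer, z a point of
   the support, and w a point off the support (both in gnomonic coordinates).  As v
   is a monotone function of xi.omega, around at least one of the poles v takes at w
   or at the reflected point 2 z - w a value at least v(z); at such a point the
   integrand |u_r(w) - v(w) - u_r(z) + v(z)|^2 is at least u_r(z)^2.  So, up to
   constants, subtracting v does not decrease the energy. *)

(** * Changes of variables *)

(** The kernel |omega - eta|^(-n) is scale invariant, so all dyadic shells between r and 1 around a
    point of the support contribute equally to the energy. This is the origin of the logarithm, and
    it confines the influence of the profile of the bump to the O(N) terms. The leading terms of
    energy and entropy cancel because pi^(n/2) = kappa Gamma(n/2), which comes from integrating a
    Gaussian in two ways. The upper bound on |LS| can therefore afford no loss in the leading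
    constant. Pairs within a fixed distance d are compared with the flat picture at the cost of
    powers of 1 + 4 d^2, all other pairs cost a constant that depends on d, and d is fixed before r
    tends to 0. The lower bound on the distance, in contrast, may lose constants freely. Two
    antipodal bumps are used because an optimizer with xi close to a pole peaks there and can
    imitate a single bump, whereas a monotone function of xi.omega cannot peak at both poles. *)

Lemma ge0_integral_scaled_image d1 d2 (X : measurableType d1)
    (Y : measurableType d2) (R : realType)
    (mu : {measure set X -> \bar R}) (nu : {measure set Y -> \bar R})
    (phi : X -> Y) (k : R) (f : Y -> \bar R) :
    measurable_fun setT phi -> 0 <= k ->
    (forall A, measurable A -> nu A = k%:E * mu (phi @^-1` A))%E ->
    measurable_fun setT f -> (forall y, 0 <= f y)%E ->
  (\int[nu]_y f y = k%:E * \int[mu]_x f (phi x))%E.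
Proof.
move=> mphi k0 nuE mf f0.
pose pm : {measure set Y -> \bar R} := pushforward mu phi.
rewrite (@eq_measure_integral _ _ _ _ (mscale (NngNum k0) (pm mphi))); last first.
  by move=> A mA _; exact: nuE.
by rewrite ge0_integral_mscale//= ge0_integral_pushforward.
Qed.

Section affine_change_of_variable.
Context {R : realType}.
Local Notation mu := (@lebesgue_measure R).
Local Open Scope ereal_scope.

Let affine_preimage_ocitv (a b c d : R) : (a != 0)%R ->
  (`|a|)%:E * mu ((fun x => a * x + b)%R @^-1` `]c, d]%classic) =
  mu `]c, d]%classic.
Proof.
move=> a0; have [a_gt0|a_lt0|a_eq0] := ltgtP 0%R a; last by rewrite -a_eq0 eqxx in a0.
- rewrite (_ : _ @^-1` _ = `](c - b) / a, (d - b) / a]%classic)%R; last first.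
    apply/seteqP; split => x /=; rewrite !in_itv/= ltr_pdivrMr// ler_pdivlMr//.
      by rewrite ltrBlDr lerBrDr mulrC.
    by rewrite ltrBlDr lerBrDr mulrC.
  rewrite !lebesgue_measure_itv/= !lte_fin ltr_pM2r ?invr_gt0// ltrD2r.
  case: ifP => _; last by rewrite mule0.
  rewrite -!EFinB -EFinM gtr0_norm//; congr EFin; field.
  by rewrite gt_eqF.
- rewrite (_ : _ @^-1` _ = `[(d - b) / a, (c - b) / a[%classic)%R; last first.
    apply/seteqP; split => x /=; rewrite !in_itv/= ltr_ndivlMr// ler_ndivrMr//;
    by rewrite ltrBlDr lerBrDr mulrC andbC.
  rewrite !lebesgue_measure_itv/= !lte_fin ltr_nM2r ?invr_lt0// ltrD2r.
  case: ifP => _; last by rewrite mule0.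
  rewrite -!EFinB -EFinM ltr0_norm//; congr EFin; field.
  by rewrite lt_eqF.
Qed.

Lemma measurable_affine (a b : R) :
  measurable_fun [set: measurableTypeR R]
    ((fun x => a * x + b)%R : measurableTypeR R -> measurableTypeR R).
Proof. by apply: measurable_funD => //; exact: measurable_funM. Qed.

Lemma ge0_integral_affine (f : R -> \bar R) (a b : R) : (a != 0)%R ->
  measurable_fun [set: R] f -> (forall x, 0 <= f x) ->
  \int[mu]_x f x = (`|a|)%:E * \int[mu]_x f (a * x + b)%R.
Proof.
move=> a0 mf f0.
have maff := measurable_affine a b.
apply: (@ge0_integral_scaled_image _ _ (measurableTypeR R) (measurableTypeR R) R
  mu mu (fun x => (a * x + b)%R)) => // A mA.
pose pm : {measure set (measurableTypeR R) -> \bar R} :=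
  @pushforward _ _ (measurableTypeR R) (measurableTypeR R) R mu
    (fun x => (a * x + b)%R).
pose nu := mscale (NngNum (normr_ge0 a)) (pm maff).
(* Lebesgue measure is determined by its values on half-open intervals. *)
apply: (@lebesgue_measure_unique _ nu) => // _ [[c d] _ <-] /=.
by rewrite -(affine_preimage_ocitv b c d a0).
Qed.

End affine_change_of_variable.

Section tuple_integral.
Context {R : realType}.
Local Notation mu := (@lebesgue_measure R).
Local Notation lambda := (@lebesgue_measuren R).
Local Open Scope ereal_scope.

Lemma ge0_integral_tcons k (f : euclid R k.+1 -> \bar R) :
  measurable_fun setT f -> (forall x, 0 <= f x) ->
  \int[lambda k.+1]_w f w = \int[mu]_x \int[lambda k]_t f (tcons (x, t)).
Proof.
move=> mf f0.
rewrite (@ge0_integral_scaled_image _ _ _ _ _ (mu \x lambda k)%E _ (@tcons R k) 1)//.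
- rewrite mul1e (fubini_tonelli1 (f \o @tcons R k))//.
    exact: (measurableT_comp mf (@measurable_tcons R k)).
  by move=> p; exact: f0.
- exact (@measurable_tcons R k).
- by move=> A mA; rewrite mul1e.
Qed.

Lemma measurable_tcons_comp k (f : euclid R k.+1 -> \bar R) :
  measurable_fun setT f ->
  measurable_fun setT (fun p : measurableTypeR R * euclid R k => f (tcons p)).
Proof. by move=> mf; exact: (measurableT_comp mf (@measurable_tcons R k)). Qed.

(** One family covers the three substitutions used later: dilations (b = 0), translations (a = 1)
    and point reflections (a = -1). *)
Definition eaff (a : R) k (b w : euclid R k) : euclid R k :=
  [tuple (a * tnth w i + tnth b i)%R | i < k].

Lemma measurable_eaff a k (b : euclid R k) : measurable_fun setT (eaff a b).
Proof.
apply/measurable_fun_tnthP => i.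
rewrite (_ : _ \o _ = (fun w => a * tnth w i + tnth b i)%R); last first.
  by apply/funext => w /=; rewrite tnth_mktuple.
apply: measurable_funD => //; apply: measurable_funM => //.
exact: measurable_tnth.
Qed.

Lemma eaff_tcons a k (b : euclid R k.+1) x (t : euclid R k) :
  eaff a b (tcons (x, t)) =
  tcons ((a * x + (tuncons b).1)%R, eaff a (tuncons b).2 t).
Proof.
apply/eq_from_tnth => i; rewrite tnth_mktuple.
have [j ->|->] := unliftP ord0 i; last first.
  by rewrite /tcons !tnth0.
rewrite /tcons !tnthS tnth_mktuple; congr (_ + _)%R.
by rewrite {1}(tuple_eta b) tnthS.
Qed.

Lemma ge0_integral_eaff k (f : euclid R k -> \bar R) (a : R) (b : euclid R k) :
  (a != 0)%R -> measurable_fun setT f -> (forall x, 0 <= f x) ->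
  \int[lambda k]_w f w = (`|a| ^+ k)%:E * \int[lambda k]_w f (eaff a b w).
Proof.
move=> a0; elim: k f b => [|k ih] f b mf f0.
  rewrite expr0 mul1e; apply: eq_integral => w _; congr f.
  by apply/eq_from_tnth => -[].
have mfb := measurableT_comp mf (measurable_eaff a b).
rewrite [in RHS]ge0_integral_tcons// ge0_integral_tcons//=.
have mf1 x : measurable_fun setT (fun t : euclid R k => f (tcons (x, t))).
  have := measurable_tcons_comp mf.
  by move=> /(measurableT_comp) h; apply: h; exact: pair1_measurable.
rewrite (@ge0_integral_affine _ _ a (tuncons b).1)//; last 2 first.
- apply: (measurable_fun_fubini_tonelli_F (f \o @tcons R k) (measurable_tcons_comp mf)).
  by move=> p; exact: f0.
- by move=> x; exact: integral_ge0.
rewrite exprS EFinM -muleA; congr (_ * _).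
rewrite -ge0_integralZl//.
- apply: eq_integral => x _.
  rewrite (ih _ (tuncons b).2)//; congr (_ * _).
  by apply: eq_integral => t _; rewrite eaff_tcons.
- apply: (measurable_fun_fubini_tonelli_F ((f \o eaff a b) \o @tcons R k) (measurable_tcons_comp mfb)).
  by move=> p; exact: f0.
- by move=> x _; exact: integral_ge0.
Qed.

End tuple_integral.

(** * Radial integrals *)

Section measurability.
Context d (T : measurableType d) {R : realType}.
Implicit Types (f g : T -> R) (b : T -> bool).

Lemma measurable_fun_invr f :
  measurable_fun setT f -> measurable_fun setT (fun x => (f x)^-1).
Proof.
move=> mf.
(* The power -1 is taken of the nonnegative f^2 only; where f vanishes, both sides are 0. *)
rewrite (_ : (fun x => _) = (fun x => f x * (f x ^+ 2) `^ (-1))); last first.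
  apply/funext => x; rewrite powR_inv1 ?sqr_ge0//.
  have [->|fx0] := eqVneq (f x) 0; first by rewrite invr0 mul0r.
  by field.
apply: measurable_funM => //.
exact: (measurableT_comp (@measurable_powR R (-1)) (measurable_funX 2 mf)).
Qed.

Lemma measurable_fun_natr_bool b :
  measurable_fun setT b -> measurable_fun setT (fun x => (b x)%:R : R).
Proof.
move=> mb; rewrite (_ : (fun x => _) = (fun x => if b x then 1 else 0 : R)).
  exact: measurable_fun_ifT.
by apply/funext => x; case: (b x).
Qed.

Lemma measurable_fun_powR f p :
  measurable_fun setT f -> measurable_fun setT (fun x => f x `^ p).
Proof. by move=> mf; exact: (measurableT_comp (@measurable_powR R p) mf). Qed.

Lemma measurable_fun_expR f :
  measurable_fun setT f -> measurable_fun setT (fun x => expR (f x)).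
Proof. by move=> mf; exact: (measurableT_comp (@measurable_expR R) mf). Qed.

Lemma measurable_fun_ln f :
  measurable_fun setT f -> measurable_fun setT (fun x => ln (f x)).
Proof. by move=> mf; exact: (measurableT_comp (@measurable_ln R) mf). Qed.

Lemma measurable_fun_sqrt f : (forall x, 0 <= f x) ->
  measurable_fun setT f -> measurable_fun setT (fun x => Num.sqrt (f x)).
Proof.
move=> f0 mf; rewrite (_ : (fun x => _) = (fun x => f x `^ 2^-1)).
  exact: measurable_fun_powR.
by apply/funext => x; rewrite powR12_sqrt.
Qed.

Lemma measurable_fun_dot n (f g : T -> euclid R n) :
  measurable_fun setT f -> measurable_fun setT g ->
  measurable_fun setT (fun x => dot (f x) (g x)).
Proof.
move=> mf mg; apply: measurable_sum => i; apply: measurable_funM.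
- exact: (measurableT_comp (measurable_tnth i) mf).
- exact: (measurableT_comp (measurable_tnth i) mg).
Qed.

End measurability.

Lemma dot_ge0 {R : realType} n (w : euclid R n) : 0 <= dot w w.
Proof. by apply: sumr_ge0 => i _; rewrite -expr2 sqr_ge0. Qed.

Lemma measurable_dot {R : realType} n :
  measurable_fun setT (fun w : euclid R n => dot w w : R).
Proof. exact: measurable_fun_dot. Qed.

Section one_dimensional_integrals.
Context {R : realType}.
Local Notation mu := (@lebesgue_measure R).
Local Open Scope ereal_scope.

Lemma integral_itv_natr (a b : R) (f : R -> R) :
  \int[mu]_(s in `[a, b]) (f s)%:E =
  \int[mu]_s ((a <= s <= b)%R%:R * f s)%:E.
Proof.
rewrite integral_mkcond; apply: eq_integral => s _.
rewrite patchE; case: ifPn => [|].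
  by rewrite inE/= in_itv/= => ->; rewrite mul1r.
by rewrite notin_setE/= in_itv/= => /negP/negbTE ->; rewrite mul0r.
Qed.

Lemma integral_inv_itv (a b : R) : (0 < a)%R -> (a < b)%R ->
  \int[mu]_s ((a <= s <= b)%R%:R * s^-1)%:E = (ln b - ln a)%:E.
Proof.
move=> a0 ab; rewrite -integral_itv_natr.
have b0 := lt_trans a0 ab.
rewrite (@continuous_FTC2 _ _ (@ln R)) ?EFinB//.
- apply/continuous_in_subspaceT => x; rewrite inE/= in_itv/= => /andP[ax _].
  by apply: cvgV; [rewrite gt_eqF// (lt_le_trans a0)|exact: cvg_id].
- split.
  + move=> x; rewrite in_itv/= => /andP[ax _].
    by apply: ex_derive; apply: is_derive1_ln; exact: lt_trans ax.
  + by apply: cvg_at_right_filter; exact: continuous_ln.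
  + by apply: cvg_at_left_filter; exact: continuous_ln.
- move=> x; rewrite in_itv/= => /andP[ax _].
  by rewrite derive1E; apply: derive_val; apply: is_derive1_ln; exact: lt_trans ax.
Qed.

End one_dimensional_integrals.

Section radial_integrals.
Context {R : realType}.
Local Notation mu := (@lebesgue_measure R).
Local Notation lambda := (@lebesgue_measuren R).
Local Open Scope ereal_scope.

Lemma dot_eaff0 n (a : R) (w : euclid R n) :
  (dot (eaff a [tuple of nseq n 0%R] w) (eaff a [tuple of nseq n 0%R] w) =
  a ^+ 2 * dot w w)%R.
Proof.
rewrite /dot mulr_sumr; apply: eq_bigr => i _.
have z0 : tnth [tuple of nseq n (0%R : measurableTypeR R)] i = 0%R.
  by rewrite (tnth_nth 0%R) nth_nseq if_same.
by rewrite tnth_mktuple z0 addr0 expr2 mulrACA.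
Qed.

(* The surface area of the unit sphere of R^n is twice this constant. *)
Definition radial_constant n : \bar R :=
  \int[lambda n]_w ((1 <= (dot w w)^-1 <= expR 1)%R%:R *
    dot w w `^ (- (n%:R / 2)))%:E.

(* Multiplicative averaging: insert 1 = int h(s/|w|^2) ds/s, with h the indicator of
   [1, e], and exchange the two scalings w -> sqrt(s) w and s -> |w|^2 s. *)
Lemma ge0_integral_dot n (F : R -> R) : (0 < n)%N ->
  measurable_fun setT F -> (forall s, 0 <= F s)%R ->
  \int[lambda n]_w (F (dot w w) * dot w w `^ (- (n%:R / 2)))%:E =
  radial_constant n * \int[mu]_s ((0 < s)%R%:R * (F s / s))%:E.
Proof.
move=> n0 mF F0; set p : R := (n%:R / 2)%R.
have p0 : (- p != 0)%R by apply/eqP => /eqP; rewrite oppr_eq0 /p mulf_eq0 invr_eq0 !pnatr_eq0 orbF eqn0Ngt n0.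
pose h (s : R) : R := ((1 <= s <= expR 1)%R%:R).
have mh : measurable_fun setT h.
  apply: measurable_fun_natr_bool; apply: measurable_and => //; exact: measurable_fun_ler.
have h0 s : (0 <= h s)%R by rewrite /h ler0n.
pose Phi (x : euclid R n * measurableTypeR R) : \bar R :=
  ((0 < x.2)%R%:R * (F (dot x.1 x.1) * dot x.1 x.1 `^ (- p)) *
   (h (x.2 / dot x.1 x.1) / x.2))%:E.
pose Psi (x : euclid R n * measurableTypeR R) : \bar R :=
  (h (dot x.1 x.1)^-1 * dot x.1 x.1 `^ (- p) *
   ((0 < x.2)%R%:R * (F (x.2 * dot x.1 x.1) / x.2)))%:E.
have m2 : measurable_fun setT (fun x : euclid R n * measurableTypeR R => x.2 : R).
  exact: measurable_snd.
have m1 : measurable_fun setT (fun x : euclid R n * measurableTypeR R => dot x.1 x.1 : R).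
  by apply: (measurableT_comp (@measurable_dot R n)); exact: measurable_fst.
have m0 : measurable_fun setT (fun x : euclid R n * measurableTypeR R => (0 < x.2)%R%:R : R).
  by apply: measurable_fun_natr_bool; exact: measurable_fun_ltr.
have mp : measurable_fun setT (fun x : euclid R n * measurableTypeR R => (dot x.1 x.1 `^ (- p))%R : R).
  exact: measurable_fun_powR.
have mPhi : measurable_fun setT Phi.
  apply/measurable_EFinP; apply: measurable_funM.
    apply: measurable_funM => //; apply: measurable_funM => //.
    exact: (measurableT_comp mF).
  apply: measurable_funM; last exact: measurable_fun_invr.
  apply: (measurableT_comp mh); apply: measurable_funM => //.
  exact: measurable_fun_invr.
have mPsi : measurable_fun setT Psi.
  apply/measurable_EFinP; apply: measurable_funM.
    apply: measurable_funM => //; apply: (measurableT_comp mh).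
    exact: measurable_fun_invr.
  apply: measurable_funM => //.
  apply: measurable_funM; last exact: measurable_fun_invr.
  apply: (measurableT_comp mF); exact: measurable_funM.
have Phi0 x : 0 <= Phi x.
  rewrite lee_fin /Phi; case: ltP => [s0|_]; last by rewrite !mul0r.
  by rewrite !mulr_ge0 ?powR_ge0 ?invr_ge0// ltW.
have Psi0 x : 0 <= Psi x.
  rewrite lee_fin /Psi; case: ltP => [s0|_]; last by rewrite mul0r mulr0.
  by rewrite !mulr_ge0 ?powR_ge0 ?invr_ge0// ltW.
(* Integrating s first, with q = |w|^2, gives ln(q e) - ln q = 1. *)
transitivity (\int[lambda n]_w \int[mu]_s Phi (w, s)).
  apply: eq_integral => w _; rewrite /Phi/=.
  (* [powR] sends 0 to 0 for a nonzero exponent, so both sides vanish at the origin; this is where 0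
     < n enters, through [p0]. *)
  have [Q0|Q0] := eqVneq (dot w w) 0%R.
    under [RHS]eq_integral do rewrite Q0 powR0// !mulr0 mul0r.
    by rewrite integral0 Q0 powR0// mulr0.
  have {}Q0 : (0 < dot w w)%R by rewrite lt_neqAle eq_sym Q0 dot_ge0.
  set q := dot w w in Q0 *.
  transitivity (\int[mu]_s ((F q * q `^ (- p))%:E *
      ((q <= s <= q * expR 1)%R%:R * s^-1)%:E)); last first.
    apply: eq_integral => s _; rewrite -EFinM; congr EFin.
    rewrite /h ler_pdivlMr// mul1r ler_pdivrMr// (mulrC (expR 1)).
    have [s0|s0] := ltP 0%R s; first by rewrite mul1r.
    by rewrite (lt_geF (le_lt_trans s0 Q0))/= !mul0r mulr0.
  rewrite ge0_integralZl//; last 3 first.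
  - apply/measurable_EFinP; apply: measurable_funM.
      apply: measurable_fun_natr_bool; apply: measurable_and; exact: measurable_fun_ler.
    exact: measurable_fun_invr.
  - move=> s _; rewrite lee_fin; case: (leP q s) => [qs|_]/=; last by rewrite mul0r.
    by rewrite mulr_ge0 ?invr_ge0// ltW// (lt_le_trans Q0).
  - by rewrite lee_fin mulr_ge0// powR_ge0.
  rewrite integral_inv_itv//; last by rewrite ltr_pMr// -expR0 ltr_expR.
  by rewrite lnM ?posrE ?expR_gt0// expRK addrAC subrr add0r mule1.
rewrite (fubini_tonelli Phi)//.
transitivity (\int[mu]_s \int[lambda n]_w Psi (w, s)).
  apply: eq_integral => s _.
  have [s0|s0] := ltP 0%R s; last first.
    by rewrite !integral0_eq// => w _; rewrite /Phi /Psi/= ltNge s0/= !mul0r ?mulr0.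
  (* The substitution w -> sqrt(s) w turns [Phi] into [Psi]: its Jacobian s^(n/2) cancels the s^(-p)
     released by the power of |w|^2. *)
  rewrite [LHS](@ge0_integral_eaff _ _ _ (Num.sqrt s) [tuple of nseq n 0%R])//; last 2 first.
  - by rewrite gt_eqF// sqrtr_gt0.
  - exact: (measurable_fun_pair1 _ mPhi).
  rewrite -ge0_integralZl//; last first.
    exact: (measurableT_comp (measurable_fun_pair1 _ mPhi) (measurable_eaff _ _)).
  apply: eq_integral => w _; rewrite /Phi /Psi/= dot_eaff0 sqr_sqrtr 1?ltW//.
  rewrite s0 !mul1r -EFinM; congr EFin.
  have -> : (s / (s * dot w w) = (dot w w)^-1)%R.
    by rewrite invfM mulrA divff ?gt_eqF// mul1r.
  have spow : (`|Num.sqrt s| ^+ n * s `^ (- p) = 1)%R.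
    rewrite ger0_norm ?sqrtr_ge0// -powR12_sqrt 1?ltW//.
    rewrite -powR_mulrn ?powR_ge0// -powRrM (mulrC 2^-1%R) powRN mulfV//.
    by rewrite gt_eqF// powR_gt0.
  rewrite powRM ?dot_ge0 1?ltW//.
  rewrite -[RHS]mul1r -spow; ring.
rewrite -(fubini_tonelli Psi)//.
rewrite -ge0_integralZr//; last 3 first.
- apply/measurable_EFinP; apply: measurable_funM.
    apply: measurable_fun_natr_bool; apply: measurable_and => //; apply: measurable_fun_ler => //;
    by apply: measurable_fun_invr; exact: measurable_dot.
  by apply: measurable_fun_powR; exact: measurable_dot.
- by move=> w _; rewrite lee_fin mulr_ge0// powR_ge0.
- apply: integral_ge0 => s _; rewrite lee_fin; case: ltP => [s0|_]; last by rewrite mul0r.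
  by rewrite !mulr_ge0// invr_ge0 ltW.
apply: eq_integral => w _; rewrite /Psi/=.
have [Q0|Q0] := eqVneq (dot w w) 0%R.
  rewrite Q0 powR0// mulr0 mul0e.
  by under eq_integral do rewrite mul0r; rewrite integral0.
have {}Q0 : (0 < dot w w)%R by rewrite lt_neqAle eq_sym Q0 dot_ge0.
set q := dot w w in Q0 *.
under eq_integral do rewrite EFinM.
have mG (G : R -> R) : measurable_fun setT G ->
    measurable_fun setT (fun s : R => (0 < s)%R%:R * (G s / s))%R.
  move=> mG; apply: measurable_funM.
    by apply: measurable_fun_natr_bool; exact: measurable_fun_ltr.
  by apply: measurable_funM => //; exact: measurable_fun_invr.
have G0 (G : R -> R) (s : R) : (forall x, 0 <= G x)%R -> (0 <= (0 < s)%R%:R * (G s / s))%R.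
  move=> G0; case: ltP => [s0|_]; last by rewrite mul0r.
  by rewrite !mulr_ge0// invr_ge0 ltW.
have mFq : measurable_fun setT (fun s : R => F (s * q)%R).
  by apply: (measurableT_comp mF); exact: measurable_funM.
rewrite ge0_integralZl//; last 3 first.
- by apply/measurable_EFinP; exact: (mG (fun s : R => F (s * q)%R)).
- by move=> s _; rewrite lee_fin (G0 (fun s : R => F (s * q)%R)).
- by rewrite lee_fin mulr_ge0// powR_ge0.
congr (_ * _).
(* The measure ds/s is invariant under s -> q s. *)
rewrite [RHS](@ge0_integral_affine _ _ q 0%R) ?gt_eqF//; last 2 first.
- by apply/measurable_EFinP; exact: mG.
- by move=> s; rewrite lee_fin G0.
rewrite -ge0_integralZl//; last 2 first.
- apply/measurable_EFinP.
  exact: (measurableT_comp (mG F mF) (measurable_affine q 0%R)).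
- by move=> s _; rewrite lee_fin G0.
apply: eq_integral => s _; rewrite addr0 -EFinM pmulr_rgt0// gtr0_norm//; congr EFin.
rewrite (mulrC q s); have [->|s0] := eqVneq s 0%R; first by rewrite mul0r ltxx !mul0r mulr0.
by field; rewrite gt_eqF.
Qed.

Lemma integral_gauss n :
  \int[lambda n]_w (expR (- dot w w))%:E = (pi `^ (n%:R / 2))%:E.
Proof.
have -> : (pi `^ (n%:R / 2) = Num.sqrt pi ^+ n :> R)%R.
  by rewrite -powR12_sqrt ?pi_ge0// -powR_mulrn ?powR_ge0// -powRrM mulrC.
elim: n => [|n ih].
  transitivity (\int[\d_([tuple] : euclid R 0)]_w (expR (- dot w w))%:E); first by [].
  rewrite integral_dirac//; last first.
    apply/measurable_EFinP; apply: measurable_fun_expR.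
    by apply: measurable_funN; exact: measurable_dot.
  rewrite diracT mul1e.
  by rewrite /dot big_ord0 oppr0 expR0 expr0.
have mg k : measurable_fun setT (fun w : euclid R k => (expR (- dot w w))%:E).
  apply/measurable_EFinP; apply: measurable_fun_expR.
  by apply: measurable_funN; exact: measurable_dot.
rewrite ge0_integral_tcons//.
transitivity (\int[mu]_x ((expR (- x ^+ 2))%:E * (Num.sqrt pi ^+ n)%:E)).
  apply: eq_integral => x _; rewrite -ih -ge0_integralZl//.
  - apply: eq_integral => t _; rewrite -EFinM -expRD; congr (expR _)%:E.
    rewrite /dot big_ord_recl /tcons tnth0 opprD expr2; congr (_ - _)%R.
    by apply: eq_bigr => i _; rewrite tnthS.
  - exact: mg.
rewrite ge0_integralZr//.
- by rewrite integralT_gauss -EFinM exprS.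
- by apply/measurable_EFinP; exact: measurable_gauss_fun.
Qed.

(** The radial formula takes the value 0 at w = 0, where the Gaussian is 1; this null set has to be
    discarded before the two are identified. It lies in a coordinate hyperplane. *)
Lemma lebesgue_dot0 n : (0 < n)%N ->
  lambda n [set w | dot w w = 0%R] = 0.
Proof.
case: n => // n _; set A := [set w | _].
have mA : measurable A.
  rewrite (_ : A = setT `&` (fun w => dot w w) @^-1` [set 0%R]); last first.
    by rewrite setTI.
  by apply: measurable_dot.
pose B : set (euclid R n.+1) := [set w | tnth w ord0 = 0%R :> R].
have mB : measurable B.
  rewrite (_ : B = setT `&` (fun w => tnth w ord0) @^-1` [set 0%R : measurableTypeR R]).
    by apply: measurable_tnth.
  by rewrite setTI.
apply: (@subset_measure0 _ _ _ (lambda n.+1) A B) => //.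
  move=> w /= w0; have : (tnth w ord0 * tnth w ord0 <= 0 :> R)%R.
    rewrite -w0 /dot big_ord_recl lerDl.
    by apply: sumr_ge0 => i _; rewrite -expr2 sqr_ge0.
  by rewrite -expr2 => h; apply/eqP; rewrite -sqrf_eq0 eq_le h sqr_ge0.
rewrite /= /cons_measure (_ : _ @^-1` B = [set 0%R] `*` setT).
  by rewrite product_measure1E// [X in X * _]lebesgue_measure_set1 mul0e.
by apply/seteqP; split => -[x t] /=; rewrite /B /= tnth0 => // -[].
Qed.

(** Evaluate the Gaussian integral twice. It is pi^(n/2) as a product of one-dimensional integrals;
    by [ge0_integral_dot] with F(s) = s^p e^(-s) it is the radial constant times the integral of
    s^(p-1) e^(-s). *)
Lemma radial_constant_Gamma n : (0 < n)%N ->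
  [/\ radial_constant n \is a fin_num, (0 < fine (radial_constant n))%R &
   (pi `^ (n%:R / 2) = fine (radial_constant n) * Gamma (n%:R / 2))%R].
Proof.
move=> n0; set p : R := (n%:R / 2)%R.
pose F (s : R) := (s `^ p * expR (- s))%R.
have mF : measurable_fun setT F.
  apply: measurable_funM; first exact: measurable_powR.
  by apply: measurable_fun_expR; exact: measurable_funN.
have F0 s : (0 <= F s)%R by rewrite mulr_ge0 ?powR_ge0 ?expR_ge0.
have := ge0_integral_dot n0 mF F0.
set G := (X in _ * X).
have G0 : 0 <= G.
  apply: integral_ge0 => s _; rewrite lee_fin; case: ltP => [s0|_]; last by rewrite mul0r.
  by rewrite mul1r divr_ge0// ltW.
have GE : Gamma p = fine G.
  rewrite /Gamma /Rintegral /G [in LHS]integral_mkcond; congr fine.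
  apply: eq_integral => s _; rewrite patchE.
  case: ifPn => [|].
    rewrite inE/= in_itv/= andbT => s0; rewrite s0 mul1r /F; congr EFin.
    rewrite (@powRB R s p 1%R); last by apply/implyP => _; rewrite gt_eqF.
    rewrite powRr1; last exact: ltW.
    ring.
  by rewrite notin_setE/= in_itv/= andbT => /negP/negbTE ->; rewrite mul0r.
have k0 : 0 <= radial_constant n.
  by apply: integral_ge0 => w _; rewrite lee_fin mulr_ge0// powR_ge0.
have -> : \int[lambda n]_w (F (dot w w) * dot w w `^ (- (n%:R / 2)))%:E =
    (pi `^ p)%:E.
  rewrite -integral_gauss.
  have mA : measurable [set w : euclid R n | dot w w = 0%R].
    rewrite (_ : [set w | _] = setT `&` (fun w => dot w w) @^-1` [set 0%R]).
      by apply: measurable_dot.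
    by rewrite setTI.
  have A0 := lebesgue_dot0 n0.
  rewrite (ge0_negligible_integral mA _ _ _ A0)//; last 2 first.
  - apply/measurable_EFinP; apply: measurable_funM.
      exact: (measurableT_comp mF (@measurable_dot R n)).
    exact: (measurable_fun_powR _ (@measurable_dot R n)).
  - by move=> w _; rewrite lee_fin mulr_ge0// powR_ge0.
  rewrite [RHS](ge0_negligible_integral mA _ _ _ A0)//; last first.
    apply/measurable_EFinP; apply: measurable_fun_expR.
    by apply: measurable_funN; exact: measurable_dot.
  apply: eq_integral => w; rewrite inE/= => -[_ /eqP w0].
  rewrite /F -/p powRN mulrAC mulfV ?mul1r// powR_eq0 negb_and.
  by rewrite w0.
(* Neither factor is known to be finite yet. Their product is a positive real, while an infinite
   factor would make it 0 or infinite. *)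
rewrite GE; move: (radial_constant n) k0 G G0 {GE} => [k| |]// k0 [g| |]// g0.
- rewrite lee_fin in k0; rewrite -EFinM => -[e]; split => //=.
  rewrite lt_neqAle k0 andbT eq_sym; apply/eqP => k00.
  by have := @powR_gt0 R pi p (pi_gt0 R); rewrite e k00 mul0r ltxx.
- have [<-|k1] := eqVneq 0%R k.
    by rewrite mul0e => -[h]; have := @powR_gt0 R pi p (pi_gt0 R); rewrite h ltxx.
  by rewrite gt0_muley// lte_fin lt_neqAle k1.
- have [<-|k1] := eqVneq 0%R g.
    by rewrite mule0 => -[h]; have := @powR_gt0 R pi p (pi_gt0 R); rewrite h ltxx.
  by rewrite gt0_mulye// lte_fin lt_neqAle k1.
Qed.

End radial_integrals.

(** * Gnomonic coordinates on the sphere *)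

Section one_dimensional_powers.
Context {R : realType}.
Local Notation mu := (@lebesgue_measure R).
Local Open Scope ereal_scope.

Lemma integral_itv_exprn (c : R) n : (0 < c)%R ->
  \int[mu]_a ((0 < a < c)%R%:R * a ^+ n)%:E = (c ^+ n.+1 / n.+1%:R)%:E.
Proof.
move=> c0.
have dF (x : R) :
    is_derive x 1%R (n.+1%:R^-1 *: (@id R ^+ n.+1))%R (x ^+ n)%R.
  have dX := is_deriveX n.+1 (is_derive_id x 1%R).
  have := is_deriveZ n.+1%:R^-1%R dX.
  by rewrite /= scaler1 scalerA mulVf ?pnatr_eq0// scale1r.
have cX : continuous (fun x : R => x ^+ n)%R by exact: exprn_continuous.
have mX : measurable_fun setT (fun x : R => x ^+ n)%R by exact: measurable_funX.
transitivity (\int[mu]_(a in `]0%R, c[) (a ^+ n)%:E).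
  rewrite [RHS]integral_mkcond; apply: eq_integral => a _; rewrite patchE.
  case: ifPn => [|].
    by rewrite inE/= in_itv/= => ->; rewrite mul1r.
  by rewrite notin_setE/= in_itv/= => /negP/negbTE ->; rewrite mul0r.
rewrite -(@integral_itv_bndoo _ _ _ _ true false); last first.
  by apply/measurable_EFinP; exact: measurable_funTS.
rewrite (@continuous_FTC2 _ _ (n.+1%:R^-1 *: (@id R ^+ n.+1))%R)//.
- by rewrite /= !fctE expr0n/= scaler0 sube0 mulrC.
- exact/continuous_subspaceT.
- split.
  + by move=> x _; exact: ex_derive.
  + by apply: cvg_at_right_filter; apply: differentiable_continuous; apply/derivable1_diffP; exact: ex_derive.
  + by apply: cvg_at_left_filter; apply: differentiable_continuous; apply/derivable1_diffP; exact: ex_derive.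
- by move=> x _; rewrite derive1E; exact: derive_val.
Qed.
End one_dimensional_powers.

Section geometry.
Context {R : realType}.
Implicit Types (n : nat).

(** Cauchy-Schwarz, by expanding the squared norm of |y|^2 x - (x.y) y. *)
Lemma dot_sqr_le n (x y : euclid R n) : dot x y ^+ 2 <= dot x x * dot y y.
Proof.
have h : 0 <= dot y y * (dot x x * dot y y - dot x y ^+ 2).
  rewrite (_ : _ * _ = \sum_(i < n) (dot y y * tnth x i - dot x y * tnth y i) ^+ 2).
    by apply: sumr_ge0 => i _; exact: sqr_ge0.
  under eq_bigr do rewrite sqrrB.
  rewrite big_split sumrB /=.
  rewrite (eq_bigr (fun i => dot y y ^+ 2 * (tnth x i * tnth x i))); last by move=> i _; ring.
  rewrite [X in _ - X + _](eq_bigr (fun i => 2 * dot y y * dot x y * (tnth x i * tnth y i))); last by move=> i _; ring.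
  rewrite [X in _ - _ + X](eq_bigr (fun i => dot x y ^+ 2 * (tnth y i * tnth y i))); last by move=> i _; ring.
  by rewrite -!mulr_sumr -/(dot x x) -/(dot x y) -/(dot y y); ring.
have [y0|y0] := eqVneq (dot y y) 0; last first.
  rewrite -subr_ge0 -(@pmulr_rge0 _ (dot y y))// lt_neqAle eq_sym y0 dot_ge0//.
suff -> : dot x y = 0 by rewrite y0 expr0n mulr0.
apply: big1 => i _.
have : tnth y i * tnth y i <= 0.
  rewrite -y0 /dot (bigD1 i)//= lerDl; apply: sumr_ge0 => j _.
  by rewrite -expr2 sqr_ge0.
rewrite -expr2 => yi; suff -> : tnth y i = 0 by rewrite mulr0.
by apply/eqP; rewrite -sqrf_eq0 eq_le yi sqr_ge0.
Qed.

Lemma edist_sqr n (x y : euclid R n) :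
  edist x y ^+ 2 = dot x x + dot y y - 2 * dot x y.
Proof.
rewrite sqr_sqrtr; last by apply: sumr_ge0 => i _; exact: sqr_ge0.
rewrite mulr_sumr -big_split -sumrB/=; apply: eq_bigr => i _; ring.
Qed.

Lemma euclid_edist_ge0 n (x y : euclid R n) : 0 <= edist x y.
Proof. exact: sqrtr_ge0. Qed.

Lemma edistC n (x y : euclid R n) : edist x y = edist y x.
Proof. by rewrite /edist; congr Num.sqrt; apply: eq_bigr => i _; ring. Qed.

Lemma enorm_ge0 n (x : euclid R n) : 0 <= enorm x.
Proof. exact: sqrtr_ge0. Qed.

Lemma enorm_sqr n (x : euclid R n) : enorm x ^+ 2 = dot x x.
Proof. by rewrite sqr_sqrtr// dot_ge0. Qed.

Lemma dot_le_enorm n (x y : euclid R n) : `|dot x y| <= enorm x * enorm y.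
Proof.
rewrite -(@ler_pXn2r _ 2)// ?nnegrE ?mulr_ge0 ?enorm_ge0//.
by rewrite exprMn !enorm_sqr real_normK ?num_real// dot_sqr_le.
Qed.

Lemma enorm_le_edistD n (x y : euclid R n) : enorm y <= enorm x + edist x y.
Proof.
have [xy|xy] := leP (enorm y) (enorm x).
  by rewrite (le_trans xy)// lerDl euclid_edist_ge0.
rewrite -lerBlDl -(@ler_pXn2r _ 2)// ?nnegrE ?euclid_edist_ge0//; last first.
  by rewrite subr_ge0 ltW.
rewrite edist_sqr sqrrB !enorm_sqr.
have := dot_le_enorm x y; rewrite ler_norml => /andP[_ h].
lra.
Qed.

Lemma edist_le_enormD n (x y : euclid R n) : edist x y <= enorm x + enorm y.
Proof.
rewrite -(@ler_pXn2r _ 2)// ?nnegrE ?euclid_edist_ge0 ?addr_ge0 ?enorm_ge0//.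
rewrite edist_sqr sqrrD !enorm_sqr.
have := dot_le_enorm x y; rewrite ler_norml => /andP[h _]; lra.
Qed.

(* [proj_norm w] is the norm of (1, w), and [gnomonic b w] is the point where the line
   spanned by (1, w) meets the upper ([b = false]) or lower ([b = true]) hemisphere. *)
Definition proj_norm n (w : euclid R n) : R := Num.sqrt (1 + dot w w).

Definition gnomonic n (b : bool) (w : euclid R n) : euclid R n.+1 :=
  [tuple (-1) ^+ b * tnth (tcons (1, w)) i / proj_norm w | i < n.+1].

Lemma proj_norm_sqr n (w : euclid R n) : proj_norm w ^+ 2 = 1 + dot w w.
Proof. by rewrite sqr_sqrtr// addr_ge0 ?dot_ge0. Qed.

Lemma proj_norm_ge1 n (w : euclid R n) : 1 <= proj_norm w.
Proof. by rewrite -{1}(@sqrtr1 R) ler_wsqrtr// lerDl dot_ge0. Qed.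

Lemma proj_norm_gt0 n (w : euclid R n) : 0 < proj_norm w.
Proof. exact: lt_le_trans ltr01 (proj_norm_ge1 w). Qed.

Lemma dot_tcons n (a b : R) (w z : euclid R n) :
  dot (tcons (a, w)) (tcons (b, z)) = a * b + dot w z.
Proof.
rewrite /dot big_ord_recl /tcons !tnth0; congr (_ + _).
by apply: eq_bigr => i _; rewrite !tnthS.
Qed.

Lemma dot_gnomonic n b c (w z : euclid R n) :
  dot (gnomonic b w) (gnomonic c z) =
  (-1) ^+ b * (-1) ^+ c * (1 + dot w z) / (proj_norm w * proj_norm z).
Proof.
rewrite -[1 + _](_ : dot (tcons (1, w)) (tcons (1, z)) = _); last first.
  by rewrite dot_tcons mulr1.
rewrite /dot mulr_sumr mulr_suml; apply: eq_bigr => i _.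
by rewrite !tnth_mktuple invfM; ring.
Qed.

Lemma dot_gnomonic_self n b (w : euclid R n) :
  dot (gnomonic b w) (gnomonic b w) = 1.
Proof.
rewrite dot_gnomonic -signr_addb addbb mul1r -proj_norm_sqr -expr2.
by rewrite mulfV// expf_neq0// gt_eqF// proj_norm_gt0.
Qed.

Lemma gnomonic_sphere n b (w : euclid R n) : unit_sphere R n.+1 (gnomonic b w).
Proof. by rewrite /unit_sphere/= /enorm dot_gnomonic_self sqrtr1. Qed.

Lemma edist_gnomonic_sqr n b c (w z : euclid R n) :
  edist (gnomonic b w) (gnomonic c z) ^+ 2 =
  2 - 2 * ((-1) ^+ b * (-1) ^+ c * (1 + dot w z) / (proj_norm w * proj_norm z)).
Proof. by rewrite edist_sqr !dot_gnomonic_self dot_gnomonic; ring. Qed.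

(** Let t be the cosine of the angle between the two points. The squared chord 2 - 2 t is at least
    the squared sine 1 - t^2, which does not see the hemispheres. The square of the product of norms
    times 1 - t^2 equals |w - z|^2 + |w|^2 |z|^2 - (w.z)^2, and Cauchy-Schwarz concludes. *)
Lemma edist_gnomonic_ge n b c (w z : euclid R n) :
  edist w z / (proj_norm w * proj_norm z) <= edist (gnomonic b w) (gnomonic c z).
Proof.
have Nw := proj_norm_gt0 w; have Nz := proj_norm_gt0 z.
rewrite -(@ler_pXn2r _ 2)// ?nnegrE ?euclid_edist_ge0//; last first.
  by rewrite divr_ge0 ?euclid_edist_ge0// mulr_ge0// ltW.
rewrite edist_gnomonic_sqr expr_div_n.
set t := _ / (proj_norm w * proj_norm z).
have tE : t ^+ 2 = (1 + dot w z) ^+ 2 / (proj_norm w * proj_norm z) ^+ 2.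
  rewrite /t expr_div_n; congr (_ / _).
  by rewrite exprMn -signr_addb sqrr_sign mul1r.
have : 1 - t ^+ 2 <= 2 - 2 * t by have := sqr_ge0 (1 - t); rewrite sqrrB; lra.
apply: le_trans; rewrite tE.
have M0 : 0 < (proj_norm w * proj_norm z) ^+ 2 by rewrite exprn_gt0// mulr_gt0.
rewrite ler_pdivrMr// mulrBl mul1r divfK ?gt_eqF//.
rewrite exprMn !proj_norm_sqr edist_sqr.
have := dot_sqr_le w z; set a := dot w w; set c' := dot w z; set d := dot z z; nra.
Qed.

(** With p, q the norms of (1, w), (1, z) and t the cosine of the angle, |w - z|^2 = (p - q)^2 + p q
    (2 - 2 t), and p q >= 1. *)
Lemma edist_gnomonic_le n b (w z : euclid R n) :
  edist (gnomonic b w) (gnomonic b z) <= edist w z.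
Proof.
have Nw := proj_norm_ge1 w; have Nz := proj_norm_ge1 z.
rewrite -(@ler_pXn2r _ 2)// ?nnegrE ?euclid_edist_ge0//.
have := sqr_ge0 (edist (gnomonic b w) (gnomonic b z)).
rewrite edist_gnomonic_sqr edist_sqr -signr_addb addbb mul1r.
have := proj_norm_sqr w; have := proj_norm_sqr z.
set p := proj_norm w in Nw *; set q := proj_norm z in Nz *.
move=> qE pE.
have pq0 : 0 < p * q by rewrite mulr_gt0// (lt_le_trans ltr01).
set t := (1 + _) / _ => t0.
have tE : 1 + dot w z = t * (p * q) by rewrite /t divfK// gt_eqF.
have := sqr_ge0 (p - q).
have : 1 <= p * q by nra.
rewrite sqrrB => h1 h2.
have : (2 - 2 * t) * (p * q - 1) >= 0 by rewrite mulr_ge0// subr_ge0.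
nra.
Qed.

(** The two charts carry opposite signs, so the hypothesis puts the points at least a right angle
    apart. *)
Lemma edist_gnomonic_opp_ge n b (w z : euclid R n) : -1 <= dot w z ->
  2 <= edist (gnomonic b w) (gnomonic (~~ b) z) ^+ 2.
Proof.
move=> wz; rewrite edist_gnomonic_sqr -signr_addb addbN addbb expr1.
rewrite mulN1r mulNr mulrN opprK lerDl mulr_ge0// divr_ge0//; first lra.
by rewrite mulr_ge0// ltW// proj_norm_gt0.
Qed.

End geometry.

Lemma integral_mrestr d (T : measurableType d) (R : realType)
    (mu : {measure set T -> \bar R}) (D : set T) (mD : measurable D)
    (f : T -> \bar R) : measurable_fun setT f -> (forall x, 0 <= f x)%E ->
  (\int[mrestr mu mD]_x f x = \int[mu]_(x in D) f x)%E.
Proof.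
move=> mf f0.
rewrite (@ge0_negligible_integral _ _ _ (mrestr mu mD) setT (~` D) f)//; last 2 first.
- exact: measurableC.
- by rewrite /= /mrestr setICl measure0.
rewrite setDE setTI setCK.
apply: eq_measure_integral => A mA AD.
by rewrite /= /mrestr setIidl.
Qed.

Section sphere_integral.
Context {R : realType}.
Local Notation mu := (@lebesgue_measure R).
Local Notation lambda := (@lebesgue_measuren R).
Variable n : nat.
Hypothesis n0 : (0 < n)%N.
Local Notation sphere := (unit_sphere R n.+1).
Local Notation sigma := (surface_measure R n).
Local Open Scope ereal_scope.

Lemma measurable_unit_sphere : measurable sphere.
Proof.
rewrite (_ : sphere = setT `&` enorm @^-1` [set 1%R]); last by rewrite setTI.
by apply: measurable_enorm.
Qed.

Lemma measurable_gnomonic b : measurable_fun setT (@gnomonic R n b).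
Proof.
apply/measurable_fun_tnthP => i.
rewrite (_ : _ \o _ = (fun w => (-1) ^+ b * tnth (tcons (1, w)) i / proj_norm w)%R); last first.
  by apply/funext => w /=; rewrite tnth_mktuple.
apply: measurable_funM.
  apply: measurable_funM => //.
  apply: (measurableT_comp (measurable_tnth i)).
  apply: (measurableT_comp (@measurable_tcons R n)).
  exact: measurable_fun_pair.
apply: measurable_fun_invr; apply: measurable_fun_sqrt.
  by move=> w; rewrite addr_ge0// dot_ge0.
by apply: measurable_funD => //; exact: measurable_dot.
Qed.

(** Jacobian of the gnomonic chart: on each hemisphere the surface measure is (1 + |w|^2)^(-(n+1)/2)
    dw. *)
Definition gnomonic_density (w : euclid R n) : R := (proj_norm w ^+ n.+1)^-1%R.

Lemma enorm_tcons_eaff (a : R) (w : euclid R n) :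
  enorm (tcons (a, eaff a [tuple of nseq n 0%R] w)) = (`|a| * proj_norm w)%R.
Proof.
rewrite /enorm dot_tcons dot_eaff0 -expr2 -{1}[(a ^+ 2)%R]mulr1 -mulrDr.
by rewrite sqrtrM ?sqr_ge0// sqrtr_sqr.
Qed.

Lemma normalize_tcons (a : R) (w : euclid R n) : (a != 0)%R ->
  normalize (tcons (a, eaff a [tuple of nseq n 0%R] w)) = gnomonic (a < 0)%R w.
Proof.
move=> a0.
have aE : tcons (a, eaff a [tuple of nseq n 0%R] w) =
    [tuple (a * tnth (tcons (1%R, w)) i)%R | i < n.+1] :> euclid R n.+1.
  apply/eq_from_tnth => i; rewrite tnth_mktuple /tcons.
  have [j ->|->] := unliftP ord0 i; last by rewrite !tnth0 mulr1.
  rewrite !tnthS tnth_mktuple.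
  have z0 : tnth [tuple of nseq n (0%R : measurableTypeR R)] j = 0%R.
    by rewrite (tnth_nth 0%R) nth_nseq if_same.
  by rewrite z0 addr0.
apply/eq_from_tnth => i; rewrite !tnth_mktuple enorm_tcons_eaff aE tnth_mktuple.
rewrite invfM.
have -> : ((-1) ^+ (a < 0)%R = a / `|a|)%R.
  have [a1|a1|/eqP] := ltgtP a 0%R; last by rewrite (negbTE a0).
    by rewrite ltr0_norm// invrN mulrN mulfV.
  by rewrite gtr0_norm// mulfV.
ring.
Qed.

Lemma surface_measureE (f : euclid R n.+1 -> \bar R) :
  measurable_fun setT f -> (forall x, 0 <= f x) ->
  \int[sigma]_(x in sphere) f x =
  n.+1%:R%:E * \int[lambda n.+1]_x
    ((enorm x < 1)%R%:R%:E * (f \_ sphere) (normalize x)).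
Proof.
move=> mf f0; rewrite integral_mkcond.
have mS : measurable_fun setT (f \_ sphere).
  by apply/(measurable_restrictT _ measurable_unit_sphere); exact: measurable_funTS.
have S0 x : 0 <= (f \_ sphere) x by apply: erestrict_ge0.
have mB := @measurable_unit_ball R n.+1.
have sigmaE A : measurable A ->
    sigma A = n.+1%:R%:E * mrestr (lambda n.+1) mB (@normalize R n.+1 @^-1` A).
  by move=> mA; rewrite /= /surface_measure /mrestr setIC.
rewrite (ge0_integral_scaled_image (@measurable_normalize R n.+1) (ler0n _ _)
  sigmaE mS S0).
congr (_ * _); rewrite integral_mrestr//; last first.
  exact: (measurableT_comp mS (@measurable_normalize R n.+1)).
rewrite integral_mkcond; apply: eq_integral => x _.
rewrite patchE; case: ifPn => [|].
  by rewrite inE /unit_ball/= => ->; rewrite mul1e.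
by rewrite notin_setE/= /unit_ball/= => /negP/negbTE ->; rewrite mul0e.
Qed.

Lemma measurable_proj_norm : measurable_fun setT (@proj_norm R n).
Proof.
apply: measurable_fun_sqrt; first by move=> w; rewrite addr_ge0// dot_ge0.
by apply: measurable_funD => //; exact: measurable_dot.
Qed.

Lemma gnomonic_density_ge0 w : (0 <= gnomonic_density w)%R.
Proof. by rewrite invr_ge0 exprn_ge0// ltW// proj_norm_gt0. Qed.

Lemma measurable_gnomonic_density : measurable_fun setT gnomonic_density.
Proof.
apply: measurable_fun_invr; apply: measurable_funX.
exact: measurable_proj_norm.
Qed.

(** Use the coordinates (a, a w) on R^(n+1), with Jacobian |a|^n. The unit ball becomes |a| < 1 /
    [proj_norm w], and normalization forgets a except for its sign, which selects the hemisphere.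
    For each sign the integral of |a|^n is [gnomonic_density w] / (n + 1), which cancels the n + 1
    of [surface_measure]. *)
Lemma ge0_integral_sphere (f : euclid R n.+1 -> \bar R) :
  measurable_fun setT f -> (forall x, 0 <= f x) ->
  \int[sigma]_(x in sphere) f x =
  \int[lambda n]_w ((gnomonic_density w)%:E *
    (f (gnomonic false w) + f (gnomonic true w))).
Proof.
move=> mf f0; rewrite surface_measureE//.
have mS : measurable_fun setT (f \_ sphere).
  by apply/(measurable_restrictT _ measurable_unit_sphere); exact: measurable_funTS.
have S0 x : 0 <= (f \_ sphere) x by apply: erestrict_ge0.
pose phi x := (enorm x < 1)%R%:R%:E * (f \_ sphere) (@normalize R n.+1 x).
have mphi : measurable_fun setT phi.
  apply: emeasurable_funM; last exact: (measurableT_comp mS (@measurable_normalize R n.+1)).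
  apply/measurable_EFinP; apply: measurable_fun_natr_bool.
  by apply: measurable_fun_ltr => //; exact: measurable_enorm.
have phi0 x : 0 <= phi x by rewrite mule_ge0.
rewrite -/phi ge0_integral_tcons//.
pose Psi (x : measurableTypeR R * euclid R n) :=
  (`|x.1| ^+ n * (`|x.1| * proj_norm x.2 < 1)%R%:R)%:E *
  (if (x.1 < 0)%R then f (gnomonic true x.2) else f (gnomonic false x.2)).
have m1 : measurable_fun setT (fun x : measurableTypeR R * euclid R n => x.1 : R).
  exact: measurable_fst.
have mn1 : measurable_fun setT (fun x : measurableTypeR R * euclid R n => `|x.1|%R : R).
  exact: (measurableT_comp (@normr_measurable _ _) m1).
have mPsi : measurable_fun setT Psi.
  apply: emeasurable_funM.
    apply/measurable_EFinP; apply: measurable_funM; first exact: measurable_funX.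
    apply: measurable_fun_natr_bool; apply: measurable_fun_ltr => //.
    apply: measurable_funM => //.
    exact: (measurableT_comp measurable_proj_norm measurable_snd).
  apply: measurable_fun_ifT; first exact: measurable_fun_ltr.
  - exact: (measurableT_comp (measurableT_comp mf (measurable_gnomonic true)) measurable_snd).
  - exact: (measurableT_comp (measurableT_comp mf (measurable_gnomonic false)) measurable_snd).
have Psi0 x : 0 <= Psi x.
  by rewrite mule_ge0// ?lee_fin ?mulr_ge0//; case: ifP.
have -> : \int[mu]_x \int[lambda n]_t phi (tcons (x, t)) =
          \int[mu]_x \int[lambda n]_t Psi (x, t).
  (* The slice a = 0, where the substitution t = a w degenerates, is a single point of the outer
     integral. *)
  have mT0 : measurable (setT `\ (0%R : measurableTypeR R)) by exact: measurableD.
  have mphiF : measurable_fun (setT `\ (0%R : measurableTypeR R))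
      (fun a => \int[lambda n]_t phi (tcons (a, t))).
    apply: measurable_funTS.
    apply: (measurable_fun_fubini_tonelli_F (phi \o @tcons R n) (measurable_tcons_comp mphi)).
    by move=> p; exact: phi0.
  have mPsiF : measurable_fun (setT `\ (0%R : measurableTypeR R))
      (fun a => \int[lambda n]_t Psi (a, t)).
    by apply: measurable_funTS; exact: (measurable_fun_fubini_tonelli_F Psi mPsi).
  rewrite -[LHS](@integral_setD1 _ _ _ _ mT0 mphiF).
  rewrite -[RHS](@integral_setD1 _ _ _ _ mT0 mPsiF).
  apply: eq_integral => a; rewrite inE/= => -[_ /eqP a0].
  rewrite (@ge0_integral_eaff _ _ _ a [tuple of nseq n 0%R])//; last first.
    exact: (measurable_fun_pair2 _ (measurable_tcons_comp mphi)).
  rewrite -ge0_integralZl//; last first.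
    exact: (measurableT_comp (measurable_fun_pair2 a (measurable_tcons_comp mphi)) (measurable_eaff _ _)).
  apply: eq_integral => w _; rewrite /phi /Psi/= normalize_tcons// enorm_tcons_eaff.
  rewrite patchE mem_set; last exact: gnomonic_sphere.
  by rewrite muleA -EFinM; case: (a < 0)%R.
rewrite (fubini_tonelli Psi)//.
rewrite -ge0_integralZl//; last 2 first.
- exact: (measurable_fun_fubini_tonelli_G Psi mPsi).
- by move=> w _; exact: integral_ge0.
apply: eq_integral => w _.
have N0 := proj_norm_gt0 w.
pose c := (proj_norm w)^-1%R.
have c0 : (0 < c)%R by rewrite invr_gt0.
pose j (a : R) := ((0 < a < c)%R%:R * a ^+ n)%R.
have j0 a : (0 <= j a)%R.
  rewrite /j; case: ltP => [a0|_]; last by rewrite mul0r.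
  by rewrite mulr_ge0// exprn_ge0// ltW.
have mj : measurable_fun setT j.
  apply: measurable_funM; last exact: measurable_funX.
  by apply: measurable_fun_natr_bool; apply: measurable_and; exact: measurable_fun_ltr.
transitivity (n.+1%:R%:E * \int[mu]_a
   ((j a)%:E * f (gnomonic false w) + (j (- a)%R)%:E * f (gnomonic true w))).
  congr (_ * _); apply: eq_integral => a _; rewrite /Psi/=.
  have Nc (b : R) : (b * proj_norm w < 1)%R = (b < c)%R by rewrite /c -ltr_pdivlMr// mul1r.
  rewrite Nc /j oppr_gt0.
  have [a0|a0|->] := ltgtP a 0%R.
  - by rewrite ltr0_norm//= !mul0r mul0e add0e mulrC.
  - by rewrite gtr0_norm//= !mul0r mul0e adde0 mulrC.
  - by rewrite /= normr0 expr0n gtn_eqF//= !mul0r !mul0e adde0.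
have jN : \int[mu]_a (j (- a)%R)%:E = \int[mu]_a (j a)%:E.
  rewrite [RHS](@ge0_integral_affine _ _ (-1)%R 0%R)//.
  - rewrite normrN1 mul1e; apply: eq_integral => a _.
    by rewrite mulN1r addr0.
  - exact/measurable_EFinP.
have mjN : measurable_fun setT (fun a : R => j (- a)%R).
  by apply: (measurableT_comp mj); exact: measurable_funN.
rewrite ge0_integralD//.
- rewrite !ge0_integralZr//.
  + rewrite jN integral_itv_exprn// -ge0_muleDr// muleA -EFinM; congr (_%:E * _).
    by rewrite /gnomonic_density /c exprVn mulrCA mulfV ?mulr1 ?pnatr_eq0.
  + exact/measurable_EFinP.
  + by move=> a _; rewrite lee_fin.
  + exact/measurable_EFinP.
  + by move=> a _; rewrite lee_fin.
- by move=> a _; rewrite mule_ge0// lee_fin.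
- by apply: emeasurable_funM => //; exact/measurable_EFinP.
- by move=> a _; rewrite mule_ge0// lee_fin.
- by apply: emeasurable_funM => //; exact/measurable_EFinP.
Qed.

Lemma ge0_double_integral_sphere (k : euclid R n.+1 * euclid R n.+1 -> \bar R) :
  measurable_fun setT k -> (forall x, 0 <= k x) ->
  \int[sigma]_(y in sphere) \int[sigma]_(x in sphere) k (x, y) =
  \int[lambda n]_z \int[lambda n]_w
    ((gnomonic_density z)%:E * (gnomonic_density w)%:E *
     (k (gnomonic false w, gnomonic false z) + k (gnomonic true w, gnomonic false z) +
      (k (gnomonic false w, gnomonic true z) + k (gnomonic true w, gnomonic true z)))).
Proof.
move=> mk k0.
pose K (x : euclid R n * euclid R n.+1) := (gnomonic_density x.1)%:E *
  (k (gnomonic false x.1, x.2) + k (gnomonic true x.1, x.2)).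
have mK : measurable_fun setT K.
  apply: emeasurable_funM.
    apply/measurable_EFinP.
    exact: (measurableT_comp measurable_gnomonic_density measurable_fst).
  apply: emeasurable_funD.
    apply: (measurableT_comp mk); apply: measurable_fun_pair; last exact: measurable_snd.
    exact: (measurableT_comp (measurable_gnomonic false) measurable_fst).
  apply: (measurableT_comp mk); apply: measurable_fun_pair; last exact: measurable_snd.
  exact: (measurableT_comp (measurable_gnomonic true) measurable_fst).
have K0 x : 0 <= K x by rewrite mule_ge0 ?adde_ge0// lee_fin gnomonic_density_ge0.
transitivity (\int[sigma]_(y in sphere) \int[lambda n]_w K (w, y)).
  apply: eq_integral => y _; rewrite ge0_integral_sphere//.
  exact: (measurable_fun_pair1 y mk).
rewrite ge0_integral_sphere//; last 2 first.
- exact: (measurable_fun_fubini_tonelli_G K mK).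
- by move=> y; exact: integral_ge0.
apply: eq_integral => z _.
rewrite -ge0_integralD//; last 2 first.
- exact: (measurable_fun_pair1 _ mK).
- exact: (measurable_fun_pair1 _ mK).
rewrite -ge0_integralZl//; last 3 first.
- by apply: emeasurable_funD; exact: (measurable_fun_pair1 _ mK).
- by move=> w _; rewrite adde_ge0.
- by rewrite lee_fin gnomonic_density_ge0.
apply: eq_integral => w _; rewrite /K/= -ge0_muleDr ?adde_ge0//.
by rewrite muleA.
Qed.

End sphere_integral.

(** * Integrals of the flat kernel around an arbitrary centre *)

Section euclidean_integrals.
Context {R : realType}.
Local Notation mu := (@lebesgue_measure R).
Local Notation lambda := (@lebesgue_measuren R).
Variable n : nat.
Hypothesis n0 : (0 < n)%N.
Local Open Scope ereal_scope.

Lemma measurable_fun_edist d (T : measurableType d) k (f g : T -> euclid R k) :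
  measurable_fun setT f -> measurable_fun setT g ->
  measurable_fun setT (fun x => edist (f x) (g x)).
Proof.
move=> mf mg; apply: measurable_fun_sqrt.
  by move=> x; apply: sumr_ge0 => i _; exact: sqr_ge0.
apply: measurable_sum => i; apply: measurable_funX; apply: measurable_funB.
- exact: (measurableT_comp (measurable_tnth i) mf).
- exact: (measurableT_comp (measurable_tnth i) mg).
Qed.

Lemma dot_powR (w : euclid R n) :
  (dot w w `^ (- (n%:R / 2)) = (enorm w ^+ n)^-1)%R.
Proof.
rewrite powRN; congr (_^-1)%R; rewrite /enorm -powR12_sqrt ?dot_ge0//.
by rewrite -powR_mulrn ?powR_ge0// -powRrM mulrC.
Qed.

Lemma edist_eaff a (z w : euclid R n) :
  edist (eaff a z w) z = (`|a| * enorm w)%R.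
Proof.
rewrite /enorm -sqrtr_sqr -sqrtrM ?sqr_ge0// /dot mulr_sumr /edist.
congr Num.sqrt; apply: eq_bigr => i _.
by rewrite tnth_mktuple addrK exprMn -expr2.
Qed.

(** [ge0_integral_dot] recentred at z, in the variable s = |w - z|^2. *)
Lemma ge0_integral_edist (z : euclid R n) (G : R -> R) :
  measurable_fun setT G -> (forall t, 0 <= G t)%R ->
  \int[lambda n]_w (G (edist w z) * (edist w z ^+ n)^-1)%:E =
  (fine (radial_constant n))%:E *
    \int[mu]_s ((0 < s)%R%:R * (G (Num.sqrt s) / s))%:E.
Proof.
move=> mG G0.
have med : measurable_fun setT (fun w : euclid R n => edist w z).
  by apply: measurable_fun_edist => //; exact: measurable_cst.
rewrite (@ge0_integral_eaff _ _ _ 1%R z) ?oner_eq0//; last 2 first.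
- apply/measurable_EFinP; apply: measurable_funM.
    exact: (measurableT_comp mG med).
  by apply: measurable_fun_invr; exact: measurable_funX.
- by move=> w; rewrite lee_fin mulr_ge0// invr_ge0 exprn_ge0// euclid_edist_ge0.
rewrite normr1 expr1n mul1e.
have [kfin _ _] := @radial_constant_Gamma R n n0.
rewrite fineK// -(@ge0_integral_dot _ _ (fun s => G (Num.sqrt s)))//.
  by apply: eq_integral => w _; rewrite edist_eaff normr1 mul1r -dot_powR.
apply: (measurableT_comp mG).
rewrite [X in measurable_fun _ X](_ : _ = fun s : R => (Num.max s 0 `^ 2^-1)%R).
  by apply: measurable_fun_powR; apply: measurable_maxr.
apply/funext => s; rewrite powR12_sqrt ?le_max ?lexx ?orbT//.
by case: (leP s 0%R) => // s0; rewrite sqrtr0 ler0_sqrtr.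
Qed.

(** Only the ratio b / a matters, by scale invariance. The factor 2 appears because s = |w - z|^2
    ranges over [a^2, b^2]. *)
Lemma integral_annulus (z : euclid R n) (a b : R) : (0 < a)%R -> (a < b)%R ->
  \int[lambda n]_w ((a <= edist w z <= b)%R%:R * (edist w z ^+ n)^-1)%:E =
  (2 * fine (radial_constant n) * (ln b - ln a))%:E.
Proof.
move=> a0 ab; have b0 := lt_trans a0 ab.
rewrite (@ge0_integral_edist z (fun t => (a <= t <= b)%R%:R))//; last first.
  by apply: measurable_fun_natr_bool; apply: measurable_and; exact: measurable_fun_ler.
have -> : \int[mu]_s ((0 < s)%R%:R * ((a <= Num.sqrt s <= b)%R%:R / s))%:E =
    \int[mu]_s ((a ^+ 2 <= s <= b ^+ 2)%R%:R * s^-1)%:E.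
  apply: eq_integral => s _; congr EFin.
  have [s0|s0] := ltP 0%R s.
    rewrite mul1r; congr (_%:R * _)%R.
    rewrite -{3 4}(@sqr_sqrtr _ s); last exact: ltW.
    by rewrite !ler_pXn2r// ?nnegrE ?sqrtr_ge0// ltW.
  by rewrite (lt_geF (le_lt_trans s0 _)) ?exprn_gt0//= !mul0r.
rewrite integral_inv_itv ?exprn_gt0//; last first.
  by rewrite ltr_pXn2r// ?nnegrE ltW.
by rewrite -EFinM !lnXn//; congr EFin; ring.
Qed.

(** For pairs at distance at most r: there the Lipschitz bound on the tent supplies the squared
    distance that makes the kernel integrable. *)
Lemma integral_ball_sqr (z : euclid R n) (r : R) : (0 < r)%R ->
  \int[lambda n]_w ((edist w z <= r)%R%:R *
     (edist w z ^+ 2 * (edist w z ^+ n)^-1))%:E =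
  (fine (radial_constant n) * r ^+ 2)%:E.
Proof.
move=> r0.
under eq_integral do rewrite mulrA.
rewrite (@ge0_integral_edist z (fun t => (t <= r)%R%:R * t ^+ 2)%R)//; last 2 first.
- apply: measurable_funM; last exact: measurable_funX.
  by apply: measurable_fun_natr_bool; exact: measurable_fun_ler.
- by move=> t; rewrite mulr_ge0// sqr_ge0.
rewrite EFinM; congr (_ * _).
transitivity (\int[mu]_(s in `]0%R, (r ^+ 2)%R]) (cst 1 s)).
  rewrite [RHS]integral_mkcond; apply: eq_integral => s _; rewrite patchE.
  have [s0|s0] := ltP 0%R s; last first.
    rewrite mul0r ifF//; apply/negbTE; rewrite notin_setE/= in_itv/=.
    by rewrite ltNge s0.
  rewrite mul1r sqr_sqrtr; last exact: ltW.
  rewrite mulfK ?gt_eqF//.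
  rewrite -(@ler_pXn2r _ 2)// ?nnegrE ?sqrtr_ge0//; last exact: ltW.
  rewrite sqr_sqrtr; last exact: ltW.
  case: ifPn.
    by rewrite inE/= in_itv/= s0/= => ->.
  by rewrite notin_setE/= in_itv/= s0/= => /negP/negbTE ->.
have <- : mu `]0%R, (r ^+ 2)%R]%classic = (r ^+ 2)%:E.
  by rewrite lebesgue_measure_itv/= lte_fin exprn_gt0// oppr0 adde0.
by rewrite integral_cst// mul1e.
Qed.

(** The indicator of the ball is at most e exp(-|w|^2 / r^2), and the rescaled Gaussian is known. *)
Lemma integral_ball_le (r : R) : (0 < r)%R ->
  \int[lambda n]_w ((enorm w <= r)%R%:R)%:E <=
  (expR 1 * pi `^ (n%:R / 2) * r ^+ n)%:E.
Proof.
move=> r0.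
pose f (w : euclid R n) := (expR (- (dot w w / r ^+ 2)))%:E.
have mf : measurable_fun setT f.
  apply/measurable_EFinP; apply: measurable_fun_expR; apply: measurable_funN.
  by apply: measurable_funM => //; exact: measurable_dot.
have -> : (expR 1 * pi `^ (n%:R / 2) * r ^+ n)%:E = (expR 1)%:E * \int[lambda n]_w f w.
  rewrite (@ge0_integral_eaff _ _ _ r [tuple of nseq n 0%R]) ?gt_eqF//; last first.
    by move=> w; rewrite lee_fin expR_ge0.
  rewrite gtr0_norm// -mulrA (mulrC (pi `^ _)%R) EFinM; congr (_ * _).
  rewrite EFinM -integral_gauss; congr (_ * _); apply: eq_integral => w _.
  rewrite /f dot_eaff0; congr (expR (- _))%:E.
  by rewrite mulrAC mulfV ?mul1r// expf_neq0// gt_eqF.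
rewrite -ge0_integralZl//; last by move=> w _; rewrite lee_fin expR_ge0.
apply: ge0_le_integral => //.
- apply/measurable_EFinP; apply: measurable_fun_natr_bool.
  by apply: measurable_fun_ler => //; exact: measurable_enorm.
- by apply: emeasurable_funM.
- move=> w _; rewrite -EFinM lee_fin -expRD.
  have [wr|_] := leP (enorm w) r; last exact: expR_ge0.
  rewrite -{1}expR0 ler_expR subr_ge0 ler_pdivrMr ?exprn_gt0// mul1r.
  by rewrite -enorm_sqr ler_pXn2r// ?nnegrE ?enorm_ge0// ltW.
Qed.

End euclidean_integrals.

(** * Tents *)

Section tent.
Context {R : realType} (n : nat).
Implicit Types (w z : euclid R n) (r d : R).

Definition tent r w : R := Num.max 0 (1 - enorm w / r).

(* [Num.sqrt (x_0^-2 - 1)] is the norm of the gnomonic coordinate of [x].  On the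
   equator [x_0 = 0], a null set, junk values make this function equal to 1. *)
Definition sphere_tent r (x : euclid R n.+1) : R :=
  Num.max 0 (1 - Num.sqrt ((tnth x ord0 ^+ 2)^-1 - 1) / r).

Lemma sphere_tent_gnomonic r b w : sphere_tent r (gnomonic b w) = tent r w.
Proof.
rewrite /sphere_tent /tent /gnomonic tnth_mktuple /tcons tnth0 mulr1.
rewrite expr_div_n sqrr_sign mul1r invrK proj_norm_sqr.
by rewrite addrAC subrr add0r.
Qed.

Lemma sphere_tent_ge0 r x : 0 <= sphere_tent r x.
Proof. by rewrite le_max lexx. Qed.

Lemma sphere_tent_le1 r x : 0 < r -> sphere_tent r x <= 1.
Proof.
move=> r0; rewrite ge_max ler01/= lerBlDr lerDl divr_ge0 ?sqrtr_ge0//.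
exact: ltW.
Qed.

Lemma tent_ge0 r w : 0 <= tent r w.
Proof. by rewrite le_max lexx. Qed.

Lemma tent_le1 r w : 0 < r -> tent r w <= 1.
Proof. by move=> r0; rewrite -(sphere_tent_gnomonic r false) sphere_tent_le1. Qed.

Lemma tent_eq0 r w : 0 < r -> r <= enorm w -> tent r w = 0.
Proof.
move=> r0 rw; apply/max_idPl; rewrite subr_le0.
by rewrite ler_pdivlMr// mul1r.
Qed.

Lemma enorm_le_edist w z : `|enorm w - enorm z| <= edist w z.
Proof.
rewrite ler_norml; apply/andP; split.
  by rewrite lerNl opprB lerBlDl enorm_le_edistD.
by rewrite lerBlDl edistC enorm_le_edistD.
Qed.

Lemma tent_lipschitz r w z : 0 < r ->
  (tent r w - tent r z) ^+ 2 <= (edist w z / r) ^+ 2.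
Proof.
move=> r0; rewrite -ler_sqrt ?sqr_ge0// !sqrtr_sqr.
rewrite [leRHS]ger0_norm; last by rewrite divr_ge0 ?euclid_edist_ge0// ltW.
have /ler_normlP[h1 h2] : `|enorm w / r - enorm z / r| <= edist w z / r.
  rewrite -mulrBl normrM (gtr0_norm (_ : 0 < r^-1)) ?invr_gt0//.
  by rewrite ler_pM2r ?invr_gt0// enorm_le_edist.
rewrite /tent; set a := enorm w / r in h1 h2 *; set b := enorm z / r in h1 h2 *.
set c := _ / r in h1 h2 *.
by apply/ler_normlP; case: (leP 0 (1 - a)) => ?; case: (leP 0 (1 - b)) => ?; split; lra.
Qed.

Lemma proj_norm_le w : proj_norm w <= 1 + enorm w.
Proof.
rewrite -(@ler_pXn2r _ 2)// ?nnegrE ?addr_ge0 ?enorm_ge0//.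
  by rewrite proj_norm_sqr sqrrD enorm_sqr expr1n mul1r -addrA lerD2l lerDr mulrn_wge0// enorm_ge0.
exact/ltW/proj_norm_gt0.
Qed.

Lemma proj_normM_le d w z : enorm z <= d -> enorm w <= 2 * d ->
  proj_norm w * proj_norm z <= 1 + 4 * d ^+ 2.
Proof.
move=> zd wd; have d0 : 0 <= d := le_trans (enorm_ge0 z) zd.
rewrite -(@ler_pXn2r _ 2)// ?nnegrE ?addr_ge0 ?mulr_ge0 ?sqr_ge0//; try exact/ltW/proj_norm_gt0.
rewrite exprMn !proj_norm_sqr expr2 ler_pM ?addr_ge0 ?dot_ge0// lerD2l.
  rewrite -enorm_sqr (le_trans (_ : _ <= (2 * d) ^+ 2))//.
    by rewrite ler_pXn2r// ?nnegrE ?enorm_ge0// mulr_ge0.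
  by rewrite exprMn; lra.
rewrite -enorm_sqr (le_trans (_ : _ <= d ^+ 2))//.
  by rewrite ler_pXn2r// ?nnegrE ?enorm_ge0.
by have := sqr_ge0 d; lra.
Qed.

(** The antipodal map is an isometry, so the four pairs of hemispheres give only two kernels: same
    hemisphere here, opposite hemispheres in [kernel_far]. *)
Definition kernel_near w z : R :=
  (edist (gnomonic false w) (gnomonic false z) ^+ n)^-1.
Definition kernel_far w z : R :=
  (edist (gnomonic true w) (gnomonic false z) ^+ n)^-1.

Lemma edist_gnomonic_addb b c w z :
  edist (gnomonic b w) (gnomonic c z) =
  edist (gnomonic (b (+) c) w) (gnomonic false z).
Proof.
rewrite -[LHS]ger0_norm ?euclid_edist_ge0// -[RHS]ger0_norm ?euclid_edist_ge0//.
rewrite -!sqrtr_sqr !edist_gnomonic_sqr; congr (Num.sqrt (_ - _ * (_ / _))).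
by rewrite -!signr_addb addbF.
Qed.

Lemma kernel_near_ge0 w z : 0 <= kernel_near w z.
Proof. by rewrite invr_ge0 exprn_ge0// euclid_edist_ge0. Qed.

Lemma kernel_far_ge0 w z : 0 <= kernel_far w z.
Proof. by rewrite invr_ge0 exprn_ge0// euclid_edist_ge0. Qed.

Lemma kernel_nearC w z : kernel_near w z = kernel_near z w.
Proof. by rewrite /kernel_near edistC. Qed.

Lemma kernel_farC w z : kernel_far w z = kernel_far z w.
Proof. by rewrite /kernel_far edistC edist_gnomonic_addb. Qed.

Let kernel_le b w z : 0 < edist w z ->
  (edist (gnomonic b w) (gnomonic false z) ^+ n)^-1 <=
  (proj_norm w * proj_norm z) ^+ n * (edist w z ^+ n)^-1.
Proof.
move=> D0; have NN : 0 < proj_norm w * proj_norm z.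
  by rewrite mulr_gt0// proj_norm_gt0.
have le := edist_gnomonic_ge b false w z.
have e0 : 0 < edist w z / (proj_norm w * proj_norm z) by rewrite divr_gt0.
rewrite (_ : _ * _ = ((edist w z / (proj_norm w * proj_norm z)) ^+ n)^-1); last first.
  by rewrite expr_div_n invf_div.
rewrite lef_pV2 ?posrE ?exprn_gt0//; last exact: lt_le_trans le.
by rewrite lerXn2r ?nnegrE ?euclid_edist_ge0// ltW.
Qed.

Hypothesis n0 : (0 < n)%N.

Let kernel_near_eq0 w z : edist w z = 0 -> kernel_near w z = 0.
Proof.
move=> D0; rewrite /kernel_near (_ : edist _ _ = 0) ?expr0n ?gtn_eqF ?invr0//.
by apply/eqP; rewrite eq_le euclid_edist_ge0 andbT -D0 edist_gnomonic_le.
Qed.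

Lemma kernel_near_le w z :
  kernel_near w z <= (proj_norm w * proj_norm z) ^+ n * (edist w z ^+ n)^-1.
Proof.
(* On the diagonal both sides are 0, since the inverse of 0 is 0. *)
have [D0|D0] := eqVneq (edist w z) 0.
  by rewrite kernel_near_eq0// D0 expr0n gtn_eqF// invr0 mulr0.
by apply: kernel_le; rewrite lt_neqAle eq_sym D0 euclid_edist_ge0.
Qed.

Lemma kernel_near_ge w z : 0 < edist w z ->
  (edist w z ^+ n)^-1 <= kernel_near w z.
Proof.
move=> D0; have NN : 0 < proj_norm w * proj_norm z.
  by rewrite mulr_gt0// proj_norm_gt0.
have e0 : 0 < edist (gnomonic false w) (gnomonic false z).
  by apply: lt_le_trans (edist_gnomonic_ge _ _ _ _); rewrite divr_gt0.
rewrite lef_pV2 ?posrE ?exprn_gt0// lerXn2r ?nnegrE ?euclid_edist_ge0//.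
exact: edist_gnomonic_le.
Qed.

(** Bounds both kernels off the ball of radius d around z, for |z| <= d. With D = |w - z| the
    product of the two projection norms is at most 2 (2 + D), and 2 <= (2 / d) D, so it is at most 2
    (1 + 2 / d) D. *)
Definition kernel_bound d : R := (2 * (1 + 2 / d)) ^+ n.

Let le_kernel_bound d w z : 0 < d -> d <= 1 / 2 -> enorm z <= d ->
  d <= edist w z ->
  (proj_norm w * proj_norm z) ^+ n * (edist w z ^+ n)^-1 <= kernel_bound d.
Proof.
move=> d0 d1 zd dD; have D0 := lt_le_trans d0 dD.
rewrite -expr_div_n lerXn2r ?nnegrE//.
- by rewrite divr_ge0 ?mulr_ge0 ?euclid_edist_ge0//; exact/ltW/proj_norm_gt0.
- by rewrite mulr_ge0// addr_ge0// divr_ge0// ltW.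
rewrite ler_pdivrMr//.
have Nw := proj_norm_le w; have Nz := proj_norm_le z.
have wz := enorm_le_edistD z w; rewrite edistC in wz.
have Nw0 := proj_norm_gt0 w; have Nz0 := proj_norm_gt0 z.
have : 2 <= 2 / d * edist w z by rewrite mulrAC ler_pdivlMr// ler_pM2l.
have : proj_norm w * proj_norm z <= (2 + edist w z) * 2.
  by apply: ler_pM; [exact: ltW|exact: ltW|lra|lra].
set e := 2 / d * _ => h1 h2.
rewrite (_ : 2 * _ * _ = 2 * (edist w z + e)); last by rewrite /e; ring.
lra.
Qed.

Lemma kernel_bound_ge1 d : 0 < d -> 1 <= kernel_bound d.
Proof.
move=> d0; rewrite exprn_ege1//.
have : 0 < 2 / d by rewrite divr_gt0.
lra.
Qed.

Lemma kernel_near_le_bound d w z : 0 < d -> d <= 1 / 2 -> enorm z <= d ->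
  d <= edist w z -> kernel_near w z <= kernel_bound d.
Proof.
move=> d0 d1 zd dD; exact: le_trans (kernel_near_le w z) (le_kernel_bound _ _ _ _).
Qed.

(** No lower bound on |w - z| is asked for: if w and z are close in the chart, both are near the
    centre, so the actual points are near opposite poles and the kernel is at most 1. *)
Lemma kernel_far_le_bound d w z : 0 < d -> d <= 1 / 2 -> enorm z <= d ->
  kernel_far w z <= kernel_bound d.
Proof.
move=> d0 d1 zd; have [dD|Dd] := leP d (edist w z).
  by apply: le_trans (kernel_le _ _) (le_kernel_bound _ _ _ _); rewrite ?(lt_le_trans d0).
apply: le_trans (kernel_bound_ge1 d0).
have wz : -1 <= dot w z.
  have := dot_le_enorm w z; rewrite ler_norml => /andP[h _].
  apply: le_trans h; rewrite lerN2.
  have := enorm_le_edistD z w; rewrite edistC => h.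
  have : enorm w * enorm z <= 1 * 1.
    by apply: ler_pM; rewrite ?enorm_ge0//; lra.
  lra.
have e1 : 1 <= edist (gnomonic true w) (gnomonic false z).
  rewrite -(@ler_pXn2r _ 2)// ?nnegrE ?euclid_edist_ge0//.
  by have := @edist_gnomonic_opp_ge R n true w z wz; rewrite expr1n /=; lra.
by rewrite /kernel_far invf_le1 ?exprn_ege1// exprn_gt0// (lt_le_trans ltr01).
Qed.

Lemma gnomonic_density_le1 w : gnomonic_density w <= 1.
Proof.
rewrite /gnomonic_density invf_le1 ?exprn_ege1 ?proj_norm_ge1//.
by rewrite exprn_gt0// proj_norm_gt0.
Qed.

Lemma gnomonic_density_ge d w : enorm w <= 2 * d ->
  ((1 + 4 * d ^+ 2) ^+ n.+1)^-1 <= gnomonic_density w.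
Proof.
move=> wd; have N1 := proj_norm_ge1 w; have N0 := proj_norm_gt0 w.
have d0 : 0 <= d by have := enorm_ge0 w; lra.
have A0 : 0 < 1 + 4 * d ^+ 2 by have := sqr_ge0 d; lra.
rewrite /gnomonic_density lef_pV2 ?posrE ?exprn_gt0//.
rewrite lerXn2r ?nnegrE//; [exact: ltW|exact: ltW|].
(* A norm that is at least 1 is bounded by its square; this wastes a power of 1 + 4 d^2 but removes
   the square root. *)
apply: (@le_trans _ _ (proj_norm w ^+ 2)); first by rewrite expr2 ler_peMl// ltW.
rewrite proj_norm_sqr lerD2l -enorm_sqr (_ : 4 * d ^+ 2 = (2 * d) ^+ 2); last by ring.
by rewrite ler_pXn2r// ?nnegrE ?enorm_ge0// mulr_ge0.
Qed.

End tent.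

Ltac nneg := repeat match goal with
  | _ => assumption
  | |- is_true (0 <= _ ^+ 2) => exact: sqr_ge0
  | |- is_true (0 <= _ ^+ _) => apply: exprn_ge0
  | |- is_true (0 <= _ * _) => apply: mulr_ge0
  | |- is_true (0 <= _ + _) => apply: addr_ge0
  | |- is_true (0 <= _ ^-1) => rewrite invr_ge0
  | |- is_true (0 <= _ *+ _) => exact: ler0n
  | |- is_true (0 <= edist _ _) => exact: euclid_edist_ge0
  | |- is_true (0 <= gnomonic_density _) => exact: gnomonic_density_ge0
  | |- is_true (0 <= kernel_near _ _) => exact: kernel_near_ge0
  | |- is_true (0 <= kernel_far _ _) => exact: kernel_far_ge0
  | |- is_true (0 <= tent _ _) => exact: tent_ge0
  | |- is_true (0 <= 1) => exact: ler01
  | H : is_true (0 < ?x) |- is_true (0 <= ?x) => exact: ltW H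
  end.

(** * Pointwise bounds for the energy integrand in gnomonic coordinates *)

Section energy_density.
Context {R : realType} (n : nat).
Hypothesis n0 : (0 < n)%N.
Implicit Types (w z : euclid R n) (r d : R).

Definition annulus r d w z : R :=
  (r <= edist w z <= d)%R%:R * (edist w z ^+ n)^-1.

(** Share of the energy charged to the value of the tent at z. The annulus term is the leading one:
    (1 + 4 d^2)^n compares the spherical kernel with the flat one, and 2 counts the hemispheres. The
    last term collects the pairs in one hemisphere beyond distance d and all pairs in opposite
    hemispheres, each with weight 2. *)
Definition majorant r d w z : R := gnomonic_density z * tent r z ^+ 2 *
  (2 * (1 + 4 * d ^+ 2) ^+ n * annulus r d w z +
   4 * kernel_bound n d * gnomonic_density w).

(** Pairs at distance at most r, by the Lipschitz constant 1 / r. If |z| > 2 r both tents vanish;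
    otherwise r <= 1/2 bounds the projection norms by 2 at z and 5/2 at w, whence 5^n. *)
Definition near_bound r w z : R := (enorm z <= 2 * r)%R%:R *
  (2 * 5 ^+ n / r ^+ 2 *
   ((edist w z <= r)%R%:R * (edist w z ^+ 2 * (edist w z ^+ n)^-1))).

(** The annulus starts at 2 r because a point that far from some z with |z| < r is outside the
    support. *)
Definition minorant r d w z : R := gnomonic_density z * tent r z ^+ 2 *
  (2 * ((1 + 4 * d ^+ 2) ^+ n.+1)^-1 * annulus (2 * r) d w z).

Definition energy_density r w z : R :=
  gnomonic_density z * gnomonic_density w *
  ((tent r w - tent r z) ^+ 2 * (2 * kernel_near w z + 2 * kernel_far w z)).

Lemma annulusC r d w z : annulus r d w z = annulus r d z w.
Proof. by rewrite /annulus edistC. Qed.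

Lemma annulus_ge0 r d w z : 0 <= annulus r d w z.
Proof. rewrite /annulus; nneg. Qed.

Lemma energy_densityC r w z : energy_density r w z = energy_density r z w.
Proof.
by rewrite /energy_density kernel_nearC kernel_farC; ring.
Qed.

Lemma energy_density_ge0 r w z : 0 <= energy_density r w z.
Proof.
rewrite /energy_density; nneg.
Qed.

Lemma majorant_ge0 r d w z : 0 < d -> 0 <= majorant r d w z.
Proof.
move=> d0; have := annulus_ge0 r d w z.
have := le_trans ler01 (kernel_bound_ge1 n d0) => *; rewrite /majorant; nneg.
Qed.

Lemma near_bound_ge0 r w z : 0 <= near_bound r w z.
Proof.
rewrite /near_bound; nneg.
Qed.

Let far_part r d w z : 0 < r -> r <= d -> d <= 1 / 2 ->
  gnomonic_density z * gnomonic_density w * (tent r z ^+ 2 * kernel_far w z) <=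
  gnomonic_density z * tent r z ^+ 2 * (kernel_bound n d * gnomonic_density w).
Proof.
move=> r0 rd d1; have d0 := lt_le_trans r0 rd.
have [zr|zr] := leP r (enorm z).
  by rewrite tent_eq0// expr0n/= mul0r !mulr0 mul0r.
have Y := kernel_far_le_bound w d0 d1 (le_trans (ltW zr) rd).
rewrite [leLHS](_ : _ = gnomonic_density z * tent r z ^+ 2 *
  (kernel_far w z * gnomonic_density w)); last by ring.
rewrite ler_wpM2l//; first nneg.
by rewrite ler_wpM2r ?gnomonic_density_ge0.
Qed.

Let near_part r d w z : 0 < r -> r <= d -> d <= 1 / 2 -> r < edist w z ->
  gnomonic_density z * gnomonic_density w * (tent r z ^+ 2 * kernel_near w z) <=
  gnomonic_density z * tent r z ^+ 2 *
   ((1 + 4 * d ^+ 2) ^+ n * annulus r d w z + kernel_bound n d * gnomonic_density w).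
Proof.
move=> r0 rd d1 rD; have d0 := lt_le_trans r0 rd.
have A0 : 0 <= (1 + 4 * d ^+ 2) ^+ n.
  by rewrite exprn_ge0// addr_ge0// mulr_ge0// sqr_ge0.
have [zr|zr] := leP r (enorm z).
  by rewrite tent_eq0// expr0n/= mul0r !mulr0 mul0r.
have zd := le_trans (ltW zr) rd.
have w0 := gnomonic_density_ge0 w; have w1 := gnomonic_density_le1 w.
have X0 := kernel_near_ge0 w z.
rewrite [leLHS](_ : _ = gnomonic_density z * tent r z ^+ 2 *
  (kernel_near w z * gnomonic_density w)); last by ring.
rewrite ler_wpM2l//; first nneg.
have K0 := le_trans ler01 (kernel_bound_ge1 n d0).
have [dD|Dd] := leP d (edist w z).
  apply: (@le_trans _ _ (kernel_bound n d * gnomonic_density w)).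
    by rewrite ler_wpM2r// kernel_near_le_bound.
  by rewrite lerDr mulr_ge0// annulus_ge0.
apply: (@le_trans _ _ ((1 + 4 * d ^+ 2) ^+ n * annulus r d w z)); last first.
  by rewrite lerDl mulr_ge0.
apply: (@le_trans _ _ (kernel_near w z)); first by rewrite ler_piMr.
apply: le_trans (kernel_near_le n0 w z) _.
rewrite /annulus (ltW rD) (ltW Dd) mul1r ler_wpM2r ?invr_ge0 ?exprn_ge0 ?euclid_edist_ge0//.
have wz := enorm_le_edistD z w; rewrite edistC in wz.
have Nw0 := proj_norm_gt0 w; have Nz0 := proj_norm_gt0 z.
rewrite lerXn2r ?nnegrE//; [nneg|nneg|].
by apply: proj_normM_le => //; lra.
Qed.

Let close_part r w z : 0 < r -> r <= 1 / 2 -> edist w z <= r ->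
  gnomonic_density z * gnomonic_density w *
    ((tent r w - tent r z) ^+ 2 * (2 * kernel_near w z)) <= near_bound r w z.
Proof.
move=> r0 r1 Dr; rewrite /near_bound Dr mul1r.
have wz := enorm_le_edistD z w; have zw := enorm_le_edistD w z.
rewrite edistC in wz.
have [zr|zr] := leP (enorm z) (2 * r); last first.
  have tz : tent r z = 0 by rewrite tent_eq0//; lra.
  have tw : tent r w = 0 by rewrite tent_eq0//; lra.
  by rewrite tz tw subr0 expr0n/= !mul0r mulr0.
rewrite mul1r.
have w0 := gnomonic_density_ge0 w; have w1 := gnomonic_density_le1 w.
have z0 := gnomonic_density_ge0 z; have z1 := gnomonic_density_le1 z.
have X0 := kernel_near_ge0 w z; have T := tent_lipschitz w z r0.
apply: (@le_trans _ _ ((tent r w - tent r z) ^+ 2 * (2 * kernel_near w z))).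
  rewrite ler_piMl//; first nneg.
  by rewrite mulr_ile1.
have N : (proj_norm w * proj_norm z) ^+ n <= 5 ^+ n.
  have Nw := proj_norm_le w; have Nz := proj_norm_le z.
  have Nw0 := proj_norm_gt0 w; have Nz0 := proj_norm_gt0 z.
  rewrite lerXn2r ?nnegrE ?mulr_ge0//; [exact: ltW|exact: ltW|].
  rewrite (_ : 5 = 5 / 2 * 2); last by field.
  by apply: ler_pM; [exact: ltW|exact: ltW|lra|lra].
have X : kernel_near w z <= 5 ^+ n * (edist w z ^+ n)^-1.
  apply: le_trans (kernel_near_le n0 w z) _.
  by rewrite ler_wpM2r// invr_ge0 exprn_ge0// euclid_edist_ge0.
rewrite [leRHS](_ : _ = (edist w z / r) ^+ 2 * (2 * (5 ^+ n * (edist w z ^+ n)^-1))); last first.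
  by rewrite expr_div_n; ring.
apply: ler_pM => //; try nneg.
by rewrite ler_pM2l.
Qed.

Lemma energy_density_le r d w z : 0 < r -> r <= d -> d <= 1 / 2 ->
  energy_density r w z <=
  majorant r d w z + majorant r d z w + near_bound r w z.
Proof.
move=> r0 rd d1; have d0 := lt_le_trans r0 rd.
(* Tents are nonnegative, so the cross term is dropped without the factor 2 of the general
   inequality. That factor would spoil the leading constant. *)
have t : (tent r w - tent r z) ^+ 2 <= tent r w ^+ 2 + tent r z ^+ 2.
  have := mulr_ge0 (tent_ge0 r w) (tent_ge0 r z); rewrite sqrrB; lra.
have rho0 : 0 <= gnomonic_density z * gnomonic_density w.
  by rewrite mulr_ge0 ?gnomonic_density_ge0.
have X0 := kernel_near_ge0 w z; have Y0 := kernel_far_ge0 w z.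
have Fz := far_part w z r0 rd d1; have Fw := far_part z w r0 rd d1.
rewrite kernel_farC (mulrC (gnomonic_density w)) in Fw.
have tY : gnomonic_density z * gnomonic_density w *
    ((tent r w - tent r z) ^+ 2 * kernel_far w z) <=
    gnomonic_density z * gnomonic_density w * (tent r w ^+ 2 * kernel_far w z) +
    gnomonic_density z * gnomonic_density w * (tent r z ^+ 2 * kernel_far w z).
  by rewrite -mulrDr -mulrDl ler_wpM2l// ler_wpM2r.
have K0 := le_trans ler01 (kernel_bound_ge1 n d0).
have A0 : 0 <= (1 + 4 * d ^+ 2) ^+ n.
  by rewrite exprn_ge0// addr_ge0// mulr_ge0// sqr_ge0.
have B0 (x y : euclid R n) : 0 <= gnomonic_density x * tent r x ^+ 2 *
    (kernel_bound n d * gnomonic_density y).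
  by nneg.
have C0 (x y : euclid R n) : 0 <= gnomonic_density x * tent r x ^+ 2 *
    ((1 + 4 * d ^+ 2) ^+ n * annulus r d y x).
  by have := annulus_ge0 r d y x => ?; nneg.
rewrite /energy_density /majorant.
have [rD|Dr] := ltP r (edist w z).
  have Nz := near_part r0 rd d1 rD.
  have rD' : r < edist z w by rewrite edistC.
  have Nw := near_part r0 rd d1 rD'.
  rewrite kernel_nearC (mulrC (gnomonic_density w)) in Nw.
  have tX : gnomonic_density z * gnomonic_density w *
    ((tent r w - tent r z) ^+ 2 * kernel_near w z) <=
    gnomonic_density z * gnomonic_density w * (tent r w ^+ 2 * kernel_near w z) +
    gnomonic_density z * gnomonic_density w * (tent r z ^+ 2 * kernel_near w z).
    by rewrite -mulrDr -mulrDl ler_wpM2l// ler_wpM2r.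
  have := near_bound_ge0 r w z.
  move: (B0 z w) (B0 w z) (C0 z w) (C0 w z) => *.
  lra.
have := close_part r0 (le_trans rd d1) Dr.
move: (B0 z w) (B0 w z) (C0 z w) (C0 w z) => *.
lra.
Qed.

Let minorant_le r d w z : 0 < r -> r <= d -> tent r w = 0 ->
  minorant r d w z <= energy_density r w z.
Proof.
move=> r0 rd tw; rewrite /minorant.
have [zr|zr] := leP r (enorm z).
  by rewrite (tent_eq0 r0 zr) expr0n/= mulr0 mul0r energy_density_ge0.
rewrite /annulus; case: (boolP (_ <= _ <= _)) => [/andP[rD Dd]|_]; last first.
  by rewrite mul0r !mulr0 energy_density_ge0.
rewrite mul1r /energy_density tw sub0r sqrrN.
have D0 : 0 < edist w z by apply: lt_le_trans rD; rewrite mulr_gt0.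
have wz := enorm_le_edistD z w; rewrite edistC in wz.
have wd : enorm w <= 2 * d by lra.
have rw := gnomonic_density_ge wd.
have X := kernel_near_ge D0.
have Y0 := kernel_far_ge0 w z.
have rz0 := gnomonic_density_ge0 z.
rewrite [leRHS](_ : _ = gnomonic_density z * tent r z ^+ 2 *
  (gnomonic_density w * (2 * kernel_near w z + 2 * kernel_far w z))); last by ring.
rewrite ler_wpM2l//; first nneg.
rewrite [leLHS](_ : _ = ((1 + 4 * d ^+ 2) ^+ n.+1)^-1 *
  (2 * (edist w z ^+ n)^-1)); last by ring.
by apply: ler_pM; [nneg|nneg|exact: rw|lra].
Qed.

(** The two minorants never compete: if both points are in the support, their distance is below 2 r
    and both minorants vanish; otherwise one of the tents is 0. *)
Lemma energy_density_ge r d w z : 0 < r -> r <= d ->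
  minorant r d w z + minorant r d z w <= energy_density r w z.
Proof.
move=> r0 rd; have [rw|rw] := leP r (enorm w).
  have tw := tent_eq0 r0 rw.
  by rewrite [X in _ + X]/minorant tw expr0n/= mulr0 mul0r addr0 minorant_le.
have [rz|rz] := leP r (enorm z).
  have tz := tent_eq0 r0 rz.
  by rewrite {1}/minorant tz expr0n/= mulr0 mul0r add0r energy_densityC minorant_le.
have D : edist w z < 2 * r by have := edist_le_enormD w z; lra.
have a0 : annulus (2 * r) d w z = 0.
  by rewrite /annulus leNgt D mul0r.
by rewrite /minorant (annulusC _ _ z w) a0 !mulr0 addr0 energy_density_ge0.
Qed.

End energy_density.

(** * Energy, norm and entropy of the tents *)

Section energy_estimates.
Context {R : realType}.
Local Notation mu := (@lebesgue_measure R).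
Local Notation lambda := (@lebesgue_measuren R).
Variable n : nat.
Hypothesis n0 : (0 < n)%N.
Local Notation sphere := (unit_sphere R n.+1).
Local Notation sigma := (surface_measure R n).
Local Notation rho := (@gnomonic_density R n).
Local Notation kap := (fine (@radial_constant R n)).
Local Notation area := (@sphere_area R n).
Implicit Types (w z : euclid R n) (r d : R).
Local Open Scope ereal_scope.

Lemma kap_gt0 : (0 < kap)%R.
Proof. by have [] := @radial_constant_Gamma R n n0. Qed.

Lemma measurable_tent r : measurable_fun setT (@tent R n r).
Proof.
apply: measurable_maxr => //; apply: measurable_funB => //.
by apply: measurable_funM => //; exact: measurable_enorm.
Qed.

Lemma measurable_sphere_tent r : measurable_fun setT (@sphere_tent R n r).
Proof.
apply: measurable_maxr => //; apply: measurable_funB => //.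
apply: measurable_funM => //.
have mt : measurable_fun setT (fun x : euclid R n.+1 => tnth x ord0 : R).
  exact: measurable_tnth.
pose g (s : R) : R := (Num.max s 0 `^ 2^-1)%R.
have mg : measurable_fun setT g.
  by apply: measurable_fun_powR; apply: measurable_maxr.
rewrite [X in measurable_fun _ X](_ : _ =
    (fun x : euclid R n.+1 => g ((tnth x ord0 ^+ 2)^-1 - 1)%R)).
  apply: (measurableT_comp mg); apply: measurable_funB => //.
  by apply: measurable_fun_invr; exact: measurable_funX.
apply/funext => x; rewrite /g powR12_sqrt ?le_max ?lexx ?orbT//.
by case: (leP _ 0%R) => // s0; rewrite sqrtr0 ler0_sqrtr.
Qed.

(** The cone over the sphere lies in the unit ball, whose volume [integral_ball_le] controls. *)
Lemma sphere_area_fin : sigma sphere = area%:E.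
Proof.
rewrite fineK// ge0_fin_numE//.
rewrite [sigma _]/= /surface_measure lte_mul_pinfty//.
have mB := @measurable_unit_ball R n.+1.
apply: (@le_lt_trans _ _ (lambda n.+1 (unit_ball R n.+1))).
  have mA : measurable (unit_ball R n.+1 `&` @normalize R n.+1 @^-1` sphere).
    apply: measurableI => //; rewrite -[X in measurable X]setTI.
    by apply: measurable_normalize => //; exact: measurable_unit_sphere.
  apply: le_measure; [by rewrite inE|by rewrite inE|].
  by move=> x [].
apply: le_lt_trans (ltry (expR 1 * pi `^ (n.+1%:R / 2) * 1 ^+ n.+1)%R).
apply: le_trans (@integral_ball_le R n.+1 1%R _); last by [].
rewrite -[leLHS]mul1e -integral_cst// integral_mkcond.
apply: ge0_le_integral => //.
- by move=> w _; apply: erestrict_ge0 => ? _; exact: lee01.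
- by apply/(measurable_restrictT _ mB).
- apply/measurable_EFinP; apply: measurable_fun_natr_bool.
  by apply: measurable_fun_ler => //; exact: measurable_enorm.
- move=> w _; rewrite patchE; case: ifPn => [|_]; last by rewrite lee_fin.
  by rewrite inE /unit_ball/= => /ltW ->.
Qed.

Let mrho : measurable_fun setT rho.
Proof. exact: measurable_gnomonic_density. Qed.

Lemma integral_gnomonic_density : \int[lambda n]_w (rho w)%:E = (area / 2)%:E.
Proof.
have : area%:E = 2%:E * \int[lambda n]_w (rho w)%:E.
  rewrite -sphere_area_fin -[LHS]mul1e -integral_cst//; last first.
    exact: measurable_unit_sphere.
  rewrite ge0_integral_sphere// -ge0_integralZl//; last 2 first.
  - exact/measurable_EFinP.
  - by move=> w _; rewrite lee_fin gnomonic_density_ge0.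
  by apply: eq_integral => w _; rewrite muleC -EFinD.
have : 0 <= \int[lambda n]_w (rho w)%:E.
  by apply: integral_ge0 => w _; rewrite lee_fin gnomonic_density_ge0.
case: (\int[lambda n]_w _) => [x| |]//.
  by move=> _; rewrite -EFinM => -[->]; rewrite mulrAC mulfV ?mul1r.
by move=> _; rewrite gt0_muley ?lte_fin.
Qed.

(** Squared norm of one of the two bumps, half of ||u_r||_2^2. *)
Definition mass r : R := fine (\int[lambda n]_z (rho z * tent r z ^+ 2)%:E).

Let m_tent2 r : measurable_fun setT (fun z => rho z * tent r z ^+ 2)%R.
Proof.
by apply: measurable_funM => //; apply: measurable_funX; exact: measurable_tent.
Qed.

Let tent2_ge0 r z : (0 <= rho z * tent r z ^+ 2)%R.
Proof. by rewrite mulr_ge0 ?gnomonic_density_ge0 ?sqr_ge0. Qed.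

Lemma integral_mass r : (0 < r)%R ->
  \int[lambda n]_z (rho z * tent r z ^+ 2)%:E = (mass r)%:E.
Proof.
move=> r0; rewrite fineK// ge0_fin_numE; last first.
  by apply: integral_ge0 => z _; rewrite lee_fin.
apply: (@le_lt_trans _ _ (area / 2)%:E); last exact: ltry.
rewrite -integral_gnomonic_density; apply: ge0_le_integral => //.
- by move=> z _; rewrite lee_fin.
- exact/measurable_EFinP.
- exact/measurable_EFinP.
- move=> z _; rewrite lee_fin ler_piMr ?gnomonic_density_ge0//.
  by rewrite exprn_ile1 ?tent_ge0 ?tent_le1.
Qed.

Lemma mass_ge0 r : (0 <= mass r)%R.
Proof. by apply: fine_ge0; apply: integral_ge0 => z _; rewrite lee_fin. Qed.

Lemma norm2_sphere_tent r : (0 < r)%R -> norm2_sq (sphere_tent (n := n) r) = (2 * mass r)%:E.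
Proof.
move=> r0; rewrite /norm2_sq ge0_integral_sphere//; last first.
  apply/measurable_EFinP; apply: measurable_funX.
  exact: (measurableT_comp (@normr_measurable _ _) (measurable_sphere_tent r)).
rewrite EFinM -integral_mass// -ge0_integralZl//; last 2 first.
- exact/measurable_EFinP.
- by move=> z _; rewrite lee_fin.
apply: eq_integral => w _; rewrite !sphere_tent_gnomonic -EFinD -!EFinM.
by rewrite real_normK ?num_real//; congr EFin; ring.
Qed.

Let T2 : measurableType _ := (euclid R n * euclid R n)%type.

Let mk dT (T : measurableType dT) (b c : bool) (f g : T -> euclid R n) :
  measurable_fun setT f -> measurable_fun setT g ->
  measurable_fun setT (fun x => edist (gnomonic b (f x)) (gnomonic c (g x)) ^+ n)%R.
Proof.
move=> mf mg; apply: measurable_funX; apply: measurable_fun_edist.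
- exact: (measurableT_comp (@measurable_gnomonic R n b) mf).
- exact: (measurableT_comp (@measurable_gnomonic R n c) mg).
Qed.

Lemma energy_sphere_tent r : energy (sphere_tent (n := n) r) =
  \int[lambda n]_z \int[lambda n]_w (energy_density r w z)%:E.
Proof.
rewrite /energy /double_int.
rewrite (@ge0_double_integral_sphere R n n0 (fun x : euclid R n.+1 * euclid R n.+1 =>
  (`|sphere_tent r x.1 - sphere_tent r x.2| ^+ 2 / edist x.1 x.2 ^+ n)%:E)).
- apply: eq_integral => z _; apply: eq_integral => w _ /=.
  rewrite !sphere_tent_gnomonic -!EFinD -!EFinM; congr EFin.
  rewrite real_normK ?num_real// (edist_gnomonic_addb false true).
  rewrite (edist_gnomonic_addb true true)/=.
  by rewrite /energy_density /kernel_near /kernel_far; ring.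
- apply/measurable_EFinP; apply: measurable_funM.
    apply: measurable_funX; apply: (measurableT_comp (@normr_measurable _ _)).
    apply: measurable_funB.
    + exact: (measurableT_comp (measurable_sphere_tent r) measurable_fst).
    + exact: (measurableT_comp (measurable_sphere_tent r) measurable_snd).
  apply: measurable_fun_invr; apply: measurable_funX.
  by apply: measurable_fun_edist; [exact: measurable_fst|exact: measurable_snd].
- by move=> x; rewrite lee_fin divr_ge0// ?exprn_ge0// euclid_edist_ge0.
Qed.

Section joint_measurability.
Variables (r d : R).

Let m1 : measurable_fun setT (fun x : T2 => x.1). Proof. exact: measurable_fst. Qed.
Let m2 : measurable_fun setT (fun x : T2 => x.2). Proof. exact: measurable_snd. Qed.

Lemma measurable_energy_density :
  measurable_fun setT (fun x : T2 => energy_density r x.1 x.2).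
Proof.
apply: measurable_funM.
  by apply: measurable_funM;
    [exact: (measurableT_comp mrho m2)|exact: (measurableT_comp mrho m1)].
apply: measurable_funM.
  apply: measurable_funX; apply: measurable_funB.
  - exact: (measurableT_comp (measurable_tent r) m1).
  - exact: (measurableT_comp (measurable_tent r) m2).
apply: measurable_funD; apply: measurable_funM => //; apply: measurable_fun_invr;
  exact: mk.
Qed.

Let mD : measurable_fun setT (fun x : T2 => edist x.1 x.2).
Proof. exact: measurable_fun_edist. Qed.

Lemma measurable_annulus a b :
  measurable_fun setT (fun x : T2 => annulus a b x.1 x.2).
Proof.
apply: measurable_funM.
  by apply: measurable_fun_natr_bool; apply: measurable_and; exact: measurable_fun_ler.
by apply: measurable_fun_invr; exact: measurable_funX.
Qed.

Lemma measurable_majorant :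
  measurable_fun setT (fun x : T2 => majorant r d x.1 x.2).
Proof.
apply: measurable_funM; first exact: (measurableT_comp (m_tent2 r) m2).
apply: measurable_funD; apply: measurable_funM => //.
  exact: measurable_annulus.
exact: (measurableT_comp mrho m1).
Qed.

Lemma measurable_minorant :
  measurable_fun setT (fun x : T2 => minorant r d x.1 x.2).
Proof.
apply: measurable_funM; first exact: (measurableT_comp (m_tent2 r) m2).
by apply: measurable_funM => //; exact: measurable_annulus.
Qed.

Lemma measurable_near_bound :
  measurable_fun setT (fun x : T2 => near_bound r x.1 x.2).
Proof.
apply: measurable_funM.
  apply: measurable_fun_natr_bool; apply: measurable_fun_ler => //.
  exact: (measurableT_comp measurable_enorm m2).
apply: measurable_funM => //; apply: measurable_funM.
  by apply: measurable_fun_natr_bool; exact: measurable_fun_ler.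
apply: measurable_funM; first exact: measurable_funX.
by apply: measurable_fun_invr; exact: measurable_funX.
Qed.

End joint_measurability.

Lemma ge0_double_integralC (f : euclid R n -> euclid R n -> R) :
  measurable_fun setT (fun x : T2 => f x.1 x.2) -> (forall w z, 0 <= f w z)%R ->
  \int[lambda n]_z \int[lambda n]_w (f z w)%:E =
  \int[lambda n]_z \int[lambda n]_w (f w z)%:E.
Proof.
move=> mf f0.
apply: (fubini_tonelli (fun x : T2 => (f x.1 x.2)%:E)); first exact/measurable_EFinP.
by move=> x; rewrite lee_fin.
Qed.

Lemma measurable_transpose (f : euclid R n -> euclid R n -> R) :
  measurable_fun setT (fun x : T2 => f x.1 x.2) ->
  measurable_fun setT (fun x : T2 => f x.2 x.1).
Proof. by move=> mf; exact: (measurableT_comp mf (@measurable_swap _ _ _ _)). Qed.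

Lemma measurable_section (f : euclid R n -> euclid R n -> R) z :
  measurable_fun setT (fun x : T2 => f x.1 x.2) ->
  measurable_fun setT (fun w => (f w z)%:E).
Proof.
move=> mf; apply/measurable_EFinP.
exact: (measurable_fun_pair1 z mf).
Qed.

Lemma measurable_inner_integral (f : euclid R n -> euclid R n -> R) :
  measurable_fun setT (fun x : T2 => f x.1 x.2) -> (forall w z, 0 <= f w z)%R ->
  measurable_fun setT (fun z => \int[lambda n]_w (f w z)%:E).
Proof.
move=> mf f0.
apply: (measurable_fun_fubini_tonelli_G (fun x : T2 => (f x.1 x.2)%:E)).
  exact/measurable_EFinP.
by move=> x; rewrite lee_fin.
Qed.

Lemma ge0_double_integralD (f g : euclid R n -> euclid R n -> R) :
  measurable_fun setT (fun x : T2 => f x.1 x.2) -> (forall w z, 0 <= f w z)%R ->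
  measurable_fun setT (fun x : T2 => g x.1 x.2) -> (forall w z, 0 <= g w z)%R ->
  \int[lambda n]_z \int[lambda n]_w (f w z + g w z)%:E =
  \int[lambda n]_z \int[lambda n]_w (f w z)%:E +
  \int[lambda n]_z \int[lambda n]_w (g w z)%:E.
Proof.
move=> mf f0 mg g0; rewrite -ge0_integralD//.
- apply: eq_integral => z _; rewrite -ge0_integralD//.
  + by move=> w _; rewrite lee_fin.
  + exact: measurable_section.
  + by move=> w _; rewrite lee_fin.
  + exact: measurable_section.
- by move=> z _; apply: integral_ge0 => w _; rewrite lee_fin.
- exact: measurable_inner_integral.
- by move=> z _; apply: integral_ge0 => w _; rewrite lee_fin.
- exact: measurable_inner_integral.
Qed.

Lemma ge0_le_double_integral (f g : euclid R n -> euclid R n -> R) :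
  measurable_fun setT (fun x : T2 => f x.1 x.2) -> (forall w z, 0 <= f w z)%R ->
  measurable_fun setT (fun x : T2 => g x.1 x.2) -> (forall w z, f w z <= g w z)%R ->
  \int[lambda n]_z \int[lambda n]_w (f w z)%:E <=
  \int[lambda n]_z \int[lambda n]_w (g w z)%:E.
Proof.
move=> mf f0 mg fg; have g0 w z : (0 <= g w z)%R by exact: le_trans (fg w z).
apply: ge0_le_integral => //.
- by move=> z _; apply: integral_ge0 => w _; rewrite lee_fin.
- exact: measurable_inner_integral.
- exact: measurable_inner_integral.
- move=> z _; apply: ge0_le_integral => //.
  + by move=> w _; rewrite lee_fin.
  + exact: measurable_section.
  + exact: measurable_section.
  + by move=> w _; rewrite lee_fin.
Qed.

Let integral_annulusE z (a b : R) : (0 < a)%R -> (a < b)%R ->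
  \int[lambda n]_w (annulus a b w z)%:E = (2 * kap * (ln b - ln a))%:E.
Proof. exact: integral_annulus. Qed.

Let m_annulus z a b : measurable_fun setT (fun w => annulus a b w z).
Proof. exact: (measurable_fun_pair1 z (measurable_annulus a b)). Qed.

Let integral_annulus_density z (a b A B : R) : (0 < a)%R -> (a < b)%R ->
  (0 <= A)%R -> (0 <= B)%R ->
  \int[lambda n]_w (A * annulus a b w z + B * rho w)%:E =
  (A * (2 * kap * (ln b - ln a)) + B * (area / 2))%:E.
Proof.
move=> a0 ab A0 B0; under eq_integral do rewrite EFinD.
have an0 w : (0 <= annulus a b w z)%R by exact: annulus_ge0.
have rh0 w : (0 <= rho w)%R by exact: gnomonic_density_ge0.
rewrite ge0_integralD//.
- under eq_integral do rewrite EFinM.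
  under [X in _ + X = _]eq_integral do rewrite EFinM.
  rewrite ge0_integralZl//; [|exact/measurable_EFinP|by move=> w _; rewrite lee_fin].
  rewrite ge0_integralZl//; [|exact/measurable_EFinP|by move=> w _; rewrite lee_fin].
  by rewrite integral_annulusE// integral_gnomonic_density.
- by move=> w _; rewrite lee_fin mulr_ge0.
- by apply/measurable_EFinP; apply: measurable_funM.
- by move=> w _; rewrite lee_fin mulr_ge0.
- by apply/measurable_EFinP; apply: measurable_funM.
Qed.

(** Common form of the majorant and, with B = 0, of the minorant: the inner integral of the bracket
    does not depend on z, so the outer one contributes only the mass. *)
Let ge0_integral_weighted r (a b A B : R) : (0 < r)%R -> (0 < a)%R -> (a < b)%R ->
  (0 <= A)%R -> (0 <= B)%R ->
  \int[lambda n]_z \int[lambda n]_w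
    (rho z * tent r z ^+ 2 * (A * annulus a b w z + B * rho w))%:E =
  (mass r * (A * (2 * kap * (ln b - ln a)) + B * (area / 2)))%:E.
Proof.
move=> r0 a0 ab A0 B0.
have I0 : (0 <= A * (2 * kap * (ln b - ln a)) + B * (area / 2))%R.
  have b0 := lt_trans a0 ab.
  have : (0 <= ln b - ln a)%R by rewrite subr_ge0 ler_ln ?posrE//; exact: ltW.
  have := kap_gt0; have : (0 <= area)%R by exact: fine_ge0.
  by move=> *; nneg.
transitivity (\int[lambda n]_z ((rho z * tent r z ^+ 2)%:E *
    (A * (2 * kap * (ln b - ln a)) + B * (area / 2))%:E)).
  apply: eq_integral => z _.
  under eq_integral do rewrite EFinM.
  rewrite ge0_integralZl//.
  - by rewrite integral_annulus_density.
  - by apply/measurable_EFinP; apply: measurable_funD; apply: measurable_funM.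
  - by move=> w _; rewrite lee_fin; have := annulus_ge0 a b w z => ?; nneg.
  - by rewrite lee_fin.
rewrite ge0_integralZr//.
- by rewrite integral_mass.
- exact/measurable_EFinP.
- by move=> z _; rewrite lee_fin.
Qed.

Lemma integral_majorant r d : (0 < r)%R -> (r < d)%R ->
  \int[lambda n]_z \int[lambda n]_w (majorant r d w z)%:E =
  (mass r * (2 * (1 + 4 * d ^+ 2) ^+ n * (2 * kap * (ln d - ln r)) +
     4 * kernel_bound n d * (area / 2)))%:E.
Proof.
move=> r0 rd; have d0 := lt_trans r0 rd.
have A0 : (0 <= (1 + 4 * d ^+ 2) ^+ n)%R by nneg.
have K0 := le_trans ler01 (kernel_bound_ge1 n d0).
by rewrite ge0_integral_weighted//; nneg.
Qed.

Lemma integral_minorant r d : (0 < r)%R -> (2 * r < d)%R ->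
  \int[lambda n]_z \int[lambda n]_w (minorant r d w z)%:E =
  (mass r * (2 * ((1 + 4 * d ^+ 2) ^+ n.+1)^-1 *
     (2 * kap * (ln d - ln (2 * r)))))%:E.
Proof.
move=> r0 rd.
have A0 : (0 <= 2 * ((1 + 4 * d ^+ 2) ^+ n.+1)^-1)%R by nneg.
have r20 : (0 < 2 * r)%R by rewrite mulr_gt0.
have := @ge0_integral_weighted r (2 * r)%R d _ 0%R r0 r20 rd A0 (lexx _).
rewrite mul0r addr0 => <-; apply: eq_integral => z _; apply: eq_integral => w _.
by rewrite mul0r addr0.
Qed.

(** The r^2 of [integral_ball_sqr] cancels the squared slope 1 / r^2. What remains is the volume of
    a ball of radius 2 r, an O(r^n) without logarithm. *)
Lemma integral_near_bound r : (0 < r)%R ->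
  \int[lambda n]_z \int[lambda n]_w (near_bound r w z)%:E <=
  (2 * 5 ^+ n * kap * (expR 1 * pi `^ (n%:R / 2) * (2 * r) ^+ n))%:E.
Proof.
move=> r0; have r20 : (0 < 2 * r)%R by rewrite mulr_gt0.
have c0 : (0 <= 2 * 5 ^+ n * kap)%R by have := kap_gt0 => ?; nneg.
have mb : measurable_fun setT (fun z : euclid R n => (enorm z <= 2 * r)%R%:R : R).
  by apply: measurable_fun_natr_bool; apply: measurable_fun_ler => //; exact: measurable_enorm.
apply: (@le_trans _ _ (\int[lambda n]_z ((2 * 5 ^+ n * kap)%:E * ((enorm z <= 2 * r)%R%:R)%:E))).
  rewrite le_eqVlt; apply/orP; left; apply/eqP; apply: eq_integral => z _.
  have mJ : measurable_fun setT (fun w : euclid R n =>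
      ((edist w z <= r)%R%:R * (edist w z ^+ 2 * (edist w z ^+ n)^-1))%:E).
    have mD : measurable_fun setT (fun w : euclid R n => edist w z).
      by apply: measurable_fun_edist => //; exact: measurable_cst.
    apply/measurable_EFinP; apply: measurable_funM.
      by apply: measurable_fun_natr_bool; exact: measurable_fun_ler.
    apply: measurable_funM; first exact: measurable_funX.
    by apply: measurable_fun_invr; exact: measurable_funX.
  rewrite /near_bound; under eq_integral do rewrite mulrA EFinM.
  rewrite ge0_integralZl//.
  - rewrite integral_ball_sqr// -!EFinM; congr EFin.
    by field; rewrite gt_eqF.
  - by move=> w _; rewrite lee_fin; nneg.
  - by rewrite lee_fin; nneg.
rewrite ge0_integralZl//.
- by rewrite [leRHS]EFinM lee_wpmul2l// integral_ball_le.
- exact/measurable_EFinP.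
Qed.

(** By Tonelli the majorant and its transpose contribute equally. With N = 2 [mass r] the leading
    term is 4 kappa N ln(1/r), up to the factor (1 + 4 d^2)^n. *)
Lemma energy_le r d : (0 < r)%R -> (r < d)%R -> (d <= 1 / 2)%R ->
  energy (sphere_tent (n := n) r) <=
  (2 * mass r * (2 * (1 + 4 * d ^+ 2) ^+ n * (2 * kap * (ln d - ln r)) +
     4 * kernel_bound n d * (area / 2)) +
   2 * 5 ^+ n * kap * (expR 1 * pi `^ (n%:R / 2) * (2 * r) ^+ n))%:E.
Proof.
move=> r0 rd d1; have d0 := lt_trans r0 rd.
rewrite energy_sphere_tent.
have mM := measurable_majorant r d.
have mM' := measurable_transpose mM.
have mN := measurable_near_bound r.
have M0 w z : (0 <= majorant r d w z)%R by exact: majorant_ge0.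
have N0 w z : (0 <= near_bound r w z)%R by exact: near_bound_ge0.
apply: (@le_trans _ _ (\int[lambda n]_z \int[lambda n]_w
    (majorant r d w z + majorant r d z w + near_bound r w z)%:E)).
  apply: (ge0_le_double_integral (measurable_energy_density r)).
  - by move=> w z; exact: energy_density_ge0.
  - by apply: measurable_funD => //; apply: measurable_funD.
  - by move=> w z; apply: energy_density_le => //; exact: ltW.
rewrite (@ge0_double_integralD (fun w z => majorant r d w z + majorant r d z w)%R
  (fun w z => near_bound r w z))//; last 2 first.
- exact: measurable_funD.
- by move=> w z; rewrite addr_ge0.
rewrite (@ge0_double_integralD (fun w z => majorant r d w z)
  (fun w z => majorant r d z w))//.
rewrite (@ge0_double_integralC (fun w z => majorant r d w z))//.
rewrite integral_majorant// -EFinD [leRHS]EFinD; apply: leeD; last exact: integral_near_bound.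
by rewrite lee_fin; lra.
Qed.

Lemma energy_ge r d : (0 < r)%R -> (2 * r < d)%R ->
  (2 * mass r * (2 * ((1 + 4 * d ^+ 2) ^+ n.+1)^-1 *
     (2 * kap * (ln d - ln (2 * r)))))%:E <= energy (sphere_tent (n := n) r).
Proof.
move=> r0 rd; rewrite energy_sphere_tent.
have mM := measurable_minorant r d.
have mM' := measurable_transpose mM.
have M0 w z : (0 <= minorant r d w z)%R.
  by rewrite /minorant; have := annulus_ge0 (2 * r) d w z => ?; nneg.
apply: (@le_trans _ _ (\int[lambda n]_z \int[lambda n]_w
    (minorant r d w z + minorant r d z w)%:E)); last first.
  apply: (@ge0_le_double_integral (fun w z => minorant r d w z + minorant r d z w)%R).
  - exact: measurable_funD.
  - by move=> w z; rewrite addr_ge0.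
  - exact: measurable_energy_density.
  - by move=> w z; apply: energy_density_ge => //; lra.
rewrite (@ge0_double_integralD (fun w z => minorant r d w z)
  (fun w z => minorant r d z w))//.
rewrite (@ge0_double_integralC (fun w z => minorant r d w z))//.
by rewrite integral_minorant// -EFinD lee_fin; lra.
Qed.

(** Restrict to r/4 <= |w| <= r/2. There the tent is at least 1/2, the density is bounded below by
    its bound for |w| <= 1, and (r/4)^n |w|^(-n) <= 1. Inserting this last factor reduces the volume
    to [integral_annulus], whence ln 2. *)
Lemma mass_ge r : (0 < r)%R -> (r <= 1)%R ->
  (((1 + 4 * (1 / 2) ^+ 2) ^+ n.+1)^-1 / 4 * ((1 / 4) ^+ n) * (2 * kap * ln 2) * r ^+ n
    <= mass r)%R.
Proof.
move=> r0 r1; rewrite -lee_fin -integral_mass//.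
set c := ((1 + _) ^+ n.+1)^-1%R.
pose z0 : euclid R n := [tuple of nseq n 0%R].
have ez w : edist w z0 = enorm w.
  rewrite /edist /enorm /dot; congr Num.sqrt; apply: eq_bigr => i _.
  rewrite (_ : tnth z0 i = 0%R); first by rewrite subr0 expr2.
  by rewrite (tnth_nth 0%R) nth_nseq if_same.
have c0 : (0 <= c)%R by rewrite /c; nneg.
have k0 : (0 <= c / 4 * (r / 4) ^+ n)%R by nneg.
have r40 : (0 < r / 4)%R by rewrite divr_gt0.
have -> : (c / 4 * (1 / 4) ^+ n * (2 * kap * ln 2) * r ^+ n)%:E =
    \int[lambda n]_w (c / 4 * (r / 4) ^+ n * annulus (r / 4) (r / 2) w z0)%:E.
  under eq_integral do rewrite EFinM.
  rewrite ge0_integralZl//; last 2 first.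
  - exact/measurable_EFinP.
  - by move=> w _; rewrite lee_fin annulus_ge0.
  rewrite integral_annulusE//; last by lra.
  rewrite -EFinM -ln_div ?posrE//; last by rewrite divr_gt0.
  rewrite (_ : r / 2 / (r / 4) = 2)%R; last by field; rewrite gt_eqF.
  by rewrite !expr_div_n expr1n; congr EFin; ring.
apply: ge0_le_integral => //.
- by move=> w _; rewrite lee_fin mulr_ge0// annulus_ge0.
- by apply/measurable_EFinP; apply: measurable_funM.
- exact/measurable_EFinP.
move=> w _; rewrite lee_fin /annulus ez.
case: (boolP (_ <= _ <= _)%R) => [/andP[rw wr]|_]; last by rewrite mul0r mulr0.
rewrite mul1r.
have w0 : (0 < enorm w)%R by exact: lt_le_trans rw.
have w1 : (enorm w <= 2 * (1 / 2))%R by lra.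
have rh := gnomonic_density_ge w1; rewrite -/c in rh.
have t : (1 / 2 <= tent r w)%R.
  rewrite le_max; apply/orP; right.
  have : (enorm w / r <= 1 / 2)%R by rewrite ler_pdivrMr//; lra.
  lra.
have t2 : (1 / 4 <= tent r w ^+ 2)%R.
  rewrite (_ : 1 / 4 = (1 / 2) ^+ 2)%R; last by field.
  by rewrite ler_pXn2r// nnegrE ?tent_ge0//.
have q : ((r / 4) ^+ n * (enorm w ^+ n)^-1 <= 1)%R.
  rewrite -expr_div_n exprn_ile1//; first exact: divr_ge0 (ltW r40) (ltW w0).
  by rewrite ler_pdivrMr// mul1r.
have q0 : (0 <= (r / 4) ^+ n * (enorm w ^+ n)^-1)%R.
  by have := ltW w0 => ?; nneg.
rewrite (_ : _ * _ / _ = (c * (1 / 4)) * ((r / 4) ^+ n * (enorm w ^+ n)^-1))%R; last by field; rewrite expf_neq0// gt_eqF.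
apply: (@le_trans _ _ (c * (1 / 4))%R); first by rewrite ler_piMr// mulr_ge0.
by apply: ler_pM.
Qed.

Lemma mass_gt0 r : (0 < r)%R -> (r <= 1)%R -> (0 < mass r)%R.
Proof.
move=> r0 r1; apply: lt_le_trans (mass_ge r0 r1).
have ln2 : (0 < ln 2 :> R)%R by rewrite ln_gt0// ltr1n.
have c0 : (0 < ((1 + 4 * (1 / 2) ^+ 2) ^+ n.+1)^-1 :> R)%R.
  by rewrite invr_gt0 exprn_gt0//; have := sqr_ge0 (1 / 2 : R)%R; lra.
have p4 : (0 < (1 / 4 : R) ^+ n)%R by rewrite exprn_gt0//; lra.
by rewrite !mulr_gt0 ?exprn_gt0 ?kap_gt0//; lra.
Qed.

Lemma integral_tent_le r : (0 < r)%R ->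
  \int[sigma]_(x in sphere) (sphere_tent r x)%:E <=
  (2 * (expR 1 * pi `^ (n%:R / 2) * r ^+ n))%:E.
Proof.
move=> r0; rewrite ge0_integral_sphere//; last 2 first.
- by apply/measurable_EFinP; exact: measurable_sphere_tent.
- by move=> x; rewrite lee_fin sphere_tent_ge0.
have mb : measurable_fun setT (fun z : euclid R n => ((enorm z <= r)%R%:R : R)%:E).
  apply/measurable_EFinP; apply: measurable_fun_natr_bool.
  by apply: measurable_fun_ler => //; exact: measurable_enorm.
rewrite EFinM; apply: le_trans (_ : _ <= 2%:E * \int[lambda n]_w ((enorm w <= r)%R%:R)%:E) _; last first.
  by rewrite lee_wpmul2l// integral_ball_le.
rewrite -ge0_integralZl//.
apply: ge0_le_integral => //.
- move=> w _; rewrite -EFinD -EFinM lee_fin.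
  by rewrite mulr_ge0 ?addr_ge0 ?sphere_tent_ge0 ?gnomonic_density_ge0.
- apply: emeasurable_funM; first exact/measurable_EFinP.
  by apply: emeasurable_funD; apply/measurable_EFinP;
    apply: (measurableT_comp (measurable_sphere_tent r)); exact: measurable_gnomonic.
- by apply: emeasurable_funM.
- move=> w _; rewrite !sphere_tent_gnomonic -EFinD -!EFinM lee_fin.
  have [wr|rw] := leP (enorm w) r; last first.
    by rewrite (tent_eq0 r0 (ltW rw)) addr0 !mulr0.
  rewrite mulr1 (_ : 2 = 1 * 2)%R; last by rewrite mul1r.
  apply: ler_pM; rewrite ?gnomonic_density_ge0 ?gnomonic_density_le1 ?addr_ge0 ?tent_ge0//.
  by have := tent_le1 w r0; lra.
Qed.

Lemma mass_le r : (0 < r)%R ->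
  (mass r <= expR 1 * pi `^ (n%:R / 2) * r ^+ n)%R.
Proof.
move=> r0; rewrite -lee_fin -integral_mass//.
apply: le_trans (@integral_ball_le R n r r0).
apply: ge0_le_integral => //.
- by move=> w _; rewrite lee_fin.
- exact/measurable_EFinP.
- apply/measurable_EFinP; apply: measurable_fun_natr_bool.
  by apply: measurable_fun_ler => //; exact: measurable_enorm.
- move=> w _; rewrite lee_fin.
  have [wr|rw] := leP (enorm w) r; last first.
    by rewrite (tent_eq0 r0 (ltW rw)) expr0n/= mulr0.
  by rewrite mulr_ile1 ?gnomonic_density_ge0 ?sqr_ge0 ?gnomonic_density_le1 ?exprn_ile1 ?tent_ge0 ?tent_le1.
Qed.

End energy_estimates.

Section entropy_estimate.
Context {R : realType}.
Variable n : nat.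
Hypothesis n0 : (0 < n)%N.
Local Notation sphere := (unit_sphere R n.+1).
Local Notation sigma := (surface_measure R n).
Local Notation area := (@sphere_area R n).
Local Open Scope ereal_scope.

Lemma mass_le_area r : (0 < r)%R -> (mass n r <= area / 2)%R.
Proof.
move=> r0; rewrite -lee_fin -integral_mass// -integral_gnomonic_density//.
have mrho := @measurable_gnomonic_density R n.
apply: ge0_le_integral => //.
- by move=> z _; rewrite lee_fin; nneg.
- apply/measurable_EFinP; apply: measurable_funM => //.
  by apply: measurable_funX; exact: measurable_tent.
- exact/measurable_EFinP.
- move=> z _; rewrite lee_fin ler_piMr ?gnomonic_density_ge0//.
  by rewrite exprn_ile1 ?tent_ge0 ?tent_le1.
Qed.

(** The error term is t^2 ln(t^2) = 2 t (t ln t), and -1 <= t ln t <= 0 because ln(1/t) < 1/t. *)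
Lemma mul_sqr_ln_bounds (t A : R) : (0 <= t <= 1)%R -> (0 < A)%R ->
  (t ^+ 2 * ln A - 2 * t <= t ^+ 2 * ln (t ^+ 2 * A) <= t ^+ 2 * ln A)%R.
Proof.
move=> /andP[t0 t1] A0; have [->|tn0] := eqVneq t 0%R.
  by rewrite expr0n/= !mul0r mulr0 subr0 lexx.
have tp : (0 < t)%R by rewrite lt_neqAle eq_sym tn0.
rewrite lnM ?posrE ?exprn_gt0// lnXn// mulrDr.
have l0 : (ln t <= 0)%R by exact: ln_le0.
have l1 : (- 1 <= t * ln t)%R.
  have : (ln t^-1 < t^-1)%R by apply: ln_sublinear; rewrite invr_gt0.
  rewrite lnV ?posrE// => h; rewrite -lerN2 opprK -mulrN.
  rewrite -[leRHS](mulfV tn0); apply: ler_wpM2l => //; exact: ltW.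
have : (t * (t * ln t) >= t * -1)%R by rewrite ler_wpM2l.
have : (t ^+ 2 * ln t <= 0)%R by rewrite mulr_ge0_le0// sqr_ge0.
rewrite expr2; set a := (t * (t * _))%R; set b := (t * t * ln A)%R.
rewrite (_ : t * t * (ln t *+ 2) = 2 * a)%R; last by rewrite /a; ring.
rewrite (_ : t * t * ln t = a)%R; last by rewrite /a; ring.
by move=> h1 h2; apply/andP; split; lra.
Qed.

Lemma integrable_sphere (f : euclid R n.+1 -> R) (B : R) :
  measurable_fun setT f -> (forall x, `|f x| <= B)%R ->
  sigma.-integrable sphere (EFin \o f).
Proof.
move=> mf fB; apply: measurable_bounded_integrable.
- exact: measurable_unit_sphere.
- have h := @sphere_area_fin R n; change (surface_measure R n sphere < +oo).
  by rewrite h ltry.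
- exact: measurable_funTS.
- exists B; split; first exact: num_real.
  by move=> M BM x _ /=; rewrite (le_trans (fB x))// ltW.
Qed.

(** The constant ln(area / N) integrates exactly against u^2. The remainder u^2 ln(u^2) lies between
    -2 u and 0, and the integral of u is O(r^n). *)
Lemma entropy_bounds r : (0 < r)%R -> (r <= 1)%R ->
  let N := (2 * mass n r)%R in
  entropy (sphere_tent (n := n) r) \is a fin_num /\
  (N * ln (area / N) - 4 * (expR 1 * pi `^ (n%:R / 2) * r ^+ n) <=
    fine (entropy (sphere_tent (n := n) r)) <= N * ln (area / N))%R.
Proof.
move=> r0 r1 N.
have N0 : (0 < N)%R by rewrite mulr_gt0// mass_gt0.
have a0 : (0 < area)%R.
  by have := mass_le_area r0; have := mass_gt0 n0 r0 r1; lra.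
have A0 : (0 < area / N)%R by rewrite divr_gt0.
set u := sphere_tent (n := n) r.
have mu_ : measurable_fun setT u by exact: measurable_sphere_tent.
have u01 x : (0 <= u x <= 1)%R by rewrite sphere_tent_ge0 sphere_tent_le1.
pose f x := (u x ^+ 2 * ln (u x ^+ 2 * (area / N)))%R.
pose g x := (u x ^+ 2 * ln (area / N))%R.
have -> : entropy u = \int[sigma]_(x in sphere) (f x)%:E.
  rewrite /entropy (norm2_sphere_tent n0 r0); apply: eq_integral => x _.
  by rewrite real_normK ?num_real// /f mulrA.
have fg x : (g x - 2 * u x <= f x <= g x)%R by exact: mul_sqr_ln_bounds.
have mg : measurable_fun setT g.
  by apply: measurable_funM => //; exact: measurable_funX.
have mf : measurable_fun setT f.
  apply: measurable_funM; first exact: measurable_funX.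
  by apply: measurable_fun_ln; apply: measurable_funM => //; exact: measurable_funX.
have u2 x : (0 <= u x ^+ 2 <= 1)%R.
  by have /andP[h0 h1] := u01 x; rewrite sqr_ge0 exprn_ile1.
have gB x : (`|g x| <= `|ln (area / N)|)%R.
  have /andP[h0 h1] := u2 x.
  by rewrite normrM (ger0_norm h0) ler_piMl.
have fB x : (`|f x| <= `|ln (area / N)| + 2)%R.
  have /andP[h0 h1] := u01 x; have /andP[k0 k1] := fg x.
  have := gB x; rewrite ler_norml => /andP[l0 l1].
  by rewrite ler_norml; apply/andP; split; lra.
have If : sigma.-integrable sphere (EFin \o f) by exact: integrable_sphere fB.
have Ig : sigma.-integrable sphere (EFin \o g) by exact: integrable_sphere gB.
have uB x : (`|2 * u x| <= 2)%R.
  have /andP[h0 h1] := u01 x; rewrite ger0_norm; [lra|].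
  by rewrite mulr_ge0.
have Iu : sigma.-integrable sphere (EFin \o (fun x => 2 * u x)%R).
  by apply: integrable_sphere uB; exact: measurable_funM.
have u2B x : (`|u x ^+ 2| <= 1)%R.
  by have /andP[h0 h1] := u2 x; rewrite ger0_norm.
have Iu2 : sigma.-integrable sphere (EFin \o (fun x => u x ^+ 2)%R).
  by apply: integrable_sphere u2B; exact: measurable_funX.
have mS := @measurable_unit_sphere R n.
have gE : \int[sigma]_(x in sphere) (g x)%:E = (N * ln (area / N))%:E.
  transitivity (\int[sigma]_(x in sphere) ((ln (area / N))%:E * (u x ^+ 2)%:E)).
    by apply: eq_integral => x _; rewrite -EFinM mulrC.
  rewrite integralZl// (mulrC N) EFinM; congr (_ * _).
  rewrite -(norm2_sphere_tent n0 r0); apply: eq_integral => x _.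
  by rewrite real_normK ?num_real.
have ffin : \int[sigma]_(x in sphere) (f x)%:E \is a fin_num.
  exact: integrable_fin_num.
split => //; rewrite -!lee_fin fineK//; apply/andP; split; last first.
  rewrite -gE; apply: le_integral => // x _.
  by rewrite lee_fin; have /andP[] := fg x.
apply: (@le_trans _ _ (\int[sigma]_(x in sphere) (g x - 2 * u x)%:E)); last first.
  apply: le_integral => //.
    by apply: eq_integrable (integrableB mS Ig Iu) => // x _.
  by move=> x _; rewrite lee_fin; have /andP[] := fg x.
under eq_integral do rewrite EFinB.
rewrite integralB_EFin// gE EFinB leeB//.
rewrite (_ : 4 = 2 * 2)%R; last by ring.
rewrite -mulrA EFinM; under eq_integral do rewrite EFinM.
rewrite ge0_integralZl//.
- by rewrite lee_wpmul2l// integral_tent_le.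
- by apply/measurable_EFinP; exact: measurable_funTS.
- by move=> x _; rewrite lee_fin; have /andP[] := u01 x.
Qed.

End entropy_estimate.

(** * Distance of the tents to the optimizers *)

Section distance_estimate.
Context {R : realType}.
Local Notation lambda := (@lebesgue_measuren R).
Variable n : nat.
Hypothesis n0 : (0 < n)%N.
Local Notation rho := (@gnomonic_density R n).
Local Notation kap := (fine (@radial_constant R n)).
Implicit Types (w z : euclid R n) (c r d : R) (xi : euclid R n.+1).
Local Open Scope ereal_scope.

Lemma measurable_optimizer c xi : measurable_fun setT (optimizer c xi).
Proof.
apply: measurable_funM => //; apply: measurable_fun_powR.
by apply: measurable_funB => //; apply: measurable_fun_dot.
Qed.

(** Since |xi| < 1, the base 1 - xi.x is positive on the sphere, and its negative power increases
    with xi.x; a negative c reverses the order. *)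
Lemma optimizer_le c xi (x y : euclid R n.+1) : unit_ball R n.+1 xi ->
  unit_sphere R n.+1 x -> unit_sphere R n.+1 y ->
  (0 <= (-1) ^+ (c < 0)%R * (dot xi y - dot xi x))%R ->
  (optimizer c xi x <= optimizer c xi y)%R.
Proof.
rewrite /unit_ball /unit_sphere /= => xi1 x1 y1.
have pos (t : euclid R n.+1) : enorm t = 1%R -> (0 < 1 - dot xi t)%R.
  move=> t1; rewrite subr_gt0; apply: le_lt_trans (ler_norm _) _.
  by apply: le_lt_trans (dot_le_enorm xi t) _; rewrite t1 mulr1.
have px := pos _ x1; have py := pos _ y1.
have n20 : (0 <= n%:R / 2 :> R)%R by rewrite divr_ge0.
have mono (a b : R) : (0 < a)%R -> (a <= b)%R ->
    (b `^ (- (n%:R / 2)) <= a `^ (- (n%:R / 2)))%R.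
  move=> a0 ab; have b0 := lt_le_trans a0 ab.
  rewrite !powRN lef_pV2 ?posrE ?powR_gt0//.
  by apply: ge0_ler_powR; rewrite ?nnegrE//; exact: ltW.
rewrite /optimizer; case: ltP => c0.
  rewrite expr1 mulN1r opprB subr_ge0 => yx.
  by rewrite ler_nM2l// mono// lerB.
rewrite expr0 mul1r subr_ge0 => xy.
by rewrite ler_wpM2l// mono// lerB.
Qed.

(** The map w -> 2 z - w, written with [eaff] so that [ge0_integral_eaff] gives its invariance. *)
Definition point_reflection z w : euclid R n :=
  eaff (-1) (eaff 2 [tuple of nseq n 0%R] z) w.

Lemma tnth_point_reflection z w i :
  tnth (point_reflection z w) i = (2 * tnth z i - tnth w i)%R :> R.
Proof.
rewrite /point_reflection !tnth_mktuple.
have z0 : tnth [tuple of nseq n (0%R : measurableTypeR R)] i = 0%R.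
  by rewrite (tnth_nth 0%R) nth_nseq if_same.
by rewrite z0 addr0 mulN1r addrC.
Qed.

Lemma edist_point_reflection z w : edist (point_reflection z w) z = edist w z.
Proof.
rewrite /edist; congr Num.sqrt; apply: eq_bigr => i _.
by rewrite tnth_point_reflection; ring.
Qed.

Lemma dot_tcons_point_reflection xi z w :
  (dot xi (tcons (1, w)) + dot xi (tcons (1, point_reflection z w)) =
   2 * dot xi (tcons (1, z)))%R.
Proof.
rewrite /dot mulr_sumr -big_split/=; apply: eq_bigr => i _.
rewrite /tcons; have [j ->|->] := unliftP ord0 i; last by rewrite !tnth0; ring.
by rewrite !tnthS tnth_point_reflection; ring.
Qed.

Definition above c xi w z : bool :=
  [exists b : bool, optimizer c xi (gnomonic b z) <= optimizer c xi (gnomonic b w)]%R.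

Lemma dot_gnomonic_tcons xi b w :
  (dot xi (gnomonic b w) = (-1) ^+ b * dot xi (tcons (1, w)) / proj_norm w)%R.
Proof.
rewrite /dot mulr_sumr mulr_suml; apply: eq_bigr => i _.
by rewrite tnth_mktuple; ring.
Qed.

Lemma proj_norm_le_enorm w z : (enorm z <= enorm w)%R -> (proj_norm z <= proj_norm w)%R.
Proof.
move=> zw; rewrite /proj_norm ler_wsqrtr// lerD2l -!enorm_sqr.
by rewrite ler_pXn2r// nnegrE enorm_ge0.
Qed.

(** Up to the sign of c, l b is the linear form xi evaluated at +-(1, w). It is affine in w, so its
    values at w and at the reflected point average to l b z, and one of them, at v say, is at least
    l b z. The optimizer is monotone in l b v / [proj_norm v]. As |v| >= |z| and l b z <= 0, passing
    to the larger denominator raises l b z / [proj_norm z], so the inequality survives the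
    projection. *)
Lemma above_or_reflection c xi r w z : unit_ball R n.+1 xi ->
  (enorm z <= r)%R -> (2 * r <= edist w z)%R ->
  above c xi w z || above c xi (point_reflection z w) z.
Proof.
move=> xi1 zr rD.
pose e := (c < 0)%R.
pose l (b : bool) w := ((-1) ^+ e * ((-1) ^+ b * dot xi (tcons (1, w))))%R.
(* The form changes sign with b: this choice of pole is the reason for having two bumps. *)
have [b lz] : exists b : bool, (l b z <= 0)%R.
  have [h|h] := leP (l false z) 0%R; first by exists false.
  exists true; move: h; rewrite /l expr0 mul1r expr1 mulN1r mulrN oppr_le0.
  exact: ltW.
have lsum : (l b w + l b (point_reflection z w) = 2 * l b z)%R.
  by rewrite /l -mulrDr -mulrDr dot_tcons_point_reflection; ring.
have main v : (2 * r <= edist v z)%R -> (l b z <= l b v)%R -> above c xi v z.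
  move=> vD lv; apply/existsP; exists b; apply: optimizer_le => //; try exact: gnomonic_sphere.
  rewrite !dot_gnomonic_tcons mulrBr !mulrA -/e.
  rewrite -[X in (X / _ - _)%R]mulrA -[X in (_ - X / _)%R]mulrA -/(l b v) -/(l b z).
  have Nz := proj_norm_gt0 z; have Nv := proj_norm_gt0 v.
  have zv : (proj_norm z <= proj_norm v)%R.
    apply: proj_norm_le_enorm.
    have := edist_le_enormD v z; lra.
  rewrite subr_ge0; apply: (@le_trans _ _ (l b z / proj_norm v)%R).
    by rewrite ler_wnM2l// lef_pV2 ?posrE.
  by rewrite ler_pM2r// invr_gt0.
have [h|h] := leP (l b z) (l b w); first by rewrite main.
by rewrite orbC main// ?edist_point_reflection//; lra.
Qed.

Let measurable_above c xi : measurable_fun setT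
  (fun x : euclid R n * euclid R n => above c xi x.1 x.2).
Proof.
rewrite (_ : (fun x => _) = (fun x : euclid R n * euclid R n =>
  (optimizer c xi (gnomonic true x.2) <= optimizer c xi (gnomonic true x.1))%R ||
  (optimizer c xi (gnomonic false x.2) <= optimizer c xi (gnomonic false x.1))%R)); last first.
  apply/funext => x; apply/existsP/orP => [[[]]|[]]; [by left|by right|by exists true|by exists false].
have mo b := measurableT_comp (measurable_optimizer c xi) (@measurable_gnomonic R n b).
by apply: measurable_or; apply: measurable_fun_ler;
  [exact: (measurableT_comp (mo true) measurable_snd)
  |exact: (measurableT_comp (mo true) measurable_fst)
  |exact: (measurableT_comp (mo false) measurable_snd)
  |exact: (measurableT_comp (mo false) measurable_fst)].
Qed.

Let above_annulus c xi a b w z : R := ((above c xi w z)%:R * annulus a b w z)%R.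

Let above_annulus_ge0 c xi a b w z : (0 <= above_annulus c xi a b w z)%R.
Proof. by rewrite mulr_ge0// annulus_ge0. Qed.

Let measurable_above_annulus c xi a b : measurable_fun setT
  (fun x : euclid R n * euclid R n => above_annulus c xi a b x.1 x.2).
Proof.
apply: measurable_funM; last exact: measurable_annulus.
exact: measurable_fun_natr_bool.
Qed.

(** Half of [integral_annulus]: the reflection at z preserves the annulus and the measure, and the
    indicators of [above] at w and at its reflection sum to at least 1. *)
Lemma integral_above_annulus c xi r d z : unit_ball R n.+1 xi ->
  (0 < r)%R -> (2 * r < d)%R -> (enorm z <= r)%R ->
  (kap * (ln d - ln (2 * r)))%:E <=
  \int[lambda n]_w (above_annulus c xi (2 * r) d w z)%:E.
Proof.
move=> xi1 r0 rd zr; set I := (X in _ <= X); set f := fun w => above_annulus c xi (2 * r)%R d w z.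
have IE : \int[lambda n]_w (f w)%:E = I by [].
have mf : measurable_fun setT (fun w => (f w)%:E).
  exact: (measurable_section z (measurable_above_annulus c xi (2 * r)%R d)).
have f0 w : 0 <= (f w)%:E by rewrite lee_fin above_annulus_ge0.
have fr : \int[lambda n]_w (f (point_reflection z w))%:E = \int[lambda n]_w (f w)%:E.
  rewrite [RHS](@ge0_integral_eaff _ _ _ (-1)%R (eaff 2 [tuple of nseq n 0%R] z))//.
  by rewrite normrN1 expr1n mul1e.
have mfr : measurable_fun setT (fun w => (f (point_reflection z w))%:E).
  exact: (measurableT_comp mf (measurable_eaff _ _)).
have : (2 * kap * (ln d - ln (2 * r)))%:E <=
    \int[lambda n]_w (f w)%:E + \int[lambda n]_w (f w)%:E.
  rewrite -[X in _ <= _ + X]fr -ge0_integralD// -(@integral_annulus R n n0 z)//; last by rewrite mulr_gt0.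
  apply: ge0_le_integral => //.
  - by move=> w _; rewrite lee_fin annulus_ge0.
  - exact: (measurable_section z (measurable_annulus (2 * r)%R d)).
  - exact: emeasurable_funD.
  move=> w _; rewrite -EFinD lee_fin -/(annulus (2 * r) d w z).
  rewrite /f /above_annulus.
  have -> : annulus (2 * r) d (point_reflection z w) z = annulus (2 * r) d w z.
    by rewrite /annulus edist_point_reflection.
  rewrite -mulrDl -natrD.
  have A0 := annulus_ge0 (2 * r) d w z.
  have [rD|Dr] := leP (2 * r)%R (edist w z); last first.
    by rewrite (_ : annulus _ _ _ _ = 0%R) ?mulr0// /annulus leNgt Dr mul0r.
  by rewrite ler_peMl// ler1n; case/orP: (above_or_reflection c xi1 zr rD) => ->; rewrite ?addn1.
have : 0 <= \int[lambda n]_w (f w)%:E by exact: integral_ge0.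
(* Halving the inequality needs a finite integral; an infinite one satisfies the bound trivially. *)
rewrite IE; case: I {IE} => [x| |] // I0.
  by rewrite -EFinD !lee_fin => h; clear -h; lra.
by move=> _; rewrite leey.
Qed.

Definition distance_term r c xi (b b' : bool) w z : R :=
  (`|tent r w - optimizer c xi (gnomonic b w) - tent r z +
     optimizer c xi (gnomonic b' z)| ^+ 2 /
   edist (gnomonic b w) (gnomonic b' z) ^+ n)%R.

Definition distance_density r c xi w z : R :=
  let D b b' := distance_term r c xi b b' w z in
  (rho z * rho w * (D false false + D true false + (D false true + D true true)))%R.

Let sqr_kernel c xi r (x : euclid R n.+1 * euclid R n.+1) : R :=
  (`|sphere_tent r x.1 - optimizer c xi x.1 - sphere_tent r x.2 + optimizer c xi x.2| ^+ 2 /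
   edist x.1 x.2 ^+ n)%R.

Let measurable_sqr_kernel c xi r : measurable_fun setT (sqr_kernel c xi r).
Proof.
have mt : measurable_fun setT (sphere_tent (n := n) r) by exact: measurable_sphere_tent.
have mo := measurable_optimizer c xi.
apply: measurable_funM.
  apply: measurable_funX; apply: (measurableT_comp (@normr_measurable _ _)).
  apply: measurable_funD; last exact: (measurableT_comp mo measurable_snd).
  apply: measurable_funB; last exact: (measurableT_comp mt measurable_snd).
  apply: measurable_funB; first exact: (measurableT_comp mt measurable_fst).
  exact: (measurableT_comp mo measurable_fst).
apply: measurable_fun_invr; apply: measurable_funX.
by apply: measurable_fun_edist; [exact: measurable_fst|exact: measurable_snd].
Qed.

Lemma double_int_distance r c xi :
  double_int (fun x y => sphere_tent r x - optimizer c xi x - sphere_tent r y +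
    optimizer c xi y)%R =
  \int[lambda n]_z \int[lambda n]_w (distance_density r c xi w z)%:E.
Proof.
rewrite /double_int (@ge0_double_integral_sphere R n n0 (EFin \o sqr_kernel c xi r)).
- apply: eq_integral => z _; apply: eq_integral => w _ /=.
  by rewrite /sqr_kernel/= !sphere_tent_gnomonic -!EFinD -!EFinM.
- by apply/measurable_EFinP; exact: measurable_sqr_kernel.
- by move=> x; rewrite lee_fin divr_ge0// ?exprn_ge0// euclid_edist_ge0.
Qed.

Let measurable_distance_density r c xi : measurable_fun setT
  (fun x : euclid R n * euclid R n => distance_density r c xi x.1 x.2).
Proof.
have mrho := @measurable_gnomonic_density R n.
have mD b b' : measurable_fun setT (fun x : euclid R n * euclid R n =>
    sqr_kernel c xi r (gnomonic b x.1, gnomonic b' x.2)).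
  apply: (measurableT_comp (measurable_sqr_kernel c xi r)).
  apply: measurable_fun_pair.
  - exact: (measurableT_comp (@measurable_gnomonic R n b) measurable_fst).
  - exact: (measurableT_comp (@measurable_gnomonic R n b') measurable_snd).
rewrite (_ : (fun x => _) = (fun x : euclid R n * euclid R n => rho x.2 * rho x.1 *
    (sqr_kernel c xi r (gnomonic false x.1, gnomonic false x.2) +
     sqr_kernel c xi r (gnomonic true x.1, gnomonic false x.2) +
     (sqr_kernel c xi r (gnomonic false x.1, gnomonic true x.2) +
      sqr_kernel c xi r (gnomonic true x.1, gnomonic true x.2))))%R); last first.
  by apply/funext => x; rewrite /distance_density /sqr_kernel/= !sphere_tent_gnomonic.
apply: measurable_funM.
  by apply: measurable_funM;
    [exact: (measurableT_comp mrho measurable_snd)|exact: (measurableT_comp mrho measurable_fst)].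
by apply: measurable_funD; apply: measurable_funD; exact: mD.
Qed.

Lemma distance_term_ge0 r c xi b b' w z : (0 <= distance_term r c xi b b' w z)%R.
Proof. by rewrite /distance_term divr_ge0// exprn_ge0// euclid_edist_ge0. Qed.

Lemma distance_term_ge r c xi b w z : (0 < r)%R -> (enorm z <= r)%R ->
  (2 * r <= edist w z)%R ->
  (optimizer c xi (gnomonic b z) <= optimizer c xi (gnomonic b w))%R ->
  (tent r z ^+ 2 * (edist w z ^+ n)^-1 <= distance_term r c xi b b w z)%R.
Proof.
move=> r0 zr rD; have zw := edist_le_enormD w z.
have edp : (0 < edist w z)%R by apply: lt_le_trans rD; rewrite mulr_gt0.
have tw : tent r w = 0%R by apply: tent_eq0 => //; lra.
have X := kernel_near_ge edp.
rewrite /distance_term (edist_gnomonic_addb b b) addbb -/(kernel_near w z) tw.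
move: (optimizer c xi _) (optimizer c xi _) => x y xy.
apply: ler_pM => //; first exact: sqr_ge0.
  by nneg.
have t0 := tent_ge0 r z.
(* After the change of sign the quantity is the tent at z plus the nonnegative increment of the
   optimizer from z to w. *)
rewrite real_normK ?num_real// sub0r -[leRHS]sqrrN ler_pXn2r// ?nnegrE//.
  by move: (tent r z) t0 => t t0; lra.
by move: (tent r z) t0 => t t0; lra.
Qed.

Lemma distance_density_ge r d c xi w z : (0 < r)%R -> (r <= d)%R ->
  (((1 + 4 * d ^+ 2) ^+ n.+1)^-1 *
     (rho z * tent r z ^+ 2 * above_annulus c xi (2 * r) d w z) <=
   distance_density r c xi w z)%R.
Proof.
move=> r0 rd; rewrite /distance_density /above_annulus /annulus.
have D0 b b' := distance_term_ge0 r c xi b b' w z.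
have RHS0 : (0 <= rho z * rho w *
    (distance_term r c xi false false w z + distance_term r c xi true false w z +
    (distance_term r c xi false true w z + distance_term r c xi true true w z)))%R.
  by rewrite !mulr_ge0 ?gnomonic_density_ge0 ?addr_ge0.
have [zr|zr] := leP r (enorm z).
  by rewrite (tent_eq0 r0 zr) expr0n/= mulr0 mul0r mulr0.
case: (boolP (_ <= _ <= _)%R) => [/andP[rD Dd]|_]; last by rewrite mul0r !mulr0.
case: (boolP (above c xi w z)) => [/existsP[b ab]|_]; last by rewrite mul0r !mulr0.
rewrite !mul1r; clear RHS0.
have Db := distance_term_ge r0 (ltW zr) rD ab.
have wd : (enorm w <= 2 * d)%R.
  by have := enorm_le_edistD z w; rewrite edistC; clear D0 Db; lra.
have rw := gnomonic_density_ge wd.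
(* Of the four pairs of hemispheres only the one with both points at the pole chosen by [above] is
   kept. *)
have DS : (distance_term r c xi b b w z <=
    distance_term r c xi false false w z + distance_term r c xi true false w z +
    (distance_term r c xi false true w z + distance_term r c xi true true w z))%R.
  case: (b); first by rewrite addrA lerDr !addr_ge0.
  by rewrite -!addrA lerDl !addr_ge0.
rewrite [leLHS](_ : _ = rho z * (((1 + 4 * d ^+ 2) ^+ n.+1)^-1 *
   (tent r z ^+ 2 * (edist w z ^+ n)^-1)))%R; last by ring.
rewrite -[leRHS]mulrA ler_wpM2l ?gnomonic_density_ge0//.
by apply: ler_pM; [nneg|nneg|exact: rw|exact: le_trans DS].
Qed.

Lemma double_int_distance_ge r d c xi : unit_ball R n.+1 xi ->
  (0 < r)%R -> (2 * r < d)%R ->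
  (((1 + 4 * d ^+ 2) ^+ n.+1)^-1 * (mass n r * (kap * (ln d - ln (2 * r)))))%:E <=
  double_int (fun x y => sphere_tent (n := n) r x - optimizer c xi x - sphere_tent r y +
    optimizer c xi y)%R.
Proof.
move=> xi1 r0 rd; have d0 : (0 < d)%R by lra.
set C := ((1 + _) ^+ n.+1)^-1%R; have C0 : (0 <= C)%R by rewrite /C; nneg.
have mrho := @measurable_gnomonic_density R n.
have mt : measurable_fun setT (fun z => rho z * tent r z ^+ 2)%R.
  by apply: measurable_funM => //; apply: measurable_funX; exact: measurable_tent.
pose g w z := (C * (rho z * tent r z ^+ 2 * above_annulus c xi (2 * r) d w z))%R.
have g0 w z : (0 <= g w z)%R.
  by have := above_annulus_ge0 c xi (2 * r) d w z => ?; rewrite /g; nneg.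
have mg : measurable_fun setT (fun x : euclid R n * euclid R n => g x.1 x.2).
  apply: measurable_funM => //; apply: measurable_funM => //.
  exact: (measurableT_comp mt measurable_snd).
have K0 : (0 <= kap * (ln d - ln (2 * r)))%R.
  rewrite mulr_ge0 ?(ltW (kap_gt0 n0))// subr_ge0 ler_ln ?posrE//; last by rewrite mulr_gt0.
  exact: ltW.
rewrite double_int_distance; apply: (@le_trans _ _ (\int[lambda n]_z \int[lambda n]_w (g w z)%:E)); last first.
  apply: ge0_le_double_integral => //.
  by move=> w z; apply: distance_density_ge => //; lra.
have -> : (C * (mass n r * (kap * (ln d - ln (2 * r)))))%:E =
    \int[lambda n]_z (C * (rho z * tent r z ^+ 2 * (kap * (ln d - ln (2 * r)))))%:E.
  transitivity (\int[lambda n]_z ((C * (kap * (ln d - ln (2 * r))))%:E *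
      (rho z * tent r z ^+ 2)%:E)); last first.
    by apply: eq_integral => z _; rewrite -EFinM; congr EFin; ring.
  rewrite ge0_integralZl//.
  - by rewrite integral_mass// -!EFinM; congr EFin; ring.
  - exact/measurable_EFinP.
  - by move=> z _; rewrite lee_fin; nneg.
  - by rewrite lee_fin mulr_ge0.
apply: ge0_le_integral => //.
- by move=> z _; rewrite lee_fin; nneg.
- apply/measurable_EFinP; apply: measurable_funM => //.
  exact: measurable_funM.
- exact: measurable_inner_integral.
move=> z _; have [rz|zr] := leP r (enorm z).
  rewrite (tent_eq0 r0 rz) expr0n/= mulr0 mul0r mulr0.
  by apply: integral_ge0 => w _; rewrite lee_fin.
rewrite /g; under eq_integral do rewrite mulrA EFinM.
rewrite ge0_integralZl//.
- rewrite [leLHS](_ : _ = (C * (rho z * tent r z ^+ 2))%:E *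
    (kap * (ln d - ln (2 * r)))%:E); last by rewrite -EFinM; congr EFin; ring.
  rewrite lee_wpmul2l//.
    by rewrite lee_fin; nneg.
  by apply: integral_above_annulus => //; exact: ltW.
- exact: measurable_section.
- by move=> w _; rewrite lee_fin.
- by rewrite lee_fin; nneg.
Qed.

End distance_estimate.

(** * The deficit of the tents *)

Section log_sobolev_estimate.
Context {R : realType}.
Variable n : nat.
Hypothesis n0 : (0 < n)%N.
Local Notation kap := (fine (@radial_constant R n)).
Local Notation area := (@sphere_area R n).
Local Notation ballc := (expR 1 * @pi R `^ (n%:R / 2)).
Implicit Types r d eta : R.

(** By convexity the power lies below its chord on [0, 1], of slope 2^k - 1; the induction needs
    this sharper slope. *)
Lemma expr1D_le k (x : R) : 0 <= x <= 1 -> (1 + x) ^+ k <= 1 + 2 ^+ k * x.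
Proof.
move=> /andP[x0 x1].
suff : (1 + x) ^+ k <= 1 + (2 ^+ k - 1) * x.
  by move=> h; apply: le_trans h _; lra.
elim: k => [|k IHk]; first by rewrite !expr0; lra.
rewrite !exprS; have k1 : 1 <= 2 ^+ k :> R by rewrite exprn_ege1// ler1n.
apply: (@le_trans _ _ ((1 + x) * (1 + (2 ^+ k - 1) * x))).
  by apply: ler_wpM2l => //; rewrite addr_ge0.
have : (2 ^+ k - 1) * x * x <= (2 ^+ k - 1) * x.
  by rewrite ler_piMr// mulr_ge0// subr_ge0.
lra.
Qed.

Lemma exists_small_radius k eta : 0 < eta ->
  exists2 d, 0 < d <= 1 / 2 & (1 + 4 * d ^+ 2) ^+ k <= 1 + eta.
Proof.
move=> e0; have k0 : 0 < 2 ^+ k :> R by rewrite exprn_gt0.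
(* The bound 1/2 gives 4 d^2 <= 2 d <= 1, so [expr1D_le] applies; the other one gives 2^k 2 d <=
   eta. *)
pose d := Num.min (1 / 2) (eta / 2 ^+ k / 2).
have d0 : 0 < d by rewrite lt_min divr_gt0//= !divr_gt0.
have d1 : d <= 1 / 2 by rewrite ge_min lexx.
have d2 : d <= eta / 2 ^+ k / 2 by rewrite ge_min lexx orbT.
exists d; first by rewrite d0.
have dd : d ^+ 2 <= d * (1 / 2) by rewrite expr2 ler_pM2l.
apply: le_trans (expr1D_le _ _) _.
  by apply/andP; split; [rewrite mulr_ge0// sqr_ge0|lra].
rewrite lerD2l mulrC -ler_pdivlMr//; lra.
Qed.

(** Converts every O(r^n) error into O(mass), the scale on which the deficit is measured. *)
Lemma exprn_le_mass : exists2 K : R, 0 < K &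
  forall r, 0 < r <= 1 -> r ^+ n <= K * mass n r.
Proof.
set c := ((1 + 4 * (1 / 2) ^+ 2) ^+ n.+1)^-1 / 4 * ((1 / 4) ^+ n) * (2 * kap * ln 2) : R.
have ln2 : 0 < ln 2 :> R by rewrite ln_gt0// ltr1n.
have c0 : 0 < c.
  have k0 := @kap_gt0 R n n0.
  have : 0 < 1 + 4 * (1 / 2) ^+ 2 :> R by have := sqr_ge0 (1 / 2 : R); lra.
  by move=> h; rewrite /c !mulr_gt0 ?invr_gt0 ?exprn_gt0 ?mulr_gt0 ?invr_gt0.
exists c^-1; first by rewrite invr_gt0.
by move=> r /andP[r0 r1]; rewrite mulrC ler_pdivlMr// mulrC; exact: mass_ge.
Qed.

Lemma ln_area_mass : exists2 K : R, 0 <= K &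
  forall r, 0 < r <= 1 -> `|ln (area / (2 * mass n r)) + n%:R * ln r| <= K.
Proof.
have [K K0 rK] := exprn_le_mass.
have [b b0 mass_le_b] : exists2 b, 0 < b & forall r, 0 < r -> mass n r <= b * r ^+ n.
  exists ballc; last exact: mass_le.
  by rewrite mulr_gt0 ?expR_gt0 ?powR_gt0 ?pi_gt0.
have a0 : 0 < area.
  have := mass_le_area n0 (@ltr01 R).
  by have := mass_gt0 n0 (@ltr01 R) (lexx _); lra.
exists (`|ln (area / (2 * b))| + `|ln (area * K / 2)|) => // r r01.
have /andP[r0 r1] := r01.
have m0 := mass_gt0 n0 r0 r1; have mb := mass_le_b r r0; have mK := rK _ r01.
have rn0 : 0 < r ^+ n by rewrite exprn_gt0.
have -> : n%:R * ln r = ln (r ^+ n) by rewrite lnXn// mulr_natl.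
have m20 : 0 < 2 * mass n r by rewrite mulr_gt0.
have A0 : 0 < area / (2 * mass n r) by rewrite divr_gt0.
rewrite -lnM ?posrE//.
have A1 : 0 < area / (2 * mass n r) * r ^+ n by rewrite mulr_gt0.
have B1 : 0 < area / (2 * b) by rewrite divr_gt0// mulr_gt0.
have B2 : 0 < area * K / 2 by rewrite divr_gt0// mulr_gt0.
have h1 : ln (area / (2 * b)) <= ln (area / (2 * mass n r) * r ^+ n).
  rewrite ler_ln ?posrE//.
  rewrite -mulrA ler_pM2l// ler_pdivlMl// ler_pdivrMr ?mulr_gt0//; lra.
have h2 : ln (area / (2 * mass n r) * r ^+ n) <= ln (area * K / 2).
  rewrite ler_ln ?posrE//.
  rewrite -!mulrA ler_pM2l// ler_pdivrMl//; lra.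
have := ler_norm (ln (area * K / 2)).
have := ler_norm (- ln (area / (2 * b))); rewrite normrN.
have := normr_ge0 (ln (area * K / 2)).
have := normr_ge0 (ln (area / (2 * b))).
by rewrite ler_norml => *; apply/andP; split; lra.
Qed.

(** The exact match of constants: the energy is led by 4 kappa N ln(1/r), and C_n times the entropy
    by C_n n N ln(1/r). *)
Lemma C_n_mul_dim : C_n n * n%:R = 4 * kap :> R.
Proof.
have [_ k0 pg] := @radial_constant_Gamma R n n0.
have g0 : Gamma (n%:R / 2 : R) != 0.
  apply/eqP => g0; move: pg; rewrite g0 mulr0 => /eqP.
  by rewrite gt_eqF// powR_gt0// pi_gt0.
have nn0 : n%:R != 0 :> R by rewrite pnatr_eq0 -lt0n.
by rewrite /C_n pg; field; rewrite nn0 g0.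
Qed.

Lemma LS_sphere_tent_le eta : 0 < eta -> exists K rho : R, 0 < rho /\
  forall r, 0 < r < rho -> LS (sphere_tent (n := n) r) \is a fin_num /\
    `|fine (LS (sphere_tent (n := n) r))| <= mass n r * (eta * - ln r + K).
Proof.
move=> e0; have k0 := @kap_gt0 R n n0.
(* The relative error eta' in the leading term 4 kappa (2 m) ln(1/r) amounts to eta m ln(1/r). *)
pose eta' := eta / (8 * kap).
have e'0 : 0 < eta' by rewrite divr_gt0// mulr_gt0.
have etaE : 8 * kap * eta' = eta by rewrite /eta'; field; rewrite gt_eqF.
(* The exponent n + 1 of the lower bound also controls the exponent n of the upper one, since the
   base is at least 1. *)
have [d /andP[d0 d1] dq] := exists_small_radius n.+1 e'0.
have [K0 K00 rK0] := exprn_le_mass.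
have [K1 K10 rK1] := ln_area_mass.
have Cn := C_n_mul_dim; set C := C_n n in Cn.
have C0 : 0 <= C.
  by rewrite -(pmulr_lge0 _ (_ : 0 < n%:R :> R)) ?ltr0n// Cn mulr_ge0// ltW.
have b0 : 0 < ballc by rewrite mulr_gt0 ?expR_gt0 ?powR_gt0 ?pi_gt0.
set x := 1 + 4 * d ^+ 2 in dq.
have x1 : 1 <= x by rewrite lerDl mulr_ge0// sqr_ge0.
have q1 : 1 <= x ^+ n.+1 by rewrite exprn_ege1.
have q0 : 0 < x ^+ n.+1 by rewrite (lt_le_trans ltr01).
have qn : x ^+ n <= 1 + eta' by apply: le_trans dq; rewrite exprS ler_peMl// exprn_ge0// (le_trans ler01).
have qV : 1 - eta' <= (x ^+ n.+1)^-1.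
  rewrite -[(_ ^+ _)^-1]mul1r ler_pdivlMr//.
  have [h|h] := leP (1 - eta') 0.
    by apply: le_trans ler01; rewrite mulr_le0_ge0// ltW.
  apply: (@le_trans _ _ ((1 - eta') * (1 + eta'))); first by rewrite ler_pM2l.
  by have := sqr_ge0 eta'; rewrite expr2; lra.
have qV1 : (x ^+ n.+1)^-1 <= 1 by rewrite invf_le1.
have qV0 : 0 < (x ^+ n.+1)^-1 by rewrite invr_gt0.
have lnd : ln d <= 0 by apply: ln_le0; lra.
have ln2 : 0 < ln 2 :> R by rewrite ln_gt0// ltr1n.
pose kp := 4 * kernel_bound n d * (area / 2).
pose Q := 2 * 5 ^+ n * kap * (ballc * 2 ^+ n).
have kp0 : 0 <= kp.
  have := kernel_bound_ge1 n d0; have : 0 <= area by exact: fine_ge0.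
  by move=> *; rewrite /kp !mulr_ge0//; lra.
have Q0 : 0 <= Q .
  have k1 := ltW k0; by rewrite /Q; nneg; [exact: expR_ge0|exact: powR_ge0].
(* In order: the pairs with bounded kernel, the pairs at distance at most r, the error of ln(area /
   N) against n ln(1/r), the remainder of the entropy, and the cutoffs 2 r and d in the lower bound
   on the energy. The radius d / 2 ensures 2 r < d. *)
exists (2 * kp + Q * K0 + 2 * C * K1 + 4 * C * ballc * K0 + 8 * kap * (ln 2 - ln d)).
exists (d / 2); split; first by rewrite divr_gt0.
move=> r /andP[r0 rd].
have r1 : r <= 1 by lra.
have r01 : 0 < r <= 1 by rewrite r0.
have rd' : r < d by lra.
have r2d : 2 * r < d by lra.
have mK := rK0 _ r01; have m0 := mass_gt0 n0 r0 r1.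
have El := energy_le n0 r0 rd' d1; have Eg := energy_ge n0 r0 r2d.
rewrite -/x in El Eg.
have [sfin] := entropy_bounds n0 r0 r1.
have := rK1 _ r01; rewrite ler_norml.
set u := sphere_tent r in El Eg sfin *; set m := mass n r in mK m0 El Eg *.
set l := ln (area / _); move=> /andP[l1 l2] /andP[s1 s2].
have efin : energy u \is a fin_num.
  rewrite fin_numElt; apply/andP; split.
    by apply: lt_le_trans Eg; exact: ltNyr.
  by apply: le_lt_trans El _; exact: ltry.
rewrite /LS -/C -(fineK efin) -(fineK sfin) -EFinM -EFinB; split => //=.
move: El Eg; rewrite -(fineK efin) !lee_fin /=.
move: (fine (energy u)) (fine (entropy u)) s1 s2 => e s s1 s2 e2 e1.
have lr : ln r < ln d by rewrite ltr_ln ?posrE.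
move: e1; rewrite lnM ?posrE//; move: l1 l2 lr e2.
rewrite exprMn.
rewrite -/kp; move: (ln r) => lr l1 l2 lrd e2 e1.
have Qm : 2 * 5 ^+ n * kap * (ballc * (2 ^+ n * r ^+ n)) <= Q * (K0 * m).
  by rewrite [leLHS](_ : _ = Q * r ^+ n) ?ler_wpM2l//; rewrite /Q; ring.
have a1 : x ^+ n * (ln d - lr) <= (1 + eta') * (- lr).
  by apply: ler_pM => //; [rewrite exprn_ge0// (le_trans ler01)|lra|lra].
have a2 : (1 - eta') * (- lr) - (ln 2 - ln d) <= (x ^+ n.+1)^-1 * (ln d - (ln 2 + lr)).
  have h1 : (1 - eta') * (- lr) <= (x ^+ n.+1)^-1 * (- lr).
    by apply: ler_wpM2r => //; lra.
  have h2 : (x ^+ n.+1)^-1 * (ln 2 - ln d) <= ln 2 - ln d.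
    by rewrite ler_piMl//; lra.
  lra.
have Cm0 : 0 <= C * m by rewrite mulr_ge0// ltW.
have C1 : C * (2 * m * l) <= 2 * m * (4 * kap * - lr + C * K1).
  rewrite -Cn; have : C * m * l <= C * m * (K1 - n%:R * lr).
    by rewrite (ler_wpM2l Cm0)// lerBrDr.
  move=> h; clear -h; lra.
have C2 : 2 * m * (4 * kap * - lr - C * K1) <= C * (2 * m * l).
  rewrite -Cn; have : C * m * (- K1 - n%:R * lr) <= C * m * l.
    by rewrite (ler_wpM2l Cm0)// lerBlDr.
  move=> h; clear -h; lra.
have s1' := ler_wpM2l C0 s1; have s2' := ler_wpM2l C0 s2.
have rn : C * (4 * (ballc * r ^+ n)) <= 4 * C * ballc * (K0 * m).
  have : C * ballc * (r ^+ n) <= C * ballc * (K0 * m).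
    by rewrite ler_wpM2l// mulr_ge0// ltW.
  lra.
have a1' : 4 * kap * (2 * m) * (x ^+ n * (ln d - lr)) <= 4 * kap * (2 * m) * ((1 + eta') * (- lr)).
  by rewrite ler_wpM2l// !mulr_ge0// ltW.
have a2' := ler_wpM2l (_ : 0 <= 4 * kap * (2 * m)) a2.
have [K00' m0' k0' b0'] := And4 (ltW K00) (ltW m0) (ltW k0) (ltW b0).
have QmK : 0 <= Q * K0 * m by nneg.
have e2' : e <= 4 * kap * (2 * m) * ((1 + eta') * - lr) + 2 * m * kp + Q * K0 * m.
  move: e2 Qm a1'; move: (x ^+ n) (2 * 5 ^+ n * kap * _) => y z e2 Qm a1'.
  clear -e2 Qm a1'; lra.
have e1' : 4 * kap * (2 * m) * ((1 - eta') * - lr - (ln 2 - ln d)) <= e.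
  have k8 : 0 <= 4 * kap * (2 * m) by nneg.
  apply: le_trans e1; apply: le_trans (a2' k8) _.
  by rewrite le_eqVlt; apply/orP; left; apply/eqP; ring.
have CK : 0 <= C * K1 * m by nneg.
have CbK : 0 <= C * ballc * K0 * m by nneg.
have kpm : 0 <= kp * m by nneg.
have kdm : 0 <= kap * (ln 2 - ln d) * m by do 2!apply: mulr_ge0 => //; lra.
rewrite ler_norml -etaE.
move: (ballc) s1 s1' s2' rn CbK => b s1 s1' s2' rn CbK.
clear -e1' e2' C1 C2 s1' s2' rn CK CbK kpm kdm QmK.
apply/andP; split; lra.
Qed.
End log_sobolev_estimate.

(** * Membership in the domain and distance to the set of optimizers *)

Section distance_to_optimizers.
Context {R : realType}.
Variable n : nat.
Hypothesis n0 : (0 < n)%N.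
Local Notation kap := (fine (@radial_constant R n)).
Local Notation q := ((1 + 4 * (1 / 2) ^+ 2) ^+ n.+1 : R).
Local Open Scope ereal_scope.

Lemma energy_sphere_tent_lty (r : R) : (0 < r)%R -> (r < 1 / 2)%R ->
  energy (sphere_tent (n := n) r) < +oo.
Proof.
move=> r0 r1; apply: le_lt_trans (energy_le n0 r0 r1 (lexx _)) _; exact: ltry.
Qed.

Lemma D_L_sphere_tent (r : R) : (0 < r)%R -> (r < 1 / 2)%R ->
  D_L R n (sphere_tent r).
Proof.
move=> r0 r1; split.
- by apply: measurable_funTS; exact: measurable_sphere_tent.
- by rewrite norm2_sphere_tent// ltry.
- exact: energy_sphere_tent_lty.
Qed.

Lemma d0_M_sphere_tent_fin (r : R) : (0 < r)%R -> (r < 1 / 2)%R ->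
  d0_M (sphere_tent (n := n) r) \is a fin_num.
Proof.
move=> r0 r1; rewrite ge0_fin_numE; last first.
  by apply: le_ereal_inf_tmp => _ [v _ <-]; exact: sqrte_ge0.
pose o : euclid R n.+1 := [tuple of nseq n.+1 0%R].
(* The zero function is the optimizer with c = 0; the distance to it is the square root of the
   energy. *)
apply: (@le_lt_trans _ _ (d0 (sphere_tent r) (optimizer 0 o))).
  apply: ereal_inf_lbound; exists (optimizer 0 o) => //; exists 0%R, o; split => //.
  rewrite /unit_ball/= /enorm /dot big1 ?sqrtr0// => i _.
  by rewrite (tnth_nth 0%R) nth_nseq if_same mul0r.
rewrite /d0 (_ : double_int _ = energy (sphere_tent (n := n) r)); last first.
  rewrite /energy; congr double_int; apply/funext => x; apply/funext => y.
  by rewrite /optimizer !mul0r subr0 addr0.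
have e0 : 0 <= energy (sphere_tent (n := n) r).
  apply: integral_ge0 => x _; apply: integral_ge0 => y _.
  by rewrite lee_fin divr_ge0// exprn_ge0// euclid_edist_ge0.
by rewrite -ge0_fin_numE ?sqrte_ge0// sqrte_fin_num// ge0_fin_numE// energy_sphere_tent_lty.
Qed.

(** [double_int_distance_ge] at d = 1/2 is uniform in c and xi, so it passes to the infimum; the
    last factor is ln(1/2) - ln(2 r). *)
Lemma d0_M_sphere_tent_ge (r : R) : (0 < r)%R -> (r < 1 / 4)%R ->
  (q^-1 * kap * (mass n r * (- ln r - 2 * ln 2)))%:E <=
  d0_M (sphere_tent (n := n) r) ^+ 2.
Proof.
move=> r0 r1; have r2 : (2 * r < 1 / 2)%R by lra.
set c := (X in X <= _).
have c0 : 0 <= c.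
  have k0 := ltW (@kap_gt0 R n n0); have m0 := @mass_ge0 R n r.
  rewrite lee_fin; apply: mulr_ge0; first by nneg.
  apply: mulr_ge0 => //.
  have : (ln (2 * r) <= ln (1 / 2))%R by rewrite ler_ln ?posrE ?mulr_gt0//; lra.
  by rewrite lnM ?posrE// ln_div ?posrE// ln1; lra.
rewrite -(sqr_sqrte c0) lee_sqr ?sqrte_ge0//; last first.
  by apply: le_ereal_inf_tmp => _ [v _ <-]; exact: sqrte_ge0.
apply: le_ereal_inf_tmp => _ [v [a [xi [xi1 ->]]] <-].
rewrite lee_sqrt//; last first.
  apply: integral_ge0 => x _; apply: integral_ge0 => y _.
  by rewrite lee_fin divr_ge0// exprn_ge0// euclid_edist_ge0.
apply: le_trans (double_int_distance_ge n0 a xi1 r0 r2).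
rewrite le_eqVlt; apply/orP; left; apply/eqP; congr EFin.
by rewrite lnM ?posrE// ln_div ?posrE// ln1; ring.
Qed.

End distance_to_optimizers.

(** * Passage to the limit *)

Lemma cvg_ratio0 (R : realType) (c b : R) (f : R^nat) : 0 < c ->
  (forall eta, 0 < eta -> exists K, \forall m \near \oo,
    `|f m| <= (eta * m%:R + K) / (c * (m%:R - b))) ->
  f @ \oo --> (0 : R).
Proof.
move=> c0 fle; apply/cvgr0Pnorm_le => e e0.
(* With eta = e c / 2 the numerator uses up half of e c m; the other half absorbs K + e c b for
   large m. *)
have ec0 : 0 < e * c / 2 by rewrite divr_gt0// mulr_gt0.
have [K fK] := fle _ ec0.
near=> m.
have mb : 0 < m%:R - b :> R.
  rewrite subr_gt0; apply: (@lt_le_trans _ _ (b + 1)); first by rewrite ltrDl.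
  by near: m; exact: nbhs_infty_ger.
apply: (@le_trans _ _ ((e * c / 2 * m%:R + K) / (c * (m%:R - b)))).
  by near: m.
rewrite ler_pdivrMr ?mulr_gt0//.
have : (K + e * c * b) / (e * c / 2) <= m%:R by near: m; exact: nbhs_infty_ger.
by rewrite ler_pdivrMr//; lra.
Unshelve. all: by end_near. Qed.

Theorem theorem1p4 (R : realType) (n : nat) (hn : (1 <= n)%N) :
  exists u : nat -> (euclid R n.+1 -> R),
    (forall m, D_L R n (u m) /\ (0 < d0_M (u m))%E) /\
    (fun m => (LS (u m) / d0_M (u m) ^+ 2)%E) @ \oo --> (0 : \bar R)%E.
Proof.
(* ln(1/r) grows linearly in m, and the shift by 4 makes the bounds for r < 1/4 available from m = 0
   on. *)
pose rad (m : nat) : R := expR (- (m%:R + 4)).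
have rad0 m : 0 < rad m by exact: expR_gt0.
have lnrad m : - ln (rad m) = m%:R + 4 by rewrite /rad expRK opprK.
have rad4 m : rad m < 1 / 4.
  rewrite /rad expRN div1r ltf_pV2 ?posrE ?expR_gt0//.
  apply: (@le_lt_trans _ _ (1 + (m%:R + 4))).
    by have := ler0n R m; lra.
  by apply: expR_gt1Dx; rewrite gt_eqF//; have := ler0n R m; lra.
have rad2 m : rad m < 1 / 2 by have := rad4 m; lra.
have rad1 m : rad m <= 1 by have := rad4 m; lra.
have k0 := @kap_gt0 R n hn.
pose c : R := ((1 + 4 * (1 / 2) ^+ 2) ^+ n.+1)^-1 * fine (radial_constant n).
have c0 : 0 < c.
  have q0 : 0 < 1 + 4 * (1 / 2) ^+ 2 :> R by have := sqr_ge0 (1 / 2 : R); lra.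
  by rewrite mulr_gt0// invr_gt0 exprn_gt0.
pose u m := sphere_tent (n := n) (rad m).
pose D m := fine (d0_M (u m) ^+ 2)%E.
(* Chosen so that - ln (rad m) - 2 ln 2 = m - b; it is negative because ln 2 < 2. *)
pose b : R := 2 * ln 2 - 4.
have ln2 : ln 2 < 2 :> R by exact: ln_sublinear.
have mb m : 0 < m%:R - b.
  by rewrite /b; have := ler0n R m; lra.
have dfin m : d0_M (u m) \is a fin_num by exact: d0_M_sphere_tent_fin.
have d2E m : (d0_M (u m) ^+ 2 = (D m)%:E)%E by rewrite fineK// fin_numX.
have m0 m : 0 < mass n (rad m) by exact: mass_gt0.
have Dge m : c * (mass n (rad m) * (m%:R - b)) <= D m.
  have := d0_M_sphere_tent_ge hn (rad0 m) (rad4 m).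
  rewrite -/(u m) d2E lee_fin lnrad; apply: le_trans.
  by rewrite -/c le_eqVlt; apply/orP; left; apply/eqP; rewrite /b; ring.
have D0 m : 0 < D m by apply: lt_le_trans (Dge m); rewrite !mulr_gt0.
exists u; split.
  move=> m; split; first exact: D_L_sphere_tent.
  rewrite lt_neqAle; apply/andP; split.
    apply/eqP => d00; have := D0 m; have := d2E m; rewrite -d00.
    by rewrite expe2 mule0 => -[<-]; rewrite ltxx.
  by apply: le_ereal_inf_tmp => _ [v _ <-]; exact: sqrte_ge0.
have LSle eta : 0 < eta -> exists K, \forall m \near \oo,
    LS (u m) \is a fin_num /\ `|fine (LS (u m))| <= mass n (rad m) * (eta * m%:R + K).
  move=> e0; have [K [rho [rho0 LSK]]] := LS_sphere_tent_le hn e0.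
  exists (eta * 4 + K); near=> m.
  have radrho : rad m < rho.
    rewrite -[rho]lnK ?posrE// /rad ltr_expR.
    suff : - ln rho <= m%:R by lra.
    by near: m; exact: nbhs_infty_ger.
  have [|LSf LSm] := LSK (rad m); first by rewrite rad0.
  split => //; apply: le_trans LSm _.
  by rewrite lnrad ler_pM2l// mulrDr addrA.
have ratioE m : LS (u m) \is a fin_num ->
    (LS (u m) / d0_M (u m) ^+ 2 = (fine (LS (u m)) / D m)%:E)%E.
  by move=> LSf; rewrite d2E inver gt_eqF// -{1}(fineK LSf).
(* The extended-real quotient is a real one as soon as [LS (u m)] is finite, which is known for
   large m only. *)
apply: cvg_EFin.
  by have [K] := LSle 1 ltr01; apply: filterS => m [/ratioE -> _].
apply: (cvg_ratio0 c0 (b := b)) => eta eta0.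
have [K LSK] := LSle eta eta0; exists K; near=> m.
have [LSf LSm] : LS (u m) \is a fin_num /\
    `|fine (LS (u m))| <= mass n (rad m) * (eta * m%:R + K) by near: m.
rewrite /= ratioE//= normrM normfV (gtr0_norm (D0 m)).
rewrite ler_pdivrMr//.
have n1 : 0 <= (eta * m%:R + K) / (c * (m%:R - b)).
  rewrite divr_ge0//; last by rewrite mulr_ge0// ltW.
  by rewrite -(pmulr_rge0 _ (m0 m)) (le_trans _ LSm).
(* The mass is a common factor of the bounds on the deficit and on the squared distance, and
   cancels. *)
apply: le_trans LSm _; apply: le_trans (ler_wpM2l n1 (Dge m)).
rewrite le_eqVlt; apply/orP; left; apply/eqP; field.
by rewrite !gt_eqF.
Unshelve. all: by end_near. Qed.
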